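(* Let $n\ge 1$, $c\in\mathbb{C}^n\setminus\{0\}$, let $p,p_1,\dots,p_6$ be polynomials on $\mathbb{C}^n$ with $p$ non-zero and irreducible, and let $L(f)=\sum_{j=1}^s q_{t_j}f_{z_{t_j}}$, where $1\le s\le n$, $1\le t_1<\dots<t_s\le n$ and the $q_{t_j}$ are non-zero polynomials on $\mathbb{C}^n$. Assume $D\not\equiv 0$ and $d_2\equiv 0$. Then for every entire solution $f$ on $\mathbb{C}^n$ of $$(p_{1} L(f)+p_{2}\overline{f}+p_5 f)^{2}+(p_{3}L(f)+p_{4}\overline{f}+p_6 f)^{2}=p$$ there exist $k\in\{1,-1\}$ and an entire function $g$ on $\mathbb{C}^n$ such that $$f=\frac{\underline{a_1}\,e^{i\underline{g}}-\underline{p}\,\underline{a_2}\,e^{-i\underline{g}}}{2i\underline{D}}\qquad( * )$$ and $g$ has one of the following properties: (i) $g$ is constant; (ii) $L(\underline{g})$ is a polynomial and either $g+\underline{g}$ or $g-\underline{g}$ is constant; (iii) $L(\underline{g})$ is transcendental, $g+\underline{g}$ is a non-constant entire function, and either $a_1\equiv b_2\equiv 0$ or $a_2\equiv b_1\equiv 0$. In addition, for any $j\in\{1,\dots,n\}$, if $L(f)=f_{z_j}$ and $d_1\equiv d_2\equiv 0$ (still with $D\not\equiv0$), then every entire solution $f$ has the form $( * )$ for some $k\in\{1,-1\}$ and some entire function $g$ with one of the following properties: (a) $g$ is constant; (b) $g_{z_j}\equiv 0$ and either $g+\underline{g}$ or $g-\underline{g}$ is constant; (c) $g_{z_j}$ is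 a non-zero polynomial, $g-\underline{g}$ is constant, and either $\deg_{z_j}\underline{g}_{z_j}=\deg_{z_j}b_1-\deg_{z_j}a_1$ or $\deg_{z_j}\underline{g}_{z_j}=\deg_{z_j}b_2-\deg_{z_j}a_2$; (d) $g_{z_j}$ is transcendental, $g+\underline{g}$ is a non-constant entire function, and either $a_1\equiv b_2\equiv 0$ or $a_2\equiv b_1\equiv 0$.
   Context: For a function $h$ on $\mathbb{C}^n$ and the fixed $c$, the bars denote shifts (not complex conjugation): $\overline{h}(z)=h(z+c)$, $\underline{h}(z)=h(z-c)$; $h_{z_j}=\partial h/\partial z_j$, and $\underline{g}_{z_j}=\partial(\underline g)/\partial z_j$. For $k\in\{1,-1\}$ put $a_1=kp_1-ip_3$, $a_2=kp_1+ip_3$, $b_1=kp_2-ip_4$, $b_2=kp_2+ip_4$, and put $d_1=p_2p_6-p_4p_5$, $d_2=p_3p_5-p_1p_6$, $D=p_1p_4-p_2p_3$. $\deg_{z_j}b$ is the degree of the polynomial $b$ in the variable $z_j$. An entire function is transcendental if it is not a polynomial. ''Irreducible'' means not a product of two non-constant polynomials; non-zero constants are allowed. *)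

(* Defs.v *)
From HB Require Import structures.
From mathcomp Require Import all_boot all_order all_algebra.
From mathcomp Require Import complex.
(* The notations of mpoly and of MathComp-Analysis declare clashing levels. *)
From mathcomp Require Import -(notations) mpoly.
From mathcomp Require Import all_classical all_reals.
From mathcomp Require Import topology normedtype sequences derive exp trigo.

Set Implicit Arguments.
Unset Strict Implicit.
Unset Printing Implicit Defensive.

Import Order.TTheory GRing.Theory Num.Theory.
Import numFieldNormedType.Exports.

Local Open Scope ring_scope.

(* As [numFieldNormedType] does for abstract fields: the topology and the norm
   of [R[i]] are those of [R[i]] as a normed module over itself. *)
#[non_forgetful_inheritance]
HB.instance Definition _ (R : realType) := GRing.ComAlgebra.copy R[i] R[i]^o.
#[non_forgetful_inheritance]
HB.instance Definition _ (R : realType) := Vector.copy R[i] R[i]^o.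
#[non_forgetful_inheritance]
HB.instance Definition _ (R : realType) := NormedModule.copy R[i] R[i]^o.

Section Defs.
Variables (R : realType) (n : nat).
Local Notation C := R[i].
Implicit Types (f g h : 'rV[C]_n -> C) (P Q : mpoly n C) (c z : 'rV[C]_n).

Definition expC (w : C) : C :=
  (expR (complex.Re w))%:C%C * (cos (complex.Im w) +i* sin (complex.Im w))%C.

Definition pfun P : 'rV[C]_n -> C := fun z => meval (z ord0) P.

(* The scalars are [C]: this is complex (Frechet) differentiability. *)
Definition entire f : Prop := forall z, differentiable f z.

Definition pderiv (j : 'I_n) f : 'rV[C]_n -> C :=
  fun z => 'D_(delta_mx ord0 j) f z.

Definition shiftp c h : 'rV[C]_n -> C := fun z => h (z + c).
Definition shiftm c h : 'rV[C]_n -> C := fun z => h (z - c).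

Definition constant_fun h : Prop := exists a : C, forall z, h z = a.
Definition polynomial_fun h : Prop := exists P, h =1 pfun P.
Definition transcendental h : Prop := entire h /\ ~ polynomial_fun h.

(* Non-zero constants are irreducible in this sense. *)
Definition irreducible_mpoly P : Prop :=
  forall Q1 Q2, P = Q1 * Q2 ->
    (exists a : C, Q1 = mpolyC n a) \/ (exists a : C, Q2 = mpolyC n a).

(* Degree in the [j]-th variable, with [deg 0 = -oo]. An equality
   [deg_in j Q = deg_in j P1 - deg_in j P2] with [Q != 0] thus forces [P1] and
   [P2] to be non-zero. *)
Definition deg_in (j : 'I_n) P : \bar int :=
  if P == 0 then -oo%E else ((\max_(m <- msupp P) m j)%N : int)%:E.

Definition diffop (s : nat) (t : 'I_s -> 'I_n) (q : 'I_s -> mpoly n C) f :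
    'rV[C]_n -> C :=
  fun z => \sum_(l < s) pfun (q l) z * pderiv (t l) f z.

(* [Lf] stands for the function [L(f)]. *)
Definition solves c (p p1 p2 p3 p4 p5 p6 : mpoly n C) Lf f : Prop :=
  forall z : 'rV[C]_n,
    (pfun p1 z * Lf z + pfun p2 z * shiftp c f z + pfun p5 z * f z) ^+ 2
    + (pfun p3 z * Lf z + pfun p4 z * shiftp c f z + pfun p6 z * f z) ^+ 2
    = pfun p z.

(* The quotient is an identity of meromorphic functions: it is required where
   its denominator does not vanish, a dense set when [D != 0]. *)
Definition has_form c (p D a1 a2 : mpoly n C) g f : Prop :=
  forall z : 'rV[C]_n, shiftm c (pfun D) z != 0 ->
    f z = (shiftm c (pfun a1) z * expC ('i * shiftm c g z)
           - shiftm c (pfun p) z * shiftm c (pfun a2) z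
             * expC (- ('i * shiftm c g z)))
          / (2 * 'i * shiftm c (pfun D) z).

End Defs.

(* Main.v *)
Require Import Defs.
From HB Require Import structures.
From mathcomp Require Import all_boot all_order all_algebra.
From mathcomp Require Import complex.
From mathcomp Require Import -(notations) mpoly.
From mathcomp Require Import all_classical all_reals.
From mathcomp Require Import topology normedtype sequences derive exp trigo.
From mathcomp Require Import measure lebesgue_measure lebesgue_integral ftc.
From mathcomp Require Import interval_inference landau.
From mathcomp Require cyclic separable cyclotomic.
From mathcomp Require Import ring lra zify.

Set Implicit Arguments.
Unset Strict Implicit.
Unset Printing Implicit Defensive.

Import Order.TTheory GRing.Theory Num.Theory.
Import numFieldNormedType.Exports.

Local Open Scope ring_scope.

(* Writing [F] and [G] for the two squared expressions, [(F + iG)(F - iG) = p]. As [p] is irreducible,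
   one factor is zero free, hence [F + ikG = e^{ig}] and [F - ikG = p e^{-ig}] with [k = 1] or [k = -1].
   Solving for [f(z+c)] gives the form of [f]; solving for [L(f)] and comparing with [L] applied to the
   form of [f] gives, with [al = i g(z-c)] and [be = i g],
     A e^{al} + B e^{-al} + P e^{be} + S e^{-be} = 0,
   where [P], [S] are polynomials and [A], [B] are affine in [L(al)] with polynomial coefficients.
   Instead of Nevanlinna theory, functions are compared with [W r = ln (2 + sup (|al| + |be|)) + ln r + 1]
   on the ball of radius [r] about a generic centre, up to the loss [r -> r (1 + 1/x)] at a cost polynomial
   in [x]: [N] is slow when [ln |N|] is bounded by [W], and [d] is tame when [|d|] is. If
   [N1 = e^d N2] with [N1], [N2] slow, a Jensen type estimate bounds the Taylor coefficients of [d], so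
   that [d] is tame. Hence in a vanishing sum of exponentials with slow coefficients either all the
   coefficients vanish or some difference of exponents is tame (Borel), and if [al] and [be] are both tame,
   iterating the estimate on [W] bounds them by a power of [ln r], so they are constant. The cases of the
   theorem come from which of [al], [be], [al - be], [al + be] is tame. *)

(** * One complex variable *)

(** Two obstacles shape the proof. Estimates of Nevanlinna type usually fail on exceptional sets of
    radii. Here they hold for every radius [r >= 1] and every [x >= 1], and this freedom closes the
    argument: if [M r] is the supremum of [|al| + |be|] and both are tame, then
    [M r <= K x^q W (r (1 + 1/x))] bounds [M] by its own logarithm at a larger radius, and with [x]
    growing geometrically all the radii of the iteration stay below [2 r]. The centre is generic
    because Jensen's inequality starts from the value of a coefficient at the centre, which must not
    be zero. The other obstacle is the first step: irreducibility speaks of polynomial factors,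
    while [F + iG] and [F - iG] are only entire. On parallel lines the roots of [p] are split
    between the two factors, and the polynomials with these roots are shown to depend polynomially
    on the base point of the line, which yields a factorization of [p] into polynomials. Several
    variables are otherwise reached through complex lines: what is built line by line is entire as a
    locally uniform limit of entire functions. *)

Section Norm.
Variable R : realType.
Local Notation C := R[i].

(** The modulus with values in [R], since [|x|] lies in [R[i]], whose order is only partial. *)
Definition nm (x : C) : R := Num.sqrt (complex.Re x ^+ 2 + complex.Im x ^+ 2).

Local Notation rc t := (t%:C%C : C).

Lemma nmE (x : C) : `|x| = rc (nm x). Proof. exact: normc_def. Qed.

Lemma nm_ge0 (x : C) : 0 <= nm x. Proof. exact: sqrtr_ge0. Qed.

Lemma nm0 : nm 0 = 0.
Proof. by apply: complexI; rewrite -nmE normr0. Qed.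

Lemma nm1 : nm 1 = 1.
Proof. by apply: complexI; rewrite -nmE normr1. Qed.

Lemma nmM (x y : C) : nm (x * y) = nm x * nm y.
Proof. by apply: complexI; rewrite -nmE normrM !nmE rmorphM. Qed.

Lemma nmN (x : C) : nm (- x) = nm x.
Proof. by apply: complexI; rewrite -nmE normrN nmE. Qed.

Lemma nmBC (x y : C) : nm (x - y) = nm (y - x).
Proof. by rewrite -nmN opprB. Qed.

Lemma nmV (x : C) : nm x^-1 = (nm x)^-1.
Proof. by apply: complexI; rewrite -nmE normfV nmE fmorphV. Qed.

Lemma nmX (x : C) k : nm (x ^+ k) = nm x ^+ k.
Proof. by apply: complexI; rewrite -nmE normrX nmE rmorphXn. Qed.

Lemma nmD (x y : C) : nm (x + y) <= nm x + nm y.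
Proof. by rewrite -lecR rmorphD /= -!nmE; exact: ler_normD. Qed.

Lemma nmB (x y : C) : nm (x - y) <= nm x + nm y.
Proof. by rewrite -(nmN y); exact: nmD. Qed.

Lemma nm_eq0 (x : C) : (nm x == 0) = (x == 0).
Proof.
apply/eqP/eqP => [h|->]; last exact: nm0.
by apply/eqP; rewrite -normr_eq0 nmE h.
Qed.

Lemma nm_gt0 (x : C) : (0 < nm x) = (x != 0).
Proof. by rewrite lt_def nm_ge0 andbT nm_eq0. Qed.

Lemma nm_rc (t : R) : nm (rc t) = `|t|.
Proof. by rewrite /nm /= expr0n addr0 sqrtr_sqr. Qed.

Lemma nmi : nm ('i : C) = 1.
Proof. by rewrite -complexiE /nm /= expr0n expr1n add0r sqrtr1. Qed.

Lemma nm_Re (x : C) : `|complex.Re x| <= nm x.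
Proof. by rewrite -sqrtr_sqr /nm ler_wsqrtr// lerDl sqr_ge0. Qed.

Lemma nm_Im (x : C) : `|complex.Im x| <= nm x.
Proof. by rewrite -sqrtr_sqr /nm ler_wsqrtr// lerDr sqr_ge0. Qed.

Lemma nm_le (x : C) : nm x <= `|complex.Re x| + `|complex.Im x|.
Proof.
rewrite {1}[x]complexE; apply: le_trans (nmD _ _) _.
by rewrite nmM complexiE nmi mul1r !nm_rc.
Qed.

Lemma nm_conj (x : C) : nm (x^*)%C = nm x.
Proof. by rewrite /nm; case: x => a b /=; rewrite sqrrN. Qed.

Lemma nm_sum (I : Type) (r : seq I) (P : pred I) (F : I -> C) :
  nm (\sum_(i <- r | P i) F i) <= \sum_(i <- r | P i) nm (F i).
Proof.
elim/big_rec2: _ => [|i y x _ h]; first by rewrite nm0.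
by apply: le_trans (nmD _ _) _; rewrite lerD2l.
Qed.

Lemma nm_prod (I : Type) (r : seq I) (P : pred I) (F : I -> C) :
  nm (\prod_(i <- r | P i) F i) = \prod_(i <- r | P i) nm (F i).
Proof. by elim/big_rec2: _ => [|i y x _ h]; rewrite ?nm1// nmM h. Qed.

Lemma nm_natr k : nm (k%:R : C) = k%:R.
Proof. by rewrite -(rmorph_nat (real_complex R)) nm_rc ger0_norm. Qed.

Lemma rc0 : rc 0 = 0. Proof. by []. Qed.
Lemma rc1 : rc 1 = 1. Proof. by []. Qed.

Lemma cReD (x y : C) : complex.Re (x + y) = complex.Re x + complex.Re y.
Proof. by case: x; case: y. Qed.
Lemma cImD (x y : C) : complex.Im (x + y) = complex.Im x + complex.Im y.
Proof. by case: x; case: y. Qed.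
Lemma cReN (x : C) : complex.Re (- x) = - complex.Re x.
Proof. by case: x. Qed.
Lemma cImN (x : C) : complex.Im (- x) = - complex.Im x.
Proof. by case: x. Qed.
Lemma cReB (x y : C) : complex.Re (x - y) = complex.Re x - complex.Re y.
Proof. by rewrite cReD cReN. Qed.
Lemma cImB (x y : C) : complex.Im (x - y) = complex.Im x - complex.Im y.
Proof. by rewrite cImD cImN. Qed.
Lemma cReM (x y : C) : complex.Re (x * y) =
  complex.Re x * complex.Re y - complex.Im x * complex.Im y.
Proof. by case: x; case: y. Qed.
Lemma cImM (x y : C) : complex.Im (x * y) =
  complex.Re x * complex.Im y + complex.Im x * complex.Re y.
Proof. by case: x => a b; case: y => c d /=. Qed.
Lemma cE (x : C) : x = rc (complex.Re x) + 'i * rc (complex.Im x).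
Proof. by rewrite -complexiE; exact: complexE. Qed.
Lemma ceq (x y : C) : complex.Re x = complex.Re y -> complex.Im x = complex.Im y ->
  x = y.
Proof. by case: x => a b; case: y => c d /= -> ->. Qed.

End Norm.

Notation rc t := (t%:C%C).

(** * Dyadic scales and nested intervals *)

Section Nested.
Variable R : realType.

Definition hp n : R := 2^-1 ^+ n.
Lemma hp_gt0 n : 0 < hp n. Proof. by rewrite exprn_gt0// invr_gt0. Qed.
Lemma hp0 : hp 0 = 1. Proof. exact: expr0. Qed.
Lemma hpS n : hp n.+1 = hp n / 2. Proof. by rewrite /hp exprSr. Qed.
Lemma hp_le1 n : hp n <= 1.
Proof. by elim: n => [|n IH]; rewrite ?hp0// hpS; have := hp_gt0 n; lra. Qed.

Lemma hp_inv n : n%:R * hp n <= 1.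
Proof.
elim: n => [|n IH]; first by rewrite mul0r.
rewrite hpS -natr1.
case: n IH => [|n] IH; first by rewrite hp0; lra.
have h1 : 1 <= n.+1%:R :> R by rewrite ler1n.
by have := hp_gt0 n.+1; nra.
Qed.

Lemma hp_small (e : R) : 0 < e -> exists n, forall m, (n <= m)%N -> hp m < e.
Proof.
move=> e0; exists (Num.bound e^-1) => m nm.
have h := archi_boundP (ltW (x:=0) (y:=e^-1) ltac:(by rewrite invr_gt0)).
have h2 : e^-1 < m%:R by apply: lt_le_trans h _; rewrite ler_nat.
have m0 : 0 < m%:R :> R by apply: lt_trans h2; rewrite invr_gt0.
have := hp_inv m; have := hp_gt0 m => p q.
rewrite -(ltr_pM2l m0); apply: le_lt_trans q _.
by rewrite -ltr_pdivrMr// div1r.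
Qed.

(** Provides the limit point of the two bisection arguments below, for the mean value inequality and
    for Goursat's theorem. *)
Lemma nested (x : nat -> R) (w : R) : 0 <= w ->
  (forall n, x n <= x n.+1 /\ x n.+1 + w * hp n.+1 <= x n + w * hp n) ->
  exists tau, forall n, x n <= tau <= x n + w * hp n.
Proof.
move=> w0 H.
have mono n m : (n <= m)%N -> x n <= x m /\ x m + w * hp m <= x n + w * hp n.
  elim: m => [|m IH]; first by rewrite leqn0 => /eqP ->.
  rewrite leq_eqVlt => /orP[/eqP ->//|/IH [h1 h2]].
  by have [h3 h4] := H m; split; [exact: le_trans h1 h3|exact: le_trans h4 h2].
have cross n m : x n <= x m + w * hp m.
  have [h1 _] := mono _ _ (leq_maxl n m); have [_ h2] := mono _ _ (leq_maxr n m).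
  apply: le_trans h1 (le_trans _ h2); rewrite lerDl mulr_ge0//.
  exact/ltW/hp_gt0.
pose S := [set y | exists n, y = x n]%classic.
have hS : has_sup S.
  split; first by exists (x 0%N); exists 0%N.
  by exists (x 0%N + w * hp 0) => _ [n ->].
exists (sup S) => n; apply/andP; split.
  by apply: ub_le_sup; [exact: hS.2|exists n].
by apply: ge_sup; [exact: hS.1|move=> _ [m ->]].
Qed.

End Nested.

(** * Complex functions of a real variable: derivatives and primitives *)

Section Rdiff.
Variable R : realType.
Local Notation C := R[i].

Definition rdiff (U : R -> C) (t : R) (d : C) :=
  forall e, 0 < e -> exists2 dl, 0 < dl & forall h : R, `|h| < dl ->
    nm (U (t + h) - U t - rc h * d) <= e * `|h|.

(** Bisection: if the increment over an interval exceeds [B + e] times its length, so does the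
    increment over one of the halves, and this contradicts differentiability at the common point of
    the halves. *)
Lemma rdiff_mvt (U u : R -> C) a b B : a <= b ->
  (forall t, a <= t <= b -> rdiff U t (u t)) ->
  (forall t, a <= t <= b -> nm (u t) <= B) -> nm (U b - U a) <= B * (b - a).
Proof.
move=> ab dU uB; rewrite leNgt; apply/negP => K.
have [ba|wn] := leP b a.
  have E : a = b by apply/eqP; rewrite eq_le ab.
  by move: K; rewrite E !subrr nm0 mulr0 ltxx.
pose w := b - a; have w0 : 0 < w by rewrite subr_gt0.
have aw : a + w = b by rewrite /w addrC subrK.
have [e e0 Ke] : exists2 e, 0 < e & (B + e) * w < nm (U b - U a).
  exists ((nm (U b - U a) - B * w) / (2 * w)); first by rewrite divr_gt0 ?mulr_gt0// subr_gt0.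
  rewrite mulrDl.
  have -> : (nm (U b - U a) - B * w) / (2 * w) * w = (nm (U b - U a) - B * w) / 2.
    by field; rewrite gt_eqF.
  by move: K; rewrite -/w; lra.
pose bad x n := (B + e) * (w * hp R n) < nm (U (x + w * hp R n) - U x).
pose fix x n := if n is n'.+1 then
  (if `[< bad (x n') n >] then x n' else x n' + w * hp R n) else a.
have hw n : w * hp R n = w * hp R n.+1 + w * hp R n.+1 by rewrite hpS; field.
have xb n : bad (x n) n.
  elim: n => [|n IH]; first by rewrite /bad /= hp0 mulr1 aw.
  rewrite /=; case: asboolP => // nb.
  rewrite /bad; rewrite /bad in IH nb; move/negP: nb; rewrite -leNgt => nb.
  rewrite -addrA -hw; move: IH; rewrite {1}hw mulrDr => IH.
  have tri := nmD (U (x n + w * hp R n) - U (x n + w * hp R n.+1)) (U (x n + w * hp R n.+1) - U (x n)).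
  rewrite addrA subrK in tri.
  by lra.
have [n|tau ht] := @nested R x w (ltW w0).
  have p := hp_gt0 R n.+1; rewrite (hw n) /=; case: ifP => _; split; nra.
have ht0 := ht 0%N; rewrite /= hp0 mulr1 /w in ht0.
have htau : a <= tau <= b by move: ht0; rewrite (addrC a) subrK.
have [dl dl0 Hd] := dU _ htau e e0.
have [n Hn] := @hp_small R (dl / w) (divr_gt0 dl0 w0).
have /andP[t1 t2] := ht n.
have hn : w * hp R n < dl by have := Hn n (leqnn _); rewrite ltr_pdivlMr// mulrC.
have p0 : 0 < w * hp R n by rewrite mulr_gt0 ?hp_gt0.
set y := x n in t1 t2; set v := w * hp R n in t2 hn p0.
have := xb n; rewrite /bad -/y -/v.
have h1 := Hd (y - tau); have h2 := Hd (y + v - tau).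
rewrite ![tau + _]addrC !subrK in h1 h2.
have n1 : `|y - tau| = tau - y by rewrite distrC ger0_norm ?subr_ge0.
have n2 : `|y + v - tau| = y + v - tau by rewrite ger0_norm ?subr_ge0.
rewrite n1 n2 in h1 h2.
have h1' := h1 ltac:(lra); have h2' := h2 ltac:(lra).
(* As [tau] lies between the endpoints, the two errors add up to [e * v], and the increment is at
   most [(B + e) * v]. *)
have E : U (y + v) - U y = (U (y + v) - U tau - rc (y + v - tau) * u tau)
   - (U y - U tau - rc (y - tau) * u tau) + rc v * u tau.
  by rewrite !rmorphB !rmorphD /=; ring.
rewrite E => bd.
have b1 := nmD ((U (y + v) - U tau - rc (y + v - tau) * u tau)
   - (U y - U tau - rc (y - tau) * u tau)) (rc v * u tau).
have b2 := nmB (U (y + v) - U tau - rc (y + v - tau) * u tau)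
   (U y - U tau - rc (y - tau) * u tau).
have b3 : nm (rc v * u tau) <= v * B.
  by rewrite nmM nm_rc gtr0_norm// ler_pM2l// uB.
nra.
Qed.

Lemma rdiffD U V t d e : rdiff U t d -> rdiff V t e ->
  rdiff (fun x => U x + V x) t (d + e).
Proof.
move=> hU hV eps e0; have e2 : 0 < eps / 2 by lra.
have [a a0 ha] := hU _ e2; have [b b0 hb] := hV _ e2.
exists (Num.min a b); first by rewrite lt_min a0.
move=> h; rewrite lt_min => /andP[h1 h2].
have := ha h h1; have := hb h h2 => p q.
have -> : U (t + h) + V (t + h) - (U t + V t) - rc h * (d + e) =
  (U (t + h) - U t - rc h * d) + (V (t + h) - V t - rc h * e) by ring.
by apply: le_trans (nmD _ _) _; lra.
Qed.

Lemma rdiffZ U t d c : rdiff U t d -> rdiff (fun x => c * U x) t (c * d).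
Proof.
move=> hU eps e0.
have c1 : 0 < nm c + 1 by have := nm_ge0 c; lra.
have [a a0 ha] := hU _ (divr_gt0 e0 c1); exists a => // h hh.
have -> : c * U (t + h) - c * U t - rc h * (c * d) = c * (U (t + h) - U t - rc h * d) by ring.
rewrite nmM; have := ha h hh => q; have := nm_ge0 c => c0.
apply: le_trans (ler_wpM2l c0 q) _.
rewrite mulrA ler_wpM2r// mulrCA ger_pMr// ler_pdivrMr//; lra.
Qed.

Lemma rdiffB U V t d e : rdiff U t d -> rdiff V t e ->
  rdiff (fun x => U x - V x) t (d - e).
Proof.
move=> hU hV; have -> : (fun x => U x - V x) = (fun x => U x + -1 * V x).
  by apply/funext => x; rewrite mulN1r.
rewrite -(mulN1r e); exact: rdiffD hU (rdiffZ (-1) hV).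
Qed.

Lemma rdiff_cst c t : rdiff (fun=> c) t 0.
Proof.
move=> eps e0; exists 1 => // h _; rewrite subrr mulr0 subrr nm0.
by rewrite mulr_ge0// ltW.
Qed.

Lemma rdiff0_cst (U : R -> C) a b : a <= b ->
  (forall t, a <= t <= b -> rdiff U t 0) -> U b = U a.
Proof.
move=> ab h; have := @rdiff_mvt U (fun=> 0) a b 0 ab h.
rewrite mul0r => k; apply/eqP; rewrite -subr_eq0 -nm_eq0 eq_le nm_ge0 andbT.
by apply: k => t _; rewrite nm0.
Qed.

Lemma rdiff_Re (F : R -> R) (t d : R) : is_derive t 1 F d ->
  forall e, 0 < e -> exists2 dl, 0 < dl & forall h : R, `|h| < dl ->
    `|F (t + h) - F t - h * d| <= e * `|h|.
Proof.
move=> [dF DF] e e0.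
have /cvgrPdist_le/(_ e e0) : ((fun h => h^-1 *: ((F \o shift t) (h *: 1) - F t)) @ 0^' --> d)%classic.
  by rewrite -DF; exact: dF.
move=> /nbhs_ballP[dl /= dl0 H]; exists dl => // h hd.
have [->|h0] := eqVneq h 0; first by rewrite addr0 subrr mul0r subr0 normr0 mulr0.
have := H h; rewrite /ball /= sub0r normrN => /(_ hd h0).
have -> : F (t + h) - F t - h * d = - h * (d - h^-1 *: (F (h *: 1 + t) - F t)).
  by rewrite /GRing.scale /= mulr1 (addrC h t); field.
by rewrite normrM normrN mulrC => k; rewrite ler_wpM2r.
Qed.

Lemma rdiff_parts (F G : R -> R) (t a b : R) : is_derive t 1 F a -> is_derive t 1 G b ->
  rdiff (fun x => (F x +i* G x)%C) t (a +i* b)%C.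
Proof.
move=> /rdiff_Re hF /rdiff_Re hG eps e0; have e2 : 0 < eps / 2 by lra.
have [x x0 hx] := hF _ e2; have [y y0 hy] := hG _ e2.
exists (Num.min x y); first by rewrite lt_min x0.
move=> h; rewrite lt_min => /andP[h1 h2].
apply: le_trans (nm_le _) _; rewrite !cReB !cImB cReM cImM /= !mul0r subr0 addr0.
by have := hx h h1; have := hy h h2; lra.
Qed.

Definition cont (u : R -> C) := forall t e, 0 < e ->
  exists2 dl, 0 < dl & forall s, `|s - t| < dl -> nm (u s - u t) <= e.

Lemma cont_Re u : cont u -> continuous (fun t => complex.Re (u t)).
Proof.
move=> cu t; apply/cvgrPdist_le => e e0; have [dl dl0 H] := cu t e e0.
apply/nbhs_ballP; exists dl => //= s ts; rewrite distrC -cReB.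
by apply: le_trans (nm_Re _) _; apply: H; rewrite distrC.
Qed.

Lemma cont_Im u : cont u -> continuous (fun t => complex.Im (u t)).
Proof.
move=> cu t; apply/cvgrPdist_le => e e0; have [dl dl0 H] := cu t e e0.
apply/nbhs_ballP; exists dl => //= s ts; rewrite distrC -cImB.
by apply: le_trans (nm_Im _) _; apply: H; rewrite distrC.
Qed.

Lemma antideriv_real (f : R -> R) (A : R) : continuous f ->
  exists F : R -> R, forall t : R, A < t -> is_derive t 1 F (f t).
Proof.
move=> cf.
exists (fun x => \int[lebesgue_measure]_(t in [set` Interval (BLeft A) (BRight x)]) f t)%R => t At.
have [|||dF DF] := @continuous_FTC1 R f (BLeft A) t (t + 1) _ _ _ (cf t).
- by rewrite ltrDl.
- apply: continuous_compact_integrable => //; first exact: segment_compact.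
  exact: continuous_subspaceT.
- by rewrite lte_fin.
by move: DF; rewrite derive1E => DF; exact: DeriveDef dF DF.
Qed.

Lemma antideriv_right (u : R -> C) (A : R) : cont u ->
  exists U : R -> C, forall t, A < t -> rdiff U t (u t).
Proof.
move=> cu; have [F hF] := antideriv_real A (cont_Re cu).
have [G hG] := antideriv_real A (cont_Im cu).
exists (fun x => (F x +i* G x)%C) => t At.
have := rdiff_parts (hF t At) (hG t At).
by rewrite (_ : (_ +i* _)%C = u t)//; case: (u t).
Qed.

(** The primitives on the half-lines [t > A] agree once they are normalised to vanish at [0]; at [x]
    the one that starts from [- |x| - 1] is used. *)
Lemma antideriv (u : R -> C) : cont u -> exists U : R -> C, forall t, rdiff U t (u t).
Proof.
move=> cu.
have [V hV] := choice (fun A => antideriv_right A cu).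
pose W A x := V A x - V A 0.
have dW A t : A < t -> rdiff (W A) t (u t).
  by move=> At; rewrite -(subr0 (u t)); apply: rdiffB (hV A t At) (rdiff_cst _ _).
have WE A B x : A < 0 -> B < 0 -> A < x -> B < x -> W A x = W B x.
  move=> A0 B0 Ax Bx; apply/eqP; rewrite -subr_eq0; apply/eqP.
  have D t : A < t -> B < t -> rdiff (fun x => W A x - W B x) t 0.
    by move=> At Bt; rewrite -(subrr (u t)); apply: rdiffB; exact: dW.
  have W0 : W A 0 - W B 0 = 0 by rewrite /W !subrr.
  have [x0|x0] := leP 0 x.
    rewrite -W0; apply: (@rdiff0_cst (fun x => W A x - W B x) _ _ x0) => t /andP[t1 t2].
    by apply: D; lra.
  rewrite -W0; apply/esym.
  apply: (@rdiff0_cst (fun x => W A x - W B x) _ _ (ltW x0)) => t /andP[t1 t2].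
  by apply: D; lra.
exists (fun x => W (- `|x| - 1) x) => t e e0.
pose A := - `|t| - 2.
have At : A < t by rewrite /A; have := ler_norm (- t); rewrite normrN; lra.
have [dl dl0 H] := dW A t At e e0.
exists (Num.min dl 1); first by rewrite lt_min dl0 /=.
move=> h; rewrite lt_min => /andP[h1 h2].
have E x : `|x - t| < 1 -> W (- `|x| - 1) x = W A x.
  move=> hx; have n1 := normr_ge0 x; have n2 := normr_ge0 t.
  have h3 : - x <= `|x| by rewrite -normrN ler_norm.
  have h4 : - t <= `|t| by rewrite -normrN ler_norm.
  have h5 : - (x - t) < 1 by apply: le_lt_trans hx; rewrite -normrN ler_norm.
  by apply: WE; rewrite /A; lra.
rewrite !E ?subrr ?normr0//; last by rewrite addrC addKr.
exact: H.
Qed.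

End Rdiff.

(** * Integrals as increments of primitives *)

Section Iint.
Variable R : realType.
Local Notation C := R[i].
Implicit Types u v : R -> C.

Definition prim (u : R -> C) : R -> C := get [set U | forall t, rdiff U t (u t)]%classic.

Lemma primP u : cont u -> forall t, rdiff (prim u) t (u t).
Proof. by move=> cu; have := antideriv cu => /(@getPex _ [set U | forall t, rdiff U t (u t)]%classic). Qed.

(** With the integral taken as the increment of a chosen primitive, linearity and bounds follow from
    the mean value inequality alone. *)
Definition iint u (a b : R) : C := prim u b - prim u a.

Lemma iint_approx u W w a b B : a <= b -> cont u ->
  (forall t, a <= t <= b -> rdiff W t (w t)) ->
  (forall t, a <= t <= b -> nm (u t - w t) <= B) ->
  nm (iint u a b - (W b - W a)) <= B * (b - a).
Proof.
move=> ab cu dW hB.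
have -> : iint u a b - (W b - W a) = (prim u b - W b) - (prim u a - W a) by rewrite /iint; ring.
apply: (@rdiff_mvt R (fun x => prim u x - W x) (fun x => u x - w x) a b B ab) => // t ht.
by apply: rdiffB; [exact: primP|exact: dW].
Qed.

Lemma iintE u W a b : a <= b -> cont u -> (forall t, rdiff W t (u t)) ->
  iint u a b = W b - W a.
Proof.
move=> ab cu dW; apply/eqP; rewrite -subr_eq0 -nm_eq0 eq_le nm_ge0 andbT.
have := @iint_approx u W u a b 0 ab cu (fun t _ => dW t).
by rewrite mul0r; apply => t _; rewrite subrr nm0.
Qed.

Lemma iint_le u a b B : a <= b -> cont u ->
  (forall t, a <= t <= b -> nm (u t) <= B) -> nm (iint u a b) <= B * (b - a).
Proof.
move=> ab cu h; have := @iint_approx u (fun=> 0) (fun=> 0) a b B ab cu.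
rewrite subrr subr0; apply; first by move=> t _; exact: rdiff_cst.
by move=> t /h; rewrite subr0.
Qed.

Lemma contD u v : cont u -> cont v -> cont (fun t => u t + v t).
Proof.
move=> cu cv t e e0; have e2 : 0 < e / 2 by lra.
have [a a0 ha] := cu t _ e2; have [b b0 hb] := cv t _ e2.
exists (Num.min a b); first by rewrite lt_min a0.
move=> s; rewrite lt_min => /andP[h1 h2].
rewrite opprD addrACA; apply: le_trans (nmD _ _) _.
by have := ha s h1; have := hb s h2; lra.
Qed.

Lemma contM u v : cont u -> cont v -> cont (fun t => u t * v t).
Proof.
move=> cu cv t e e0.
have K0 : 0 < nm (u t) + nm (v t) + 1 by have := nm_ge0 (u t); have := nm_ge0 (v t); lra.
set K := _ + 1 in K0.
pose e' := Num.min 1 (e / K).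
have e'0 : 0 < e' by rewrite lt_min ltr01 divr_gt0.
have [a a0 ha] := cu t _ e'0; have [b b0 hb] := cv t _ e'0.
exists (Num.min a b); first by rewrite lt_min a0.
move=> s; rewrite lt_min => /andP[h1 h2].
have -> : u s * v s - u t * v t = (u s - u t) * (v s - v t) + (u s - u t) * v t + u t * (v s - v t) by ring.
have /= p := ha s h1; have /= q := hb s h2.
have e1 : e' <= 1 by rewrite ge_min lexx.
have eK : e' * K <= e by rewrite -ler_pdivlMr// ge_min lexx orbT.
apply: le_trans (nmD _ _) _; apply: le_trans (lerD (nmD _ _) (lexx _)) _.
rewrite !nmM; have := nm_ge0 (u s - u t); have := nm_ge0 (v s - v t).
have := nm_ge0 (u t); have := nm_ge0 (v t).
move: p q; set x := nm (_ - _); set y := nm (_ - _) => p q v0 u0 y0 x0.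
have m1 : x * y <= e' by nra.
have m2 : x * nm (v t) <= e' * nm (v t) by rewrite ler_wpM2r.
have m3 : nm (u t) * y <= e' * nm (u t) by rewrite mulrC ler_wpM2r.
move: eK; rewrite /K; nra.
Qed.

Lemma cont_cst (c : C) : cont (fun=> c).
Proof. by move=> t e e0; exists 1 => // s _; rewrite subrr nm0 ltW. Qed.

Lemma contZ (c : C) u : cont u -> cont (fun t => c * u t).
Proof. exact/contM/cont_cst. Qed.

Lemma contB u v : cont u -> cont v -> cont (fun t => u t - v t).
Proof.
move=> cu cv; rewrite (_ : (fun t => _) = (fun t => u t + -1 * v t)).
  by apply: contD => //; exact: contZ.
by apply/funext => t; rewrite mulN1r.
Qed.

Lemma contV u : cont u -> (forall t, u t != 0) -> cont (fun t => (u t)^-1).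
Proof.
move=> cu u0 t e e0.
have n0 : 0 < nm (u t) by rewrite nm_gt0.
pose e' := Num.min (nm (u t) / 2) (e * nm (u t) ^+ 2 / 2).
have e'0 : 0 < e' by rewrite lt_min !divr_gt0// mulr_gt0// exprn_gt0.
have [a a0 ha] := cu t _ e'0; exists a => // s hs; have := ha s hs.
have -> : (u s)^-1 - (u t)^-1 = - (u s - u t) * ((u s)^-1 * (u t)^-1) by field; rewrite !u0.
rewrite nmM nmN nmM !nmV => p.
have p1 : nm (u s - u t) <= nm (u t) / 2 by apply: le_trans p _; rewrite ge_min lexx.
have p2 : nm (u s - u t) <= e * nm (u t) ^+ 2 / 2 by apply: le_trans p _; rewrite ge_min lexx orbT.
have q : nm (u t) / 2 <= nm (u s).
  by have := nmD (u s) (u t - u s); rewrite addrC subrK nmBC; lra.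
have s0 : 0 < nm (u s) by lra.
have k : 0 <= e * nm (u t) * (nm (u s) - nm (u t) / 2).
  by rewrite mulr_ge0 ?subr_ge0// mulr_ge0// ltW.
rewrite -invfM ler_pdivrMr ?mulr_gt0//; apply: le_trans p2 _; lra.
Qed.

Lemma rdiff_cont (U u : R -> C) : (forall t, rdiff U t (u t)) -> cont U.
Proof.
move=> dU t e e0; have [dl dl0 H] := dU t 1 ltr01.
have K0 : 0 < nm (u t) + 1 by have := nm_ge0 (u t); lra.
exists (Num.min dl (e / (nm (u t) + 1))); first by rewrite lt_min dl0 divr_gt0.
move=> s; rewrite lt_min => /andP[h1 h2].
have := H (s - t) h1; rewrite mul1r (addrC t) subrK => p.
have := nmD (U s - U t - rc (s - t) * u t) (rc (s - t) * u t).
rewrite subrK nmM nm_rc => q.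
by move: h2; rewrite ltr_pdivlMr//; lra.
Qed.

Lemma iintD u v a b : a <= b -> cont u -> cont v ->
  iint (fun t => u t + v t) a b = iint u a b + iint v a b.
Proof.
move=> ab cu cv; rewrite (@iintE _ (fun t => prim u t + prim v t) a b ab (contD cu cv)).
  by rewrite /iint; ring.
by move=> t; apply: rdiffD; exact: primP.
Qed.

Lemma iintZ c u a b : a <= b -> cont u ->
  iint (fun t => c * u t) a b = c * iint u a b.
Proof.
move=> ab cu; rewrite (@iintE _ (fun t => c * prim u t) a b ab (contZ c cu)).
  by rewrite /iint; ring.
by move=> t; apply: rdiffZ; exact: primP.
Qed.

Lemma iint_cst_approx u a b c B : cont u ->
  (forall t, `|t - a| <= `|b - a| -> nm (u t - c) <= B) ->
  nm (iint u a b - rc (b - a) * c) <= B * `|b - a|.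
Proof.
have lin t : rdiff (fun t => c * rc t) t c.
  move=> e e0; exists 1 => // h _; rewrite rmorphD /=.
  by rewrite (_ : _ - _ - _ = 0) ?nm0 ?mulr_ge0 ?(ltW e0)//; ring.
move=> cu H; have [ab|ba] := leP a b.
  rewrite (ger0_norm (_ : 0 <= b - a)) ?subr_ge0//.
  have -> : rc (b - a) * c = c * rc b - c * rc a by rewrite rmorphB /=; ring.
  apply: (@iint_approx u (fun t => c * rc t) (fun=> c)) => // t /andP[t1 t2].
  by apply: H; rewrite !ger0_norm ?subr_ge0// lerD2r.
have -> : iint u a b - rc (b - a) * c = - (iint u b a - (c * rc a - c * rc b)).
  by rewrite /iint rmorphB /=; ring.
rewrite nmN ltr0_norm ?subr_lt0// opprB in H *.
apply: (@iint_approx u (fun t => c * rc t) (fun=> c)); rewrite ?(ltW ba)// => t /andP[t1 t2].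
by apply: H; rewrite ler0_norm ?subr_le0// opprB lerD2l lerN2.
Qed.

End Iint.

(** * Complex derivatives in one variable *)

Section Cdiff.
Variable R : realType.
Local Notation C := R[i].
Implicit Types f g phi : C -> C.

Definition cdiff phi z d := forall e, 0 < e -> exists2 dl, 0 < dl &
  forall h : C, nm h < dl -> nm (phi (z + h) - phi z - h * d) <= e * nm h.

Definition ent1 phi := forall z, exists d, cdiff phi z d.

Definition cder phi z := get [set d | cdiff phi z d]%classic.

Definition ccont phi := forall z e, 0 < e -> exists2 dl, 0 < dl &
  forall h : C, nm h < dl -> nm (phi (z + h) - phi z) <= e.

Lemma rc_lt_ex (dl : R) : 0 < dl -> exists2 h : C, h != 0 & nm h < dl.
Proof.
move=> d0; exists (rc (dl / 2)); last by rewrite nm_rc gtr0_norm; lra.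
by rewrite -nm_gt0 nm_rc gtr0_norm; lra.
Qed.

Lemma cdiff_uniq phi z d d' : cdiff phi z d -> cdiff phi z d' -> d = d'.
Proof.
move=> H H'; apply/eqP; rewrite -subr_eq0 -nm_eq0 eq_le nm_ge0 andbT.
rewrite leNgt; apply/negP => K.
have e0 : 0 < nm (d - d') / 4 by lra.
have [a a0 ha] := H _ e0; have [b b0 hb] := H' _ e0.
have m0 : 0 < Num.min a b by rewrite lt_min a0.
have [h h0] := rc_lt_ex m0; rewrite lt_min => /andP[h1 h2].
have p := ha h h1; have q := hb h h2.
have := nmB (phi (z + h) - phi z - h * d') (phi (z + h) - phi z - h * d).
rewrite (_ : _ - _ = h * (d - d')); last by ring.
have n0 : 0 < nm h by rewrite nm_gt0.
by rewrite nmM; nra.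
Qed.

Lemma cderP phi z : ent1 phi -> cdiff phi z (cder phi z).
Proof. by move=> /(_ z) /(@getPex _ [set d | cdiff phi z d]%classic). Qed.

Lemma cderE phi z d : cdiff phi z d -> cder phi z = d.
Proof.
move=> h; apply: (cdiff_uniq _ h).
exact: (@getPex _ [set d | cdiff phi z d]%classic (ex_intro _ d h)).
Qed.

Lemma cdiff_cont1 phi z d : cdiff phi z d -> forall e, 0 < e -> exists2 dl, 0 < dl &
  forall h : C, nm h < dl -> nm (phi (z + h) - phi z) <= e.
Proof.
move=> H e e0; have [dl dl0 hd] := H 1 ltr01.
have K0 : 0 < nm d + 1 by have := nm_ge0 d; lra.
exists (Num.min dl (e / (nm d + 1))); first by rewrite lt_min dl0 divr_gt0.
move=> h; rewrite lt_min => /andP[h1 h2].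
have := hd h h1; rewrite mul1r => p.
have := nmD (phi (z + h) - phi z - h * d) (h * d); rewrite subrK nmM => q.
by move: h2; rewrite ltr_pdivlMr//; lra.
Qed.

Lemma ent1_cont phi : ent1 phi -> ccont phi.
Proof. by move=> H z; have [d hd] := H z; exact: cdiff_cont1 hd. Qed.

Lemma cdiff_cst c z : cdiff (fun=> c) z 0.
Proof. by move=> e e0; exists 1 => // h _; rewrite mulr0 !subrr nm0 mulr_ge0 ?nm_ge0 ?(ltW e0). Qed.

Lemma cdiff_id z : cdiff (fun x => x) z 1.
Proof.
move=> e e0; exists 1 => // h _.
by rewrite (_ : _ - _ = 0) ?nm0 ?mulr_ge0 ?nm_ge0 ?(ltW e0)//; ring.
Qed.

Lemma cdiffD f g z a b : cdiff f z a -> cdiff g z b ->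
  cdiff (fun x => f x + g x) z (a + b).
Proof.
move=> hf hg e e0; have e2 : 0 < e / 2 by lra.
have [x x0 hx] := hf _ e2; have [y y0 hy] := hg _ e2.
exists (Num.min x y); first by rewrite lt_min x0.
move=> h; rewrite lt_min => /andP[h1 h2].
have -> : f (z + h) + g (z + h) - (f z + g z) - h * (a + b) =
  (f (z + h) - f z - h * a) + (g (z + h) - g z - h * b) by ring.
by apply: le_trans (nmD _ _) _; have := hx h h1; have := hy h h2; lra.
Qed.

Lemma cdiffM f g z a b : cdiff f z a -> cdiff g z b ->
  cdiff (fun x => f x * g x) z (a * g z + f z * b).
Proof.
move=> hf hg e e0.
have ge := nm_ge0 (g z); have fe := nm_ge0 (f z); have ae := nm_ge0 a.
pose K := nm (f z) + nm (g z) + nm a + 1.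
have K0 : 0 < K by rewrite /K; lra.
pose e' := Num.min 1 (e / (2 * K)).
have e'0 : 0 < e' by rewrite lt_min ltr01 divr_gt0// mulr_gt0.
have eK : e' * (2 * K) <= e by rewrite -ler_pdivlMr ?mulr_gt0// ge_min lexx orbT.
have [x x0 hx] := hf _ e'0; have [y y0 hy] := hg _ e'0.
have [w w0 hw] := cdiff_cont1 hg e'0.
exists (Num.min x (Num.min y w)); first by rewrite !lt_min x0 y0.
move=> h; rewrite !lt_min => /andP[h1 /andP[h2 h3]].
have p := hx h h1; have q := hy h h2; have r := hw h h3.
have -> : f (z + h) * g (z + h) - f z * g z - h * (a * g z + f z * b) =
  (f (z + h) - f z - h * a) * (g z + (g (z + h) - g z)) + h * a * (g (z + h) - g z)
   + f z * (g (z + h) - g z - h * b) by ring.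
have hh := nm_ge0 h.
apply: le_trans (nmD _ _) _; apply: le_trans (lerD (nmD _ _) (lexx _)) _.
rewrite !nmM.
have s : nm (g z + (g (z + h) - g z)) <= nm (g z) + 1.
  apply: le_trans (nmD _ _) _; rewrite lerD2l; apply: le_trans r _.
  by rewrite ge_min lexx.
have b1 : nm (f (z + h) - f z - h * a) * nm (g z + (g (z + h) - g z)) <= (e' * nm h) * (nm (g z) + 1).
  by apply: ler_pM; rewrite ?nm_ge0.
have b2 : nm h * nm a * nm (g (z + h) - g z) <= nm h * nm a * e'.
  by rewrite ler_wpM2l// mulr_ge0.
have b3 : nm (f z) * nm (g (z + h) - g z - h * b) <= nm (f z) * (e' * nm h).
  by rewrite ler_wpM2l.
apply: le_trans (lerD (lerD b1 b2) b3) _.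
have -> : e' * nm h * (nm (g z) + 1) + nm h * nm a * e' + nm (f z) * (e' * nm h) = e' * K * nm h.
  by rewrite /K; ring.
rewrite ler_wpM2r//; nra.
Qed.

Lemma cdiffZ c f z a : cdiff f z a -> cdiff (fun x => c * f x) z (c * a).
Proof. by move=> h; have := cdiffM (cdiff_cst c z) h; rewrite mul0r add0r. Qed.

Lemma cdiffN f z a : cdiff f z a -> cdiff (fun x => - f x) z (- a).
Proof.
move=> h; rewrite -(mulN1r a) (_ : (fun x => _) = (fun x => -1 * f x)); first exact: cdiffZ.
by apply/funext => x; rewrite mulN1r.
Qed.

Lemma cdiffB f g z a b : cdiff f z a -> cdiff g z b ->
  cdiff (fun x => f x - g x) z (a - b).
Proof. by move=> h k; apply: cdiffD h (cdiffN k). Qed.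

Lemma cdiff_comp f g z a b : cdiff g z a -> cdiff f (g z) b ->
  cdiff (fun x => f (g x)) z (a * b).
Proof.
move=> hg hf e e0; have ae := nm_ge0 a; have be := nm_ge0 b.
pose K := nm a + nm b + 2.
have K0 : 0 < K by rewrite /K; lra.
pose e' := Num.min 1 (e / K).
have e'0 : 0 < e' by rewrite lt_min ltr01 divr_gt0.
have eK : e' * K <= e by rewrite -ler_pdivlMr// ge_min lexx orbT.
have e'1 : e' <= 1 by rewrite ge_min lexx.
have [x x0 hx] := hf _ e'0; have [y y0 hy] := hg _ e'0.
have x2 : 0 < x / 2 by lra.
have [w w0 hw] := cdiff_cont1 hg x2.
exists (Num.min y w); first by rewrite !lt_min y0.
move=> h; rewrite !lt_min => /andP[h1 h2].
have r := hw h h2; have q := hy h h1.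
have hh := nm_ge0 h.
pose k := g (z + h) - g z.
have kx : nm k < x by rewrite /k; lra.
have p := hx k kx; rewrite {1}/k [g z + _]addrC subrK in p.
have -> : f (g (z + h)) - f (g z) - h * (a * b) =
  (f (g (z + h)) - f (g z) - k * b) + (k - h * a) * b by ring.
apply: le_trans (nmD _ _) _; rewrite nmM.
have kb : nm k <= (nm a + 1) * nm h.
  have := nmD (k - h * a) (h * a); rewrite subrK nmM => s.
  by rewrite -/k in q; nra.
have b1 : nm (f (g (z + h)) - f (g z) - k * b) <= e' * ((nm a + 1) * nm h).
  by apply: le_trans p _; rewrite ler_wpM2l// ltW.
have b2 : nm (k - h * a) * nm b <= e' * nm h * nm b by rewrite ler_wpM2r.
apply: le_trans (lerD b1 b2) _.
have -> : e' * ((nm a + 1) * nm h) + e' * nm h * nm b = (e' * (K - 1)) * nm h by rewrite /K; ring.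
rewrite ler_wpM2r//; nra.
Qed.

Lemma cdiff_inv z : z != 0 -> cdiff (fun x => x^-1) z (- z^-1 ^+ 2).
Proof.
move=> z0 e e0; have n0 : 0 < nm z by rewrite nm_gt0.
exists (Num.min (nm z / 2) (e * nm z ^+ 3 / 2)).
  by rewrite lt_min !divr_gt0// mulr_gt0// exprn_gt0.
move=> h; rewrite lt_min => /andP[h1 h2].
have q : nm z / 2 <= nm (z + h) by have := nmB (z + h) h; rewrite addrK; lra.
have s0 : 0 < nm (z + h) by lra.
have zh : z + h != 0 by rewrite -nm_gt0.
have -> : (z + h)^-1 - z^-1 - h * - z^-1 ^+ 2 = h ^+ 2 * ((z + h)^-1 * z^-1 ^+ 2) by field; rewrite ?zh ?z0.
rewrite !nmM !nmV -!invfM ler_pdivrMr ?mulr_gt0//.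
have k : 0 <= e * nm z * nm z * (nm (z + h) - nm z / 2).
  by rewrite mulr_ge0 ?subr_ge0// !mulr_ge0// ltW.
have k2 : nm h <= e * (nm (z + h) * (nm z * nm z)) by move: h2; rewrite !exprS expr0; lra.
by rewrite mulrAC [X in _ <= X]mulrC ler_wpM2l ?nm_ge0.
Qed.

Lemma cdiff_exp f z a k : cdiff f z a -> cdiff (fun x => f x ^+ k) z (k%:R * f z ^+ k.-1 * a).
Proof.
move=> hf; elim: k => [|k IH]; first by rewrite !mul0r; exact: cdiff_cst.
rewrite (_ : (fun x => _) = (fun x => f x * f x ^+ k)); last by apply/funext => x; rewrite exprS.
rewrite (_ : _ * a = a * f z ^+ k + f z * (k%:R * f z ^+ k.-1 * a)); first exact: cdiffM.
by case: k {IH} => [|k]; rewrite /= ?mul0r -?natr1 ?exprS; ring.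
Qed.

Lemma cdiff_eq f g z a : (exists2 dl, 0 < dl & forall h, nm h < dl -> f (z + h) = g (z + h)) ->
  cdiff f z a -> cdiff g z a.
Proof.
move=> [dl dl0 E] H e e0; have [x x0 hx] := H e e0.
exists (Num.min dl x); first by rewrite lt_min dl0.
move=> h; rewrite lt_min => /andP[h1 h2].
by rewrite -(E h h1) -(addr0 z) -E ?nm0// addr0 hx.
Qed.

Lemma cdiff_line phi (a b : C) t d : cdiff phi (a + rc t * b) d ->
  rdiff (fun t => phi (a + rc t * b)) t (b * d).
Proof.
move=> H e e0; have b1 : 0 < nm b + 1 by have := nm_ge0 b; lra.
have [x x0 hx] := H _ (divr_gt0 e0 b1).
exists (x / (nm b + 1)); first by rewrite divr_gt0.
move=> h; rewrite ltr_pdivlMr// => hh.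
have hn : nm (rc h * b) < x.
  rewrite nmM nm_rc; apply: le_lt_trans hh; rewrite ler_wpM2l//; lra.
have -> : a + rc (t + h) * b = a + rc t * b + rc h * b by rewrite rmorphD /=; ring.
rewrite mulrA; apply: le_trans (hx _ hn) _.
rewrite nmM nm_rc -mulrA ler_pM2l// mulrCA ler_piMr// mulrC ler_pdivrMr//; lra.
Qed.

Lemma ccont_line phi (a b : C) : ccont phi -> cont (fun t : R => phi (a + rc t * b)).
Proof.
move=> H t e e0; have b1 : 0 < nm b + 1 by have := nm_ge0 b; lra.
have [x x0 hx] := H (a + rc t * b) e e0; exists (x / (nm b + 1)); first by rewrite divr_gt0.
move=> s; rewrite ltr_pdivlMr// => hh.
have := hx (rc (s - t) * b); rewrite nmM nm_rc rmorphB /=.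
have -> : a + rc t * b + (rc s - rc t) * b = a + rc s * b by ring.
apply; apply: le_lt_trans hh; rewrite ler_wpM2l//; lra.
Qed.

End Cdiff.

(** * Goursat's theorem and primitives of entire functions *)

Section Goursat.
Variable R : realType.
Local Notation C := R[i].
Implicit Types f g phi : C -> C.

Definition hor phi (y : R) := fun t : R => phi (t +i* y)%C.
Definition ver phi (x : R) := fun t : R => phi (x +i* t)%C.

Lemma cmplxE (x y : R) : (x +i* y)%C = 'i * rc y + rc x * 1.
Proof. by rewrite mulr1 addrC; apply: ceq; rewrite -complexiE ?cReD ?cReM ?cImD ?cImM /=; ring. Qed.

Lemma cmplxE' (x y : R) : (x +i* y)%C = rc x + rc y * 'i.
Proof. by apply: ceq; rewrite -complexiE ?cReD ?cReM ?cImD ?cImM /=; ring. Qed.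

Lemma horE phi y : hor phi y = fun t => phi ('i * rc y + rc t * 1).
Proof. by apply/funext => t; rewrite -cmplxE. Qed.

Lemma verE phi x : ver phi x = fun t => phi (rc x + rc t * 'i).
Proof. by apply/funext => t; rewrite -cmplxE'. Qed.

Lemma cont_hor phi y : ccont phi -> cont (hor phi y).
Proof. by move=> h; rewrite horE; exact: ccont_line. Qed.

Lemma cont_ver phi x : ccont phi -> cont (ver phi x).
Proof. by move=> h; rewrite verE; exact: ccont_line. Qed.

Definition rect phi x0 x1 y0 y1 : C :=
  iint (hor phi y0) x0 x1 + 'i * iint (ver phi x1) y0 y1
  - iint (hor phi y1) x0 x1 - 'i * iint (ver phi x0) y0 y1.

(** An affine function has the primitive [P], hence integral zero round the rectangle; only its
    distance from [phi] contributes, times the perimeter. *)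
Lemma rect_approx phi x0 x1 y0 y1 a c d B : x0 <= x1 -> y0 <= y1 -> ccont phi ->
  (forall x y, x0 <= x <= x1 -> y0 <= y <= y1 ->
    nm (phi (x +i* y)%C - (c + d * ((x +i* y)%C - a))) <= B) ->
  nm (rect phi x0 x1 y0 y1) <= 2 * B * ((x1 - x0) + (y1 - y0)).
Proof.
move=> x01 y01 cphi H.
pose P (z : C) := c * z + d / 2 * (z - a) ^+ 2.
have dP z : cdiff P z (c + d * (z - a)).
  have h0 := cdiffB (cdiff_id z) (cdiff_cst a z).
  have := cdiffD (cdiffZ c (cdiff_id z)) (cdiffZ (d / 2) (cdiff_exp 2 h0)).
  by rewrite (_ : c * 1 + _ = c + d * (z - a))//=; field.
have Hh y : y0 <= y <= y1 ->
   nm (iint (hor phi y) x0 x1 - (P (x1 +i* y)%C - P (x0 +i* y)%C)) <= B * (x1 - x0).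
  move=> hy; apply: (@iint_approx _ _ (hor P y) (fun t => c + d * ((t +i* y)%C - a))) => //.
  - exact: cont_hor.
  - move=> t _; rewrite horE -[X in rdiff _ _ X]mul1r cmplxE; exact/cdiff_line/dP.
  - by move=> t ht; exact: H.
have Hv x : x0 <= x <= x1 ->
   nm ('i * iint (ver phi x) y0 y1 - (P (x +i* y1)%C - P (x +i* y0)%C)) <= B * (y1 - y0).
  move=> hx.
  have i2 : 'i * - 'i = 1 :> C by rewrite mulrN -expr2 sqrCi opprK.
  have -> : 'i * iint (ver phi x) y0 y1 - (P (x +i* y1)%C - P (x +i* y0)%C) =
     'i * (iint (ver phi x) y0 y1 - ((- 'i) * P (x +i* y1)%C - (- 'i) * P (x +i* y0)%C)).
    by rewrite -(mul1r (P _ - _)) -{1}i2; ring.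
  rewrite nmM nmi mul1r.
  apply: (@iint_approx _ _ (fun t => - 'i * ver P x t) (fun t => c + d * ((x +i* t)%C - a))) => //.
  - exact: cont_ver.
  - move=> t _; rewrite verE -[X in rdiff _ _ X]mul1r -i2 [_ * - _]mulrC -mulrA.
    by apply: rdiffZ; rewrite cmplxE'; exact/cdiff_line/dP.
  - by move=> t ht; exact: H.
have b1 := Hh y0 ltac:(by rewrite lexx); have b2 := Hh y1 ltac:(by rewrite lexx y01).
have b3 := Hv x0 ltac:(by rewrite lexx); have b4 := Hv x1 ltac:(by rewrite lexx x01).
rewrite /rect.
set h0 := iint (hor phi y0) _ _ in b1 *; set h1 := iint (hor phi y1) _ _ in b2 *.
set v0 := 'i * iint (ver phi x0) _ _ in b3 *; set v1 := 'i * iint (ver phi x1) _ _ in b4 *.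
have -> : h0 + v1 - h1 - v0 = (h0 - (P (x1 +i* y0)%C - P (x0 +i* y0)%C))
  + (v1 - (P (x1 +i* y1)%C - P (x1 +i* y0)%C))
  - (h1 - (P (x1 +i* y1)%C - P (x0 +i* y1)%C))
  - (v0 - (P (x0 +i* y1)%C - P (x0 +i* y0)%C)) by ring.
apply: le_trans (nmB _ _) _; apply: le_trans (lerD (nmB _ _) (lexx _)) _.
apply: le_trans (lerD (lerD (nmD _ _) (lexx _)) (lexx _)) _.
lra.
Qed.

(** Quartering: one of the four parts keeps at least a quarter of the integral, so [4^-n] of it
    survives after [n] steps. Near the limit point [phi] is affine up to [e] times the size of the
    rectangle, and the perimeter is a second factor of that size. *)
Lemma goursat phi x w y h : 0 <= w -> 0 <= h -> ent1 phi ->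
  rect phi x (x + w) y (y + h) = 0.
Proof.
move=> w0 h0 ephi; have cphi := ent1_cont ephi.
apply/eqP; rewrite -nm_eq0 eq_le nm_ge0 andbT leNgt; apply/negP.
set kap := nm _ => k0.
pose W n := w * hp R n; pose H n := h * hp R n.
have WS n : W n = W n.+1 + W n.+1 by rewrite /W hpS; field.
have HS n : H n = H n.+1 + H n.+1 by rewrite /H hpS; field.
have W_ge0 n : 0 <= W n by rewrite mulr_ge0// ltW// hp_gt0.
have H_ge0 n : 0 <= H n by rewrite mulr_ge0// ltW// hp_gt0.
pose bad (p : R * R) n := kap * hp R n ^+ 2 <= nm (rect phi p.1 (p.1 + W n) p.2 (p.2 + H n)).
pose quarters (p : R * R) n := [:: p; (p.1 + W n, p.2); (p.1, p.2 + H n); (p.1 + W n, p.2 + H n)].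
have split p n : bad p n -> exists2 q, q \in quarters p n.+1 & bad q n.+1.
  rewrite /bad => hb; apply: contrapT => K.
  have nb q : q \in quarters p n.+1 -> nm (rect phi q.1 (q.1 + W n.+1) q.2 (q.2 + H n.+1)) < kap * hp R n.+1 ^+ 2.
    by move=> hq; rewrite ltNge; apply/negP => hb'; apply: K; exists q.
  have := nb _ (mem_head _ _); have := nb (p.1 + W n.+1, p.2); have := nb (p.1, p.2 + H n.+1).
  have := nb (p.1 + W n.+1, p.2 + H n.+1).
  rewrite !inE !eqxx !orbT /= => /(_ isT) q1 /(_ isT) q2 /(_ isT) q3 q4.
  move: hb; rewrite [W n]WS [H n]HS !addrA; move: q1 q2 q3 q4.
  set a := p.1; set a' := a + W n.+1; set a'' := a' + W n.+1.
  set b := p.2; set b' := b + H n.+1; set b'' := b' + H n.+1 => q1 q2 q3 q4.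
  have -> : rect phi a a'' b b'' = rect phi a a' b b' + rect phi a' a'' b b' +
     rect phi a a' b' b'' + rect phi a' a'' b' b'' by rewrite /rect /iint; ring.
  rewrite leNgt => /negP; apply.
  apply: le_lt_trans (nmD _ _) _; apply: le_lt_trans (lerD (nmD _ _) (lexx _)) _.
  apply: le_lt_trans (lerD (lerD (nmD _ _) (lexx _)) (lexx _)) _.
  have -> : kap * hp R n ^+ 2 = kap * hp R n.+1 ^+ 2 * 4 by rewrite hpS; field.
  lra.
have [nxt hnxt] : exists nxt : R * R -> nat -> R * R, forall p n, bad p n ->
    nxt p n \in quarters p n.+1 /\ bad (nxt p n) n.+1.
  have : forall pn : (R * R) * nat, exists q, bad pn.1 pn.2 -> q \in quarters pn.1 pn.2.+1 /\ bad q pn.2.+1.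
    move=> [p n]; have [hb|hb] := pselect (bad p n); last by exists p.
    by have [q q1 q2] := split p n hb; exists q.
  by move=> /choice[f hf]; exists (fun p n => f (p, n)) => p n hb; exact: (hf (p, n)).
pose fix s n := if n is n'.+1 then nxt (s n') n' else (x, y).
have sb n : bad (s n) n.
  elim: n => [|n IH] /=; last exact: (hnxt _ _ IH).2.
  by rewrite /bad /W /H hp0 !mulr1 expr1n mulr1.
have sq n : s n.+1 \in quarters (s n) n.+1 by exact: (hnxt _ _ (sb n)).1.
have [n|tx htx] := @nested R (fun n => (s n).1) w w0.
  have := sq n; have := W_ge0 n.+1; have := WS n; rewrite !inE -![w * _]/(W _) => q p.
  by move=> /or4P[] /eqP -> /=; split; lra.
have [n|ty hty] := @nested R (fun n => (s n).2) h h0.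
  have := sq n; have := H_ge0 n.+1; have := HS n; rewrite !inE -![h * _]/(H _) => q p.
  by move=> /or4P[] /eqP -> /=; split; lra.
pose a := (tx +i* ty)%C; have [d hd] := ephi a.
pose S := (w + h); have S0 : 0 <= S by rewrite /S; lra.
(* Chosen so that [2 * e * S ^+ 2 < kap]. *)
pose e := kap / (4 * (S ^+ 2 + 1)).
have S2 : 0 <= S ^+ 2 by rewrite exprn_ge0.
have e0 : 0 < e by rewrite divr_gt0//; lra.
have [dl dl0 hdl] := hd e e0.
have d'0 : 0 < dl / (S + 1) by rewrite divr_gt0//; lra.
have [n hn] := hp_small d'0.
have {}hn := hn n (leqnn _).
have p0 := hp_gt0 R n.
have hS : S * hp R n < dl.
  by move: hn; rewrite ltr_pdivlMr//; [lra|lra].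
have /andP[a1 a2] := htx n; have /andP[b1 b2] := hty n.
have K := @rect_approx phi (s n).1 ((s n).1 + W n) (s n).2 ((s n).2 + H n) a (phi a) d (e * (S * hp R n)).
have : nm (rect phi (s n).1 ((s n).1 + W n) (s n).2 ((s n).2 + H n)) <= 2 * (e * (S * hp R n)) * (S * hp R n).
  have -> : S * hp R n = ((s n).1 + W n - (s n).1) + ((s n).2 + H n - (s n).2).
    by rewrite /S /W /H; ring.
  have -> : (s n).1 + W n - (s n).1 + ((s n).2 + H n - (s n).2) = S * hp R n by rewrite /S /W /H; ring.
  rewrite {2}(_ : S * hp R n = ((s n).1 + W n - (s n).1) + ((s n).2 + H n - (s n).2)).
    2: by rewrite /S /W /H; ring.
  apply: K; rewrite ?lerDl//.
  move=> x' y' /andP[x1 x2] /andP[y1 y2].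
  have E : (x' +i* y')%C = a + ((x' +i* y')%C - a) by rewrite addrC subrK.
  have N : nm ((x' +i* y')%C - a) <= S * hp R n.
    apply: le_trans (nm_le _) _; rewrite /a cReB cImB /= /S mulrDl.
    by apply: lerD; rewrite ler_norml; move: a2 b2 x2 y2; rewrite /W /H; lra.
  have := hdl _ (le_lt_trans N hS); rewrite -E => q.
  rewrite opprD addrA [d * _]mulrC; apply: le_trans q _.
  by rewrite ler_wpM2l// ltW.
apply/negP; rewrite -ltNge; apply: lt_le_trans (sb n).
have -> : 2 * (e * (S * hp R n)) * (S * hp R n) = (2 * e * S ^+ 2) * hp R n ^+ 2 by ring.
rewrite ltr_pM2r; last exact: exprn_gt0.
have -> : 2 * e * S ^+ 2 = kap * (S ^+ 2 / (2 * (S ^+ 2 + 1))) by rewrite /e; field; lra.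
rewrite gtr_pMr// ltr_pdivrMr; lra.
Qed.

Lemma rect0 phi x0 x1 y0 y1 : ent1 phi -> rect phi x0 x1 y0 y1 = 0.
Proof.
move=> ephi.
have P a b c d : a <= b -> c <= d -> rect phi a b c d = 0.
  move=> ab cd; have := @goursat phi a (b - a) c (d - c).
  by rewrite !subr_ge0 ab cd ![_ + (_ - _)]addrC !subrK; apply.
have [ab|ba] := leP x0 x1; have [cd|dc] := leP y0 y1; first exact: P.
- have := P _ _ _ _ ab (ltW dc); rewrite /rect /iint => E.
  by apply: oppr_inj; rewrite oppr0 -E; ring.
- have := P _ _ _ _ (ltW ba) cd; rewrite /rect /iint => E.
  by apply: oppr_inj; rewrite oppr0 -E; ring.
- by have := P _ _ _ _ (ltW ba) (ltW dc); rewrite /rect /iint => E; rewrite -E; ring.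
Qed.

Definition cprim phi (z : C) : C :=
  iint (hor phi 0) 0 (complex.Re z) + 'i * iint (ver phi (complex.Re z)) 0 (complex.Im z).

(** By [rect0] the increment from [z] to [z + k] is an integral over the two short sides only, on
    which [phi] is within [e / 2] of [phi z]. *)
Lemma cprimP phi z : ent1 phi -> cdiff (cprim phi) z (phi z).
Proof.
move=> ephi e e0; have cphi := ent1_cont ephi.
have e2 : 0 < e / 2 by lra.
have [dl dl0 hdl] := cphi z _ e2.
exists (dl / 2); first by lra.
move=> k kd; pose x := complex.Re z; pose y := complex.Im z.
pose a := complex.Re k; pose b := complex.Im k.
have zE : z = (x +i* y)%C by rewrite /x /y; case: (z).
have kE : k = (a +i* b)%C by rewrite /a /b; case: (k).
have ka : `|a| <= nm k := nm_Re k.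
have kb : `|b| <= nm k := nm_Im k.
have := rect0 x (x + a) 0 y ephi; rewrite /rect => E.
have -> : cprim phi (z + k) - cprim phi z =
   iint (hor phi y) x (x + a) + 'i * iint (ver phi (x + a)) y (y + b).
  rewrite /cprim cReD cImD -/x -/y -/a -/b; apply/eqP; rewrite -subr_eq0 -E.
  by rewrite /iint; apply/eqP; ring.
have h1 : nm (iint (hor phi y) x (x + a) - rc (x + a - x) * phi z) <= e / 2 * `|x + a - x|.
  apply: iint_cst_approx; first exact: cont_hor.
  move=> t ht; have := hdl ((t - x) +i* 0)%C; rewrite /hor.
  have -> : z + ((t - x) +i* 0)%C = (t +i* y)%C by rewrite zE; apply: ceq; rewrite ?cReD ?cImD /=; ring.
  apply; apply: le_lt_trans (nm_le _) _; rewrite /= normr0 addr0.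
  by move: ht; rewrite [x + a]addrC addrK => ht; lra.
have h2 : nm (iint (ver phi (x + a)) y (y + b) - rc (y + b - y) * phi z) <= e / 2 * `|y + b - y|.
  apply: iint_cst_approx; first exact: cont_ver.
  move=> t ht; have := hdl (a +i* (t - y))%C; rewrite /ver.
  have -> : z + (a +i* (t - y))%C = ((x + a) +i* t)%C by rewrite zE; apply: ceq; rewrite ?cReD ?cImD /=; ring.
  apply; apply: le_lt_trans (nm_le _) _ => /=.
  by move: ht; rewrite [y + b]addrC addrK => ht; lra.
move: h1 h2; rewrite [x + a]addrC [y + b]addrC !addrK [a + x]addrC [b + y]addrC.
set I1 := iint _ _ _; set I2 := iint _ _ _ => h1 h2.
have -> : I1 + 'i * I2 - k * phi z = (I1 - rc a * phi z) + 'i * (I2 - rc b * phi z).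
  by rewrite kE cmplxE'; ring.
apply: le_trans (nmD _ _) _; rewrite nmM nmi mul1r.
by have := nm_ge0 k; nra.
Qed.

End Goursat.

(** * Integrals over circles and the Cauchy formula for primitives *)

Section Cauchy.
Variable R : realType.
Local Notation C := R[i].
Implicit Types f g phi F : C -> C.

Lemma rdiff_comp (ga : R -> C) (P : C -> C) t (g p : C) : rdiff ga t g -> cdiff P (ga t) p ->
  rdiff (fun t => P (ga t)) t (g * p).
Proof.
move=> hg hP e e0; have ge := nm_ge0 g; have pe := nm_ge0 p.
pose K := nm g + nm p + 2.
have K0 : 0 < K by rewrite /K; lra.
pose e' := Num.min 1 (e / K).
have e'0 : 0 < e' by rewrite lt_min ltr01 divr_gt0.
have eK : e' * K <= e by rewrite -ler_pdivlMr// ge_min lexx orbT.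
have e'1 : e' <= 1 by rewrite ge_min lexx.
have [x x0 hx] := hP _ e'0; have [y y0 hy] := hg _ e'0.
exists (Num.min y (x / (nm g + 1))); first by rewrite !lt_min y0 divr_gt0//; lra.
move=> h; rewrite !lt_min => /andP[h1]; rewrite ltr_pdivlMr; last by lra.
move=> h2; have q := hy h h1; have hh := normr_ge0 h.
pose k := ga (t + h) - ga t.
have kb : nm k <= (nm g + 1) * `|h|.
  have := nmD (k - rc h * g) (rc h * g); rewrite subrK nmM nm_rc => s.
  by rewrite -/k in q; nra.
have kx : nm k < x by lra.
have r := hx k kx; rewrite {1}/k [ga t + _]addrC subrK in r.
have -> : P (ga (t + h)) - P (ga t) - rc h * (g * p) =
  (P (ga (t + h)) - P (ga t) - k * p) + (k - rc h * g) * p by ring.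
apply: le_trans (nmD _ _) _; rewrite nmM.
have b1 : nm (P (ga (t + h)) - P (ga t) - k * p) <= e' * ((nm g + 1) * `|h|).
  by apply: le_trans r _; rewrite ler_wpM2l// ltW.
have b2 : nm (k - rc h * g) * nm p <= e' * `|h| * nm p by rewrite ler_wpM2r.
apply: le_trans (lerD b1 b2) _.
have -> : e' * ((nm g + 1) * `|h|) + e' * `|h| * nm p = (e' * (K - 1)) * `|h| by rewrite /K; ring.
rewrite ler_wpM2r//; nra.
Qed.

Definition circ (r t : R) : C := rc r * (cos t +i* sin t)%C.

Lemma circ_rdiff r t : rdiff (circ r) t ('i * circ r t).
Proof.
have := rdiffZ (rc r) (rdiff_parts (is_derive_cos t) (is_derive_sin t)).
rewrite (_ : _ * _ = 'i * circ r t)// /circ mulrCA; congr (_ * _).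
by rewrite -complexiE; apply: ceq; rewrite ?cReM ?cImM /=; ring.
Qed.

Lemma nm_circ r t : 0 <= r -> nm (circ r t) = r.
Proof.
move=> r0; rewrite nmM nm_rc ger0_norm// /nm /= cos2Dsin2 sqrtr1 mulr1//.
Qed.

Lemma circ_neq0 r t : 0 < r -> circ r t != 0.
Proof. by move=> r0; rewrite -nm_gt0 nm_circ// ltW. Qed.

Lemma circ2pi r : circ r (2 * pi) = circ r 0.
Proof. by rewrite /circ mulr_natl cos2pi sin2pi cos0 sin0. Qed.

Lemma cont_circ phi a r : ccont phi -> cont (fun t => phi (a + circ r t)).
Proof.
move=> cphi t e e0; have [dl dl0 hd] := cphi (a + circ r t) e e0.
have d2 : 0 < dl / 2 by lra.
have [x x0 hx] := rdiff_cont (circ_rdiff r) t d2.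
exists x => // s /hx h; have := hd (circ r s - circ r t).
have <- : a + circ r s = a + circ r t + (circ r s - circ r t) by ring.
by apply; lra.
Qed.

(** The integral in [dt] over one turn. On the circle [dz = i (circ r t) dt], so the contour
    integral of [psi] is [i] times the value of [cint] at [psi * circ]. *)
Definition cint (u : R -> C) := iint u 0 (2 * pi).

Lemma twopi_gt0 : 0 < 2 * pi :> R. Proof. by rewrite mulr_gt0// pi_gt0. Qed.

Lemma cint_le u B : cont u -> (forall t, nm (u t) <= B) -> nm (cint u) <= B * (2 * pi).
Proof.
move=> cu h; rewrite -[X in _ <= B * X]subr0.
by apply: iint_le => //; exact/ltW/twopi_gt0.
Qed.

Lemma cint_prim psi a r : ent1 psi ->
  cint (fun t => psi (a + circ r t) * circ r t) = 0.
Proof.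
move=> epsi.
have cc : cont (fun t => psi (a + circ r t) * circ r t).
  by apply: contM; [exact/cont_circ/ent1_cont|exact: rdiff_cont (circ_rdiff r)].
have i2 : - 'i * 'i = 1 :> C by rewrite mulNr -expr2 sqrCi opprK.
rewrite /cint (@iintE _ _ (fun t => - 'i * cprim psi (a + circ r t))) ?circ2pi ?subrr//.
  exact/ltW/twopi_gt0.
move=> t; have -> : psi (a + circ r t) * circ r t = - 'i * ('i * circ r t * psi (a + circ r t)).
  by transitivity (- 'i * 'i * (psi (a + circ r t) * circ r t)); [rewrite i2 mul1r|ring].
apply: rdiffZ; apply: (@rdiff_comp (fun t => a + circ r t) (cprim psi)); last exact: cprimP.
by rewrite -[X in rdiff _ _ X]add0r; apply: rdiffD (rdiff_cst _ _) (circ_rdiff r t).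
Qed.

Lemma cint_invX r k : 0 < r -> cint (fun t => (circ r t)^-1 ^+ k.+1) = 0.
Proof.
move=> r0; have kn0 : k.+1%:R != 0 :> C by rewrite pnatr_eq0.
have D t : rdiff (fun t => (circ r t)^-1 ^+ k.+1) t
    ('i * circ r t * (k.+1%:R * (circ r t)^-1 ^+ k * - (circ r t)^-1 ^+ 2)).
  apply: (@rdiff_comp (circ r) (fun z => z^-1 ^+ k.+1)); first exact: circ_rdiff.
  by apply: (cdiff_exp k.+1); apply: cdiff_inv; exact: circ_neq0.
have i2 : - 'i * 'i = 1 :> C by rewrite mulNr -expr2 sqrCi opprK.
rewrite /cint (@iintE _ _ (fun t => 'i / k.+1%:R * (circ r t)^-1 ^+ k.+1)) ?circ2pi ?subrr//.
- exact/ltW/twopi_gt0.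
- exact: (rdiff_cont D).
move=> t; have := rdiffZ ('i / k.+1%:R) (D t).
rewrite (_ : 'i / _ * _ = (circ r t)^-1 ^+ k.+1)//.
transitivity (- 'i * 'i * (circ r t)^-1 ^+ k.+1); last by rewrite i2 mul1r.
rewrite [_ ^+ k.+1]exprS; have := circ_neq0 t r0; move: kn0 (circ r t) => /[swap] x.
move: k.+1%:R (x^-1 ^+ k) => N y N0 x0; by field; rewrite x0 N0.
Qed.

Lemma cint_cst c : cint (fun=> c) = rc (2 * pi) * c.
Proof.
rewrite /cint (@iintE _ _ (fun t => c * rc t)) ?mulr0 ?subr0 ?(mulrC c)//.
- exact/ltW/twopi_gt0.
- exact: cont_cst.
move=> t e e0; exists 1 => // h _; rewrite rmorphD /=.
by rewrite (_ : _ - _ - _ = 0) ?nm0 ?mulr_ge0 ?(ltW e0)//; ring.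
Qed.

Lemma cintD u v : cont u -> cont v -> cint (fun t => u t + v t) = cint u + cint v.
Proof. by move=> cu cv; apply: iintD => //; exact/ltW/twopi_gt0. Qed.

Lemma cintZ c u : cont u -> cint (fun t => c * u t) = c * cint u.
Proof. by move=> cu; apply: iintZ => //; exact/ltW/twopi_gt0. Qed.

Lemma cont_circ_id r : cont (circ r).
Proof. exact: rdiff_cont (circ_rdiff r). Qed.

Lemma circ_sub r t w : 0 < r -> nm w <= r / 2 -> r / 2 <= nm (circ r t - w).
Proof.
move=> r0 hw; have h := nmD (circ r t - w) w.
by rewrite subrK (nm_circ t (ltW r0)) in h; lra.
Qed.

Lemma circ_sub_neq0 r t w : 0 < r -> nm w <= r / 2 -> circ r t - w != 0.
Proof. by move=> r0 hw; rewrite -nm_gt0; have := circ_sub t r0 hw; lra. Qed.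

Lemma cont_kernel r w : 0 < r -> nm w <= r / 2 -> cont (fun t => (circ r t - w)^-1).
Proof.
move=> r0 hw; apply: contV => [|t]; last exact: circ_sub_neq0.
by apply: contB; [exact: cont_circ_id|exact: cont_cst].
Qed.

Lemma eq0_hp (x : C) A : (forall K, nm x <= A * hp R K) -> x = 0.
Proof.
move=> H; apply/eqP; rewrite -nm_eq0 eq_le nm_ge0 andbT leNgt; apply/negP => k0.
have A0 : 0 < A by have := H 0%N; rewrite hp0; lra.
have [n /(_ n (leqnn _))] := hp_small (divr_gt0 k0 A0).
by rewrite ltr_pdivlMr//; have := H n; lra.
Qed.

Lemma contX u k : cont u -> cont (fun t => (u t : C) ^+ k).
Proof.
move=> cu; elim: k => [|k IH]; first exact: (cont_cst (1 : C)).
by rewrite (_ : (fun t => _) = (fun t => u t * u t ^+ k)); [exact: contM|apply/funext => t; rewrite exprS].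
Qed.

(** Geometric series in [w / circ r t]: the negative powers of [circ r t] integrate to zero, and the
    remainder is at most [2 * hp R K] because [|w| <= r / 2]. *)
Lemma cint_kernel r w : 0 < r -> nm w <= r / 2 ->
  cint (fun t => circ r t / (circ r t - w)) = rc (2 * pi).
Proof.
move=> r0 hw; apply/eqP; rewrite -subr_eq0; apply/eqP.
have cI : cont (fun t => (circ r t)^-1).
  by apply: contV; [exact: cont_circ_id|move=> t; exact: circ_neq0].
have cK := cont_kernel r0 hw.
have cR K : cont (fun t => circ r t / (circ r t - w) * (w / circ r t) ^+ K).
  by apply: contM; [apply: contM => //; exact: cont_circ_id|apply: contX; apply: contZ].
have step K : cint (fun t => circ r t / (circ r t - w) * (w / circ r t) ^+ K.+1) =
   cint (fun t => circ r t / (circ r t - w)) - rc (2 * pi).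
  elim: K => [|K IH].
    have -> : cint (fun t => circ r t / (circ r t - w)) = cint (fun t => 1 + circ r t / (circ r t - w) * (w / circ r t) ^+ 1).
      congr cint; apply/funext => t; rewrite expr1.
      by have h1 := circ_neq0 t r0; have h2 := circ_sub_neq0 t r0 hw; field; rewrite h1 h2.
    rewrite cintD//; last exact: (cont_cst (1 : C)).
    by rewrite cint_cst; ring.
  rewrite -IH.
  have -> : cint (fun t => circ r t / (circ r t - w) * (w / circ r t) ^+ K.+1) =
    cint (fun t => w ^+ K.+1 * (circ r t)^-1 ^+ K.+1 + circ r t / (circ r t - w) * (w / circ r t) ^+ K.+2).
    congr cint; apply/funext => t; rewrite -exprMn [_ ^+ K.+2]exprS mulrA -[X in _ = X + _]mul1r -mulrDl.
    congr (_ * _).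
    by have h1 := circ_neq0 t r0; have h2 := circ_sub_neq0 t r0 hw; field; rewrite h1 h2.
  rewrite cintD//; last by apply: contZ; exact: contX.
  by rewrite cintZ ?cint_invX ?mulr0 ?add0r//; exact: contX.
have k1 t : nm (circ r t / (circ r t - w)) <= 2.
  have h := circ_sub t r0 hw; have h' : 0 < nm (circ r t - w) by lra.
  by rewrite nmM nmV nm_circ ?(ltW r0)// ler_pdivrMr//; lra.
have k2 K t : nm ((w / circ r t) ^+ K) <= hp R K.
  rewrite nmX nmM nmV nm_circ ?(ltW r0)// /hp lerXn2r ?nnegrE ?invr_ge0 ?mulr_ge0 ?nm_ge0 ?invr_ge0 ?(ltW r0)//.
  by rewrite ler_pdivrMr// mulrC.
apply: (@eq0_hp _ (2 * (2 * pi))) => K; case: K => [|K].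
  have -> : rc (2 * pi) = rc (2 * pi) * (1 : C) by rewrite mulr1.
  rewrite -cint_cst hp0 mulr1.
  have -> : cint (fun t => circ r t / (circ r t - w)) - cint (fun=> 1) = cint (fun t => circ r t / (circ r t - w) * (w / circ r t) ^+ 1).
    by rewrite step cint_cst mulr1.
  apply: cint_le => // t; rewrite nmM; have := k1 t; have := k2 1%N t; have := hp_le1 R 1.
  by have := nm_ge0 ((w / circ r t) ^+ 1); have := nm_ge0 (circ r t / (circ r t - w)); nra.
rewrite -(step K) mulrAC; apply: cint_le => // t; rewrite nmM.
by apply: ler_pM; rewrite ?nm_ge0.
Qed.

Definition dqa F a z := if z == a then cder F a else (F z - F a) / (z - a).

Lemma dqaE F a z : F z = F a + (z - a) * dqa F a z.
Proof.
rewrite /dqa; case: eqP => [->|/eqP za]; first by rewrite subrr mul0r addr0.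
by rewrite mulrC divfK ?subr_eq0// addrC subrK.
Qed.

(** Away from [a] the product rule applies; at [a] the second order expansion of [F], divided by
    [h], is the first order expansion of the quotient. *)
Lemma dqa_ent1_exp F a p q : ent1 F ->
  (forall e, 0 < e -> exists2 dl, 0 < dl & forall h, nm h < dl ->
     nm (F (a + h) - F a - h * p - h ^+ 2 * q) <= e * nm h ^+ 2) ->
  ent1 (dqa F a).
Proof.
move=> eF H z; have [->|za] := eqVneq z a; last first.
  exists (cder (fun z => (F z - F a) * (z - a)^-1) z).
  apply: (@cdiff_eq _ (fun z => (F z - F a) * (z - a)^-1)).
    have d0 : 0 < nm (z - a) by rewrite nm_gt0 subr_eq0.
    exists (nm (z - a)) => // h hh; rewrite /dqa; case: eqP => // E.
    by move: hh; rewrite -E opprD addrA subrr sub0r nmN ltxx.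
  have [d hd] := eF z.
  have za' : z - a != 0 by rewrite subr_eq0.
  have D := cdiffM (cdiffB hd (cdiff_cst (F a) z))
     (cdiff_comp (cdiffB (cdiff_id z) (cdiff_cst a z)) (cdiff_inv za')).
  by rewrite (cderE D).
have cp : cder F a = p.
  apply: cderE => e e0; have e2 : 0 < e / 2 by lra.
  have [dl dl0 hd] := H 1 ltr01.
  have q1 : 0 < 1 + nm q by have := nm_ge0 q; lra.
  exists (Num.min dl (e / (1 + nm q))); first by rewrite lt_min dl0 divr_gt0.
  move=> h; rewrite lt_min ltr_pdivlMr// => /andP[h1 h2].
  have := nmD (F (a + h) - F a - h * p - h ^+ 2 * q) (h ^+ 2 * q).
  rewrite subrK => s; apply: le_trans s _; rewrite nmM nmX.
  by have := hd h h1; have := nm_ge0 h; nra.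
exists q => e e0; have [dl dl0 hd] := H e e0; exists dl => // h hh.
rewrite /dqa eqxx cp; case: eqP => [E|/eqP ah].
  have -> : h = 0 by apply: (addrI a); rewrite E addr0.
  by rewrite mul0r !subrr nm0 mulr0.
have h0 : h != 0 by apply: contra_neq ah => ->; rewrite addr0.
have hn : 0 < nm h by rewrite nm_gt0.
rewrite [a + h - a]addrC addKr -(ler_pM2r hn) -mulrA -expr2 -nmM.
by rewrite (_ : _ * h = F (a + h) - F a - h * p - h ^+ 2 * q) ?hd//; field.
Qed.

(** A primitive has a second order expansion, obtained by integrating the first order expansion of
    [phi] along a segment. This makes the Cauchy formula available for primitives before it is known
    for all entire functions. *)
Lemma dqa_cprim phi a : ent1 phi -> ent1 (dqa (cprim phi) a).
Proof.
move=> ephi; have [d hd] := ephi a.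
apply: (@dqa_ent1_exp _ _ (phi a) (d / 2)); first by move=> z; exists (phi z); exact: cprimP.
move=> e e0; have [dl dl0 H] := hd e e0; exists dl => // h hh.
pose U t := cprim phi (a + rc t * h) - rc t * (h * phi a) - rc t ^+ 2 * (h ^+ 2 * (d / 2)).
pose u t := h * phi (a + rc t * h) - h * phi a - (2%:R * rc t ^+ 1 * 1) * (h ^+ 2 * (d / 2)).
have rcd t : rdiff (fun t => rc t : C) t 1.
  move=> e1 e10; exists 1 => // k _; rewrite rmorphD /=.
  by rewrite (_ : _ - _ - _ = 0) ?nm0 ?mulr_ge0 ?(ltW e10)//; ring.
have dU t : rdiff U t (u t).
  apply: rdiffB; first apply: rdiffB.
  - by apply: cdiff_line; exact: cprimP.
  - rewrite (_ : (fun x => _) = fun x => (h * phi a) * rc x); last by apply/funext => x; rewrite mulrC.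
    by rewrite -[X in rdiff _ _ X]mulr1; apply: rdiffZ.
  - rewrite (_ : (fun x => _) = fun x => (h ^+ 2 * (d / 2)) * rc x ^+ 2); last by apply/funext => x; rewrite mulrC.
    rewrite [X in rdiff _ _ X]mulrC; apply: rdiffZ.
    rewrite -[X in rdiff _ _ X]mul1r; apply: (@rdiff_comp (fun t => rc t) (fun z => z ^+ 2)) => //.
    exact: (cdiff_exp 2 (cdiff_id _)).
have := @rdiff_mvt _ U u 0 1 (e * nm h ^+ 2) ler01 (fun t _ => dU t).
rewrite subr0 mulr1 /U mul1r !mul0r addr0 subr0 expr1n expr0n /= mul0r subr0 !mul1r => K.
rewrite (_ : _ - _ - _ - _ = cprim phi (a + h) - h * phi a - h ^+ 2 * (d / 2) - cprim phi a); last by ring.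
apply: K => t /andP[t0 t1]; rewrite /u expr1.
have -> : h * phi (a + rc t * h) - h * phi a - 2%:R * rc t * 1 * (h ^+ 2 * (d / 2)) =
   h * (phi (a + rc t * h) - phi a - rc t * h * d) by field.
have th : nm (rc t * h) <= nm h by rewrite nmM nm_rc ger0_norm// ler_piMl ?nm_ge0.
have := H (rc t * h) (le_lt_trans th hh) => K.
rewrite nmM expr2 mulrCA ler_wpM2l ?nm_ge0//.
by apply: le_trans K _; rewrite ler_wpM2l// ltW.
Qed.

(** The entire difference quotient at [a + w] has contour integral zero; [cint_kernel] evaluates the
    part that contains [F (a + w)]. *)
Lemma cauchy_dqa F a w r : 0 < r -> nm w <= r / 2 -> ent1 F -> ent1 (dqa F (a + w)) ->
  rc (2 * pi) * F (a + w) = cint (fun t => F (a + circ r t) * (circ r t / (circ r t - w))).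
Proof.
move=> r0 hw eF ed; have := cint_prim a r ed.
have -> : cint (fun t => dqa F (a + w) (a + circ r t) * circ r t) =
  cint (fun t => F (a + circ r t) * (circ r t / (circ r t - w)) + (- F (a + w)) * (circ r t / (circ r t - w))).
  congr cint; apply/funext => t; have h := circ_sub_neq0 t r0 hw.
  rewrite /dqa; case: eqP => [/addrI E|_]; first by rewrite E subrr eqxx in h.
  by rewrite opprD addrACA subrr add0r; field.
have ck : cont (fun t => circ r t / (circ r t - w)).
  by apply: contM; [exact: cont_circ_id|exact: cont_kernel].
have cF : cont (fun t => F (a + circ r t) * (circ r t / (circ r t - w))).
  by apply: contM => //; apply: cont_circ; exact: ent1_cont.
rewrite cintD//; last exact: contZ.
by rewrite cintZ// cint_kernel// mulNr => /eqP; rewrite subr_eq0 => /eqP ->; rewrite mulrC.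
Qed.

End Cauchy.

(** * Cauchy estimates and Taylor expansion *)

Section Taylor.
Variable R : realType.
Local Notation C := R[i].
Implicit Types f g phi psi chi F : C -> C.

Lemma cont_nm (u : R -> C) : cont u -> continuous (fun t => nm (u t)).
Proof.
move=> cu t; apply/cvgrPdist_le => e e0; have [dl dl0 H] := cu t e e0.
apply/nbhs_ballP; exists dl => //= s ts; rewrite distrC.
have h := H s; rewrite distrC in h.
have := h ts; have := nmD (u s - u t) (u t); have := nmD (u t - u s) (u s).
by rewrite !subrK (nmBC (u t)) ler_norml => *; apply/andP; split; lra.
Qed.

Lemma cont_bounded (u : R -> C) a b : a <= b -> cont u ->
  exists M, forall t, a <= t <= b -> nm (u t) <= M.
Proof.
move=> ab /cont_nm cu.
have [c _ hc] := EVT_max ab (continuous_subspaceT (A := `[a, b]%classic) cu).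
by exists (nm (u c)) => t ht; apply: hc; rewrite in_itv.
Qed.

Lemma cint_le_itv (u : R -> C) B : cont u ->
  (forall t, 0 <= t <= 2 * pi -> nm (u t) <= B) -> nm (cint u) <= B * (2 * pi).
Proof.
move=> cu h; rewrite -[X in _ <= B * X]subr0.
by apply: iint_le => //; exact/ltW/twopi_gt0.
Qed.

Lemma circ_bounded F a r : ent1 F -> exists2 M, 0 <= M &
  forall t, 0 <= t <= 2 * pi -> nm (F (a + circ r t)) <= M.
Proof.
move=> eF; have [M hM] := cont_bounded (ltW (twopi_gt0 R)) (cont_circ a r (ent1_cont eF)).
exists M => //; apply: le_trans (nm_ge0 _) (hM 0 _); rewrite lexx; exact/ltW/twopi_gt0.
Qed.

(** The Cauchy formula for the primitive [F] is differentiated under the integral sign, and the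
    resulting kernel is expanded to second order. This passes from primitives to all entire
    functions and takes the place of removing the singularity of the difference quotient. *)
Lemma ent1_second phi a : ent1 phi -> exists p q, forall e, 0 < e -> exists2 dl, 0 < dl &
  forall h, nm h < dl -> nm (phi (a + h) - phi a - h * p - h ^+ 2 * q) <= e * nm h ^+ 2.
Proof.
move=> ephi; pose F := cprim phi.
have eF : ent1 F by move=> z; exists (phi z); exact: cprimP.
have [M M0 HM] := circ_bounded a 1 eF.
have T0 := twopi_gt0 R; have T1 : rc (2 * pi) != 0 :> C by rewrite -nm_gt0 nm_rc gtr0_norm.
pose c t := circ (1 : R) t; pose Fc t := F (a + c t).
have cc : cont c by exact: cont_circ_id.
have cF : cont Fc by apply: cont_circ; exact: ent1_cont.
have c0 t : c t != 0 by apply: circ_neq0.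
have cn t : nm (c t) = 1 by rewrite nm_circ.
have cI : cont (fun t => (c t)^-1) by apply: contV.
have sub w t : nm w <= 1 / 2 -> c t - w != 0 by apply: circ_sub_neq0.
have subn w t : nm w <= 1 / 2 -> nm (c t - w)^-1 <= 2.
  move=> hw; have h : 1 / 2 <= nm (c t - w) by exact: circ_sub.
  by rewrite nmV -[2]invrK lef_pV2 ?posrE; lra.
have cK w : nm w <= 1 / 2 -> cont (fun t => (c t - w)^-1) by move=> hw; exact: cont_kernel.
have CF w : nm w <= 1 / 2 -> rc (2 * pi) * F (a + w) = cint (fun t => Fc t * (c t / (c t - w))).
  by move=> hw; apply: cauchy_dqa => //; exact: dqa_cprim.
(* The integral is a derivative of [F] at [a + w], and so is [phi (a + w)]. The constant 8 bounds
   the product of the three inverses, each at most 2. *)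
have Cphi w : nm w <= 1 / 4 -> rc (2 * pi) * phi (a + w) = cint (fun t => Fc t * (c t * (c t - w)^-1 ^+ 2)).
  move=> hw; set X := cint _.
  have w2 : nm w <= 1 / 2 by lra.
  suff -> : phi (a + w) = X / rc (2 * pi) by rewrite mulrC divfK.
  apply: (cdiff_uniq (cprimP (a + w) ephi)) => e e0.
  have K0 : 0 < 8 * M + 1 by lra.
  exists (Num.min (1/4) (e / (8 * M + 1))); first by rewrite lt_min !divr_gt0.
  move=> k; rewrite lt_min => /andP[k1]; rewrite ltr_pdivlMr// => k2.
  have wk : nm (w + k) <= 1 / 2 by have := nmD w k; lra.
  rewrite -/F -(ler_pM2l T0) -{1}(gtr0_norm T0) -nm_rc -nmM !mulrBr -[a + w + k]addrA !CF//.
  have -> : rc (2 * pi) * (k * (X / rc (2 * pi))) = k * X by rewrite mulrCA [X / _]mulrC mulVKf.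
  have cX : cont (fun t => Fc t * (c t * (c t - w)^-1 ^+ 2)).
    by apply: contM => //; apply: contM => //; apply: contX; exact: cK.
  have cw v : nm v <= 1 / 2 -> cont (fun t => Fc t * (c t / (c t - v))).
    by move=> hv; apply: contM => //; apply: contM => //; exact: cK.
  have -> : cint (fun t => Fc t * (c t / (c t - (w + k)))) - cint (fun t => Fc t * (c t / (c t - w))) - k * X =
     cint (fun t => k ^+ 2 * (Fc t * (c t * ((c t - w)^-1 ^+ 2 * (c t - (w + k))^-1)))).
    have d0 := cw (w + k) wk; have d1 := contZ (- 1) (cw w w2); have d2 := contZ (- k) cX.
    rewrite /X -(mulNr k) -(cintZ (- k) cX) -(mulN1r (cint _)) -(cintZ (- 1) (cw w w2)).
    rewrite -(cintD d0 d1) -(cintD (contD d0 d1) d2).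
    congr cint; apply/funext => t.
    have h1 := sub w t w2; have h2 := sub (w + k) t wk.
    have h2' : c t - w - k != 0 by rewrite -addrA -opprD.
    by field; rewrite ?h1 ?h2 ?h2'.
  apply: le_trans (cint_le_itv (B := nm k ^+ 2 * (M * 8)) _ _) _.
  - apply: contZ; apply: contM => //; apply: contM => //; apply: contM; last exact: cK.
    by apply: contX; exact: cK.
  - move=> t ht; rewrite nmM nmX ler_wpM2l ?exprn_ge0 ?nm_ge0// nmM.
    apply: ler_pM; rewrite ?nm_ge0 ?HM// nmM cn mul1r nmM nmX.
    rewrite (_ : 8 = 2 ^+ 2 * 2); last by ring.
    by apply: ler_pM; rewrite ?exprn_ge0 ?nm_ge0 ?subn// lerXn2r ?nnegrE ?nm_ge0 ?subn.
  - by have := nm_ge0 k; rewrite [_ * (2 * pi)]mulrC => kk; rewrite ler_pM2l//; nra.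
pose q := 3 / rc (2 * pi) * cint (fun t => Fc t * (c t)^-1 ^+ 2).
pose p := 2 / rc (2 * pi) * cint (fun t => Fc t * (c t)^-1 ^+ 2).
exists (2 / rc (2 * pi) * cint (fun t => Fc t * (c t)^-1 ^+ 2)).
exists (3 / rc (2 * pi) * cint (fun t => Fc t * (c t)^-1 ^+ 3)) => e e0.
have K0 : 0 < 20 * M + 1 by lra.
exists (Num.min (1/4) (e / (20 * M + 1))); first by rewrite lt_min !divr_gt0.
move=> w; rewrite lt_min => /andP[k1]; rewrite ltr_pdivlMr// => k2.
have w4 : nm w <= 1 / 4 by lra.
have w2 : nm w <= 1 / 2 by lra.
have z4 : nm (0 : C) <= 1 / 4 by rewrite nm0; lra.
rewrite -(ler_pM2l T0) -{1}(gtr0_norm T0) -nm_rc -nmM.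
have cX k : cont (fun t => Fc t * (c t)^-1 ^+ k) by apply: contM => //; exact: contX.
have cw v : nm v <= 1 / 2 -> cont (fun t => Fc t * (c t * (c t - v)^-1 ^+ 2)).
  by move=> hv; apply: contM => //; apply: contM => //; apply: contX; exact: cK.
rewrite (_ : rc (2 * pi) * _ = rc (2 * pi) * phi (a + w) - rc (2 * pi) * phi (a + 0)
   + (- (2 * w)) * cint (fun t => Fc t * (c t)^-1 ^+ 2) + (- (3 * w ^+ 2)) * cint (fun t => Fc t * (c t)^-1 ^+ 3)); last first.
  by rewrite addr0; move: T1; move: (rc (2 * pi)) => tp tp0; field.
rewrite Cphi// Cphi//.
(* The kernel [c / (c - w)^2] is the sum of [(k + 1) w^k / c^(k+1)], and the terms with [k >= 3] add
   up to [w^3 (4 c - 3 w) / (c^3 (c - w)^2)]. *)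
have -> : cint (fun t => Fc t * (c t * (c t - w)^-1 ^+ 2)) - cint (fun t => Fc t * (c t * (c t - 0)^-1 ^+ 2))
   + (- (2 * w)) * cint (fun t => Fc t * (c t)^-1 ^+ 2) + (- (3 * w ^+ 2)) * cint (fun t => Fc t * (c t)^-1 ^+ 3)
  = cint (fun t => w ^+ 3 * (Fc t * ((4 * c t - 3 * w) * ((c t)^-1 ^+ 3 * (c t - w)^-1 ^+ 2)))).
  have z2 : nm (0 : C) <= 1 / 2 by rewrite nm0; lra.
  rewrite -(mulN1r (cint (fun t => Fc t * (c t * (c t - 0)^-1 ^+ 2)))) -(cintZ (- 1) (cw 0 z2)).
  rewrite -(cintZ (- (2 * w)) (cX 2%N)) -(cintZ (- (3 * w ^+ 2)) (cX 3%N)).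
  have d1 := contZ (- 1) (cw 0 z2); have d2 := contZ (- (2 * w)) (cX 2%N).
  have d3 := contZ (- (3 * w ^+ 2)) (cX 3%N).
  rewrite -(cintD (cw w w2) d1) -(cintD (contD (cw w w2) d1) d2) -(cintD (contD (contD (cw w w2) d1) d2) d3).
  congr cint; apply/funext => t; have h1 := sub w t w2; rewrite subr0.
  by have h2 := c0 t; field; rewrite h1 h2.
apply: le_trans (cint_le_itv (B := nm w ^+ 3 * (M * (5 * 4))) _ _) _.
- apply: contZ; apply: contM => //; apply: contM.
    by apply: contB; [exact: contZ|exact: cont_cst].
  by apply: contM; apply: contX => //; exact: cK.
- move=> t ht; rewrite nmM nmX ler_wpM2l ?exprn_ge0 ?nm_ge0// nmM.
  apply: ler_pM; rewrite ?nm_ge0 ?HM// nmM; apply: ler_pM; rewrite ?nm_ge0//.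
    apply: le_trans (nmB _ _) _; rewrite (nmM 4) (nmM 3) cn !nm_natr; lra.
  rewrite (nmM ((c t)^-1 ^+ 3)) !nmX nmV cn invr1 expr1n mul1r (_ : 4 = 2 ^+ 2); last by ring.
  by rewrite lerXn2r ?nnegrE ?nm_ge0 ?subn.
- have := nm_ge0 w; rewrite [_ * (2 * pi)]mulrC => kk; rewrite ler_pM2l//.
  have -> : nm w ^+ 3 * (M * (5 * 4)) = nm w ^+ 2 * (nm w * (20 * M)) by ring.
  by rewrite [e * _]mulrC ler_wpM2l ?exprn_ge0//; nra.
Qed.

Lemma dqa_ent phi a : ent1 phi -> ent1 (dqa phi a).
Proof. by move=> e; have [p [q H]] := ent1_second a e; exact: dqa_ent1_exp H. Qed.

Lemma cauchy_formula F a w r : 0 < r -> nm w <= r / 2 -> ent1 F ->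
  rc (2 * pi) * F (a + w) = cint (fun t => F (a + circ r t) * (circ r t / (circ r t - w))).
Proof. by move=> r0 hw eF; apply: cauchy_dqa => //; exact: dqa_ent. Qed.

Lemma mean_value F a r : 0 < r -> ent1 F ->
  rc (2 * pi) * F a = cint (fun t => F (a + circ r t)).
Proof.
move=> r0 eF; have := @cauchy_formula F a 0 r r0 _ eF; rewrite addr0 nm0 => ->; last by lra.
by congr cint; apply/funext => t; rewrite subr0 divff ?mulr1// circ_neq0.
Qed.

Lemma max_center F a r M : 0 < r -> ent1 F -> (forall z, nm z = r -> nm (F (a + z)) <= M) ->
  nm (F a) <= M.
Proof.
move=> r0 eF H; have T0 := twopi_gt0 R.
rewrite -(ler_pM2l T0) -{1}(gtr0_norm T0) -nm_rc -nmM (mean_value a r0 eF) [_ * M]mulrC.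
by apply: cint_le => [|t]; [exact/cont_circ/ent1_cont|apply: H; rewrite nm_circ// ltW].
Qed.

(** A crude maximum principle read off the Cauchy formula: at half the radius the kernel is at most
    2. *)
Lemma max_half F a w r M : 0 < r -> ent1 F -> (forall z, nm z = r -> nm (F (a + z)) <= M) ->
  nm w <= r / 2 -> nm (F (a + w)) <= 2 * M.
Proof.
move=> r0 eF H hw; have T0 := twopi_gt0 R.
rewrite -(ler_pM2l T0) -{1}(gtr0_norm T0) -nm_rc -nmM (cauchy_formula a r0 hw eF) [2 * pi * _]mulrC.
apply: cint_le => [|t].
  apply: contM; first exact/cont_circ/ent1_cont.
  by apply: contM; [exact: cont_circ_id|exact: cont_kernel].
rewrite nmM [2 * M]mulrC; apply: ler_pM; rewrite ?nm_ge0 ?H ?nm_circ// ?(ltW r0)//.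
have h := circ_sub t r0 hw; have h' : 0 < nm (circ r t - w) by lra.
by rewrite nmM nmV nm_circ ?(ltW r0)// ler_pdivrMr//; lra.
Qed.

Lemma cauchy_cder F a r M : 0 < r -> ent1 F -> (forall z, nm z = r -> nm (F (a + z)) <= M) ->
  nm (cder F a) <= 2 * M / r.
Proof.
move=> r0 eF H; have -> : cder F a = dqa F a a by rewrite /dqa eqxx.
apply: (max_center (r := r)) => //; first exact: dqa_ent.
move=> z hz; have z0 : z != 0 by rewrite -nm_gt0 hz.
rewrite /dqa; case: eqP => [E|_].
  by have : z = 0 by [apply: (addrI a); rewrite addr0]; move/eqP: z0.
rewrite [a + z - a]addrC addKr nmM nmV hz ler_wpM2r ?invr_ge0 ?(ltW r0)//.
apply: le_trans (nmB _ _) _; have := H z hz; have := max_center r0 eF H; lra.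
Qed.

Definition dq phi := dqa phi 0.

Lemma dq_ent phi : ent1 phi -> ent1 (dq phi). Proof. exact: dqa_ent. Qed.
Lemma dqE phi z : phi z = phi 0 + z * dq phi z.
Proof. by rewrite {1}(dqaE phi 0 z) subr0. Qed.

Lemma dq_uniq phi chi c : ccont chi -> (forall z, phi z = c + z * chi z) ->
  c = phi 0 /\ dq phi = chi.
Proof.
move=> cchi E; have c0 : c = phi 0 by rewrite E mul0r addr0.
split=> //; apply/funext => z; rewrite /dq /dqa; case: eqP => [->|/eqP z0]; last first.
  by rewrite E -c0 subr0 addrC addKr mulrC mulKf.
apply: cderE => e e0; have [dl dl0 H] := cchi 0 e e0; exists dl => // h hh.
have := H h hh; rewrite !add0r E -c0 => K.
rewrite (_ : c + h * chi h - c - h * chi 0 = h * (chi h - chi 0)); last by ring.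
by rewrite nmM mulrC ler_wpM2r ?nm_ge0.
Qed.

(** Taylor coefficients by iterated difference quotients at [0]: the expansion with remainder is
    then an algebraic identity, and no power series has to converge. *)
Definition tc phi k := iter k dq phi 0.

Lemma iter_dq_ent phi k : ent1 phi -> ent1 (iter k dq phi).
Proof. by move=> e; elim: k => //= k; exact: dq_ent. Qed.

Lemma tc0 phi : tc phi 0 = phi 0. Proof. by []. Qed.
Lemma tcS phi k : tc phi k.+1 = tc (dq phi) k. Proof. by rewrite /tc iterSr. Qed.

Lemma taylor phi K z :
  phi z = \sum_(k < K) tc phi k * z ^+ k + z ^+ K * iter K dq phi z.
Proof.
elim: K => [|K IH]; first by rewrite big_ord0 add0r mul1r.
rewrite IH big_ord_recr /= -addrA; congr (_ + _).
by rewrite {1}(dqE (iter K dq phi)) exprSr /tc; ring.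
Qed.

Lemma tc_cint phi r k : 0 < r -> ent1 phi ->
  rc (2 * pi) * tc phi k = cint (fun t => phi (circ r t) * (circ r t)^-1 ^+ k).
Proof.
move=> r0; have ci n : cont (fun t => (circ r t)^-1 ^+ n).
  by apply: contX; apply: contV; [exact: cont_circ_id|move=> t; exact: circ_neq0].
have cc psi : ent1 psi -> cont (fun t => psi (circ r t)).
  move=> /ent1_cont/(cont_circ 0 r).
  by under eq_fun do rewrite add0r.
elim: k phi => [|k IH] phi ephi.
  rewrite tc0 (mean_value 0 r0 ephi).
  by congr cint; apply/funext => t; rewrite add0r mulr1.
rewrite tcS IH; last exact: dq_ent.
have -> : cint (fun t => phi (circ r t) * (circ r t)^-1 ^+ k.+1) =
   cint (fun t => phi 0 * (circ r t)^-1 ^+ k.+1 + dq phi (circ r t) * (circ r t)^-1 ^+ k).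
  congr cint; apply/funext => t; rewrite (dqE phi) mulrDl; congr (_ + _).
  by rewrite exprS; have := circ_neq0 t r0 => h; field.
rewrite cintD; first by rewrite cintZ// cint_invX// mulr0 add0r.
  exact: contZ.
by apply: contM => //; apply: cc; exact: dq_ent.
Qed.

Lemma tc_le phi r M k : 0 < r -> ent1 phi -> (forall z, nm z = r -> nm (phi z) <= M) ->
  nm (tc phi k) * r ^+ k <= M.
Proof.
move=> r0 ephi H; have T0 := twopi_gt0 R.
rewrite -(ler_pM2l T0) mulrA -{1}(gtr0_norm T0) -nm_rc -nmM (tc_cint k r0 ephi).
rewrite -ler_pdivlMr ?exprn_gt0// -mulrA [X in _ <= X]mulrC.
apply: cint_le => [|t].
  apply: contM; last by apply: contX; apply: contV; [exact: cont_circ_id|move=> t; exact: circ_neq0].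
  have := cont_circ 0 r (ent1_cont ephi).
  by under eq_fun do rewrite add0r.
by rewrite nmM nmX nmV nm_circ ?(ltW r0)// exprVn ler_wpM2r ?invr_ge0 ?exprn_ge0 ?(ltW r0)// H ?nm_circ// ltW.
Qed.

(** The remainder divided by [w^K] is entire. On the circle the remainder is at most [phi] and its
    [K] Taylor terms, each bounded by [M]; [max_half] carries the bound inside. *)
Lemma taylor_rem phi r M K w : 0 < r -> ent1 phi -> (forall z, nm z = r -> nm (phi z) <= M) ->
  nm w <= r / 2 ->
  nm (phi w - \sum_(k < K) tc phi k * w ^+ k) <= 2 * (K.+1%:R * M) * (nm w / r) ^+ K.
Proof.
move=> r0 ephi H hw.
rewrite {1}(taylor phi K w) addrC addKr nmM nmX exprMn [X in _ <= X]mulrC -mulrA.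
rewrite ler_wpM2l ?exprn_ge0 ?nm_ge0// exprVn mulrC -mulrA.
rewrite -[w in iter _ _ _ w]add0r.
apply: (max_half (r := r)) => //; first exact: iter_dq_ent.
move=> z hz; rewrite add0r ler_pdivlMr ?exprn_gt0// mulrC -hz -nmX -nmM.
have -> : z ^+ K * iter K dq phi z = phi z - \sum_(k < K) tc phi k * z ^+ k.
  by rewrite (taylor phi K z) addrC addKr.
apply: le_trans (nmB _ _) _; rewrite -natr1 mulrDl mul1r addrC lerD ?H//.
apply: le_trans (nm_sum _ _ _) _.
have -> : K%:R * M = \sum_(k < K) M by rewrite sumr_const card_ord mulr_natl.
by apply: ler_sum => k _; rewrite nmM nmX hz; exact: tc_le.
Qed.

Lemma hp_lin K : K.+1%:R * hp R K <= 2.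
Proof.
have := hp_inv R K; have := hp_le1 R K; rewrite -natr1 mulrDl mul1r; lra.
Qed.

(** At a quarter of the radius the remainder has a factor [4^-K]; half of it absorbs the factor
    [K + 1], and [2^-K] is left. *)
Lemma taylor_rem_hp phi r M K w : 0 < r -> ent1 phi -> 0 <= M ->
  (forall z, nm z = r -> nm (phi z) <= M) -> nm w <= r / 4 ->
  nm (phi w - \sum_(k < K) tc phi k * w ^+ k) <= 4 * M * hp R K.
Proof.
move=> r0 ephi M0 H hw; apply: le_trans (taylor_rem K r0 ephi H _) _; first by lra.
have q : (nm w / r) ^+ K <= hp R K * hp R K.
  rewrite /hp -exprMn lerXn2r ?nnegrE ?mulr_ge0 ?nm_ge0 ?invr_ge0 ?(ltW r0)//.
  by rewrite ler_pdivrMr//; lra.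
have K1 : 0 <= K.+1%:R :> R by [].
have := hp_lin K; have := hp_gt0 R K => h0 h1.
apply: (le_trans (y := 2 * (K.+1%:R * M) * (hp R K * hp R K))).
  by rewrite ler_wpM2l// mulr_ge0// mulr_ge0.
rewrite (_ : 2 * (K.+1%:R * M) * (hp R K * hp R K) = (2 * M * hp R K) * (K.+1%:R * hp R K)); last by ring.
rewrite (_ : 4 * M * hp R K = (2 * M * hp R K) * 2); last by ring.
by rewrite ler_wpM2l// mulr_ge0 ?(ltW h0)// mulr_ge0.
Qed.

Lemma circP (r : R) (z : C) : 0 <= r -> nm z = r -> exists2 t, 0 <= t <= 2 * pi & z = circ r t.
Proof.
rewrite le_eqVlt => /orP[/eqP <- hz|r0 hz].
  exists 0; first by rewrite lexx ltW// twopi_gt0.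
  by rewrite /circ mul0r; apply/eqP; rewrite -nm_eq0 hz.
pose x := complex.Re z / r; pose y := complex.Im z / r.
have r2 : complex.Re z ^+ 2 + complex.Im z ^+ 2 = r ^+ 2.
  by rewrite -hz /nm sqr_sqrtr// addr_ge0 ?sqr_ge0.
have xy : x ^+ 2 + y ^+ 2 = 1.
  by rewrite /x /y !expr_div_n -mulrDl r2 divff// expf_neq0// gt_eqF.
have x1 : -1 <= x <= 1.
  by rewrite -ler_norml -(@ler_sqr R)// ?nnegrE// expr1n real_normK ?num_real// -xy lerDl sqr_ge0.
have [/andP[a0 api] ca] := acos_def x1.
have zE : z = rc r * (x +i* y)%C.
  by apply: ceq; rewrite ?cReM ?cImM /= /x /y mul0r ?subr0 ?addr0 mulrC divfK// gt_eqF.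
have sa : sin (acos x) = `|y|.
  by rewrite sin_acos// -xy addrC addKr sqrtr_sqr.
have [y0|y0] := leP 0 y.
  exists (acos x); first by rewrite a0 /=; have := @pi_gt0 R; lra.
  by rewrite /circ ca sa ger0_norm.
exists (2 * pi - acos x); first by have := @pi_gt0 R; lra.
rewrite /circ mulr_natl cosB sinB cos2pi sin2pi ca sa ltr0_norm// zE.
by congr (_ * (_ +i* _)%C); ring.
Qed.

Lemma circle_bounded F a (r : R) : 0 <= r -> ent1 F -> exists2 M, 0 <= M &
  forall z, nm z = r -> nm (F (a + z)) <= M.
Proof.
move=> r0 eF; have [M M0 HM] := circ_bounded a r eF; exists M => // z hz.
by have [t ht ->] := circP r0 hz; exact: HM.
Qed.

Lemma tc_zero phi : ent1 phi -> (forall k, tc phi k = 0) -> forall w, phi w = 0.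
Proof.
move=> ephi H w; pose r := 4 * nm w + 1.
have r0 : 0 < r by have := nm_ge0 w; rewrite /r; lra.
have [M M0 HM] := circle_bounded 0 (ltW r0) ephi.
apply: (@eq0_hp _ _ (4 * M)) => K.
have := @taylor_rem_hp phi r M K w r0 ephi M0.
rewrite big1 ?subr0; last by move=> k _; rewrite H mul0r.
by apply => [z /HM|]; rewrite ?add0r// /r; lra.
Qed.

Lemma tcD phi psi k : ent1 phi -> ent1 psi ->
  tc (fun z => phi z + psi z) k = tc phi k + tc psi k.
Proof.
elim: k phi psi => [//|k IH] phi psi e1 e2; rewrite !tcS -IH; [|exact: dq_ent..].
have [||_ ->//] := @dq_uniq (fun z => phi z + psi z) (fun z => dq phi z + dq psi z) (phi 0 + psi 0).
  move=> z; have [a ha] := dq_ent e1 z; have [b hb] := dq_ent e2 z; exact: cdiff_cont1 (cdiffD ha hb).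
by move=> z; rewrite (dqE phi) (dqE psi); ring.
Qed.

Lemma tcM_id phi : ent1 phi -> forall k, tc (fun z => z * phi z) k.+1 = tc phi k.
Proof.
move=> e1 k; rewrite tcS.
have [|_ ->//] := @dq_uniq (fun z => z * phi z) phi 0 (ent1_cont e1).
by move=> z; rewrite add0r.
Qed.

(** Two successive difference quotients at [a] express the derivative near [a] through [chi] and its
    derivative; the latter is multiplied by [h^2] and bounded by a Cauchy estimate. *)
Lemma cder_ent phi : ent1 phi -> ent1 (cder phi).
Proof.
move=> ephi a; pose psi := dqa phi a; pose chi := dqa psi a.
have epsi : ent1 psi by exact: dqa_ent.
have echi : ent1 chi by exact: dqa_ent.
have mul f g z : ent1 f -> (forall z, g z = g a + (z - a) * f z) -> cder g z = f z + (z - a) * cder f z.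
  move=> ef E; have -> : g = fun z => g a + (z - a) * f z by apply/funext => x.
  apply: cderE; rewrite -[X in cdiff _ _ X]add0r; apply: cdiffD (cdiff_cst _ _) _.
  rewrite -[X in _ _ _ (X + _)]mul1r -[1]subr0; apply: cdiffM (cderP _ ef).
  exact: cdiffB (cdiff_id _) (cdiff_cst _ _).
have E1 z := mul psi phi z epsi (dqaE phi a).
have E2 z := mul chi psi z echi (dqaE psi a).
exists (2 * chi a).
have [dl dl0 Hdl] := ent1_cont echi a ltr01.
have bd h : nm h < dl / 2 -> nm (cder chi (a + h)) <= 4 * (nm (chi a) + 1) / dl.
  move=> hh; have d2 : 0 < dl / 2 by lra.
  rewrite (_ : 4 * _ / dl = 2 * (nm (chi a) + 1) / (dl / 2)); last by field; lra.
  apply: cauchy_cder => // z hz.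
  have := Hdl (h + z); rewrite addrA => K.
  have k : nm (h + z) < dl by have := nmD h z; lra.
  by have := K k; have := nmD (chi (a + h + z) - chi a) (chi a); rewrite subrK; lra.
move=> e e0.
have e4 : 0 < e / 4 by lra.
have [d2 d20 Hd2] := ent1_cont echi a e4.
have B0 : 0 < 8 * (nm (chi a) + 1) / dl + 1.
  have : 0 <= 8 * (nm (chi a) + 1) / dl by rewrite divr_ge0 ?(ltW dl0)//; have := nm_ge0 (chi a); lra.
  lra.
exists (Num.min (dl / 2) (Num.min d2 (e / (8 * (nm (chi a) + 1) / dl + 1)))).
  by rewrite !lt_min d20 !divr_gt0.
move=> h; rewrite !lt_min => /andP[h1 /andP[h2]]; rewrite ltr_pdivlMr// => h3.
rewrite !E1 !E2 subrr !mul0r !addr0 (dqaE psi a (a + h)) -/chi.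
have -> : a + h - a = h by ring.
rewrite (_ : _ - _ - _ = h * (2 * (chi (a + h) - chi a) + h * cder chi (a + h))); last by ring.
rewrite nmM mulrC ler_wpM2r ?nm_ge0//.
apply: le_trans (nmD _ _) _; rewrite !nmM nm_natr.
have := Hd2 h h2; have := bd h h1.
rewrite (_ : 8 * (nm (chi a) + 1) / dl = 2 * (4 * (nm (chi a) + 1) / dl)) in h3; last by field; lra.
have := nm_ge0 (cder chi (a + h)); have := nm_ge0 h; nra.
Qed.

Lemma tc_cder phi k : ent1 phi -> tc (cder phi) k = k.+1%:R * tc phi k.+1.
Proof.
elim: k phi => [|k IH] phi ephi; first by rewrite mul1r tcS !tc0 /dq /dqa eqxx.
have E : cder phi = fun z => dq phi z + z * cder (dq phi) z.
  apply/funext => z; have {1}-> : phi = fun z => phi 0 + z * dq phi z by apply/funext => x; exact: dqE.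
  apply: cderE; rewrite -[X in cdiff _ _ X]add0r; apply: cdiffD (cdiff_cst _ _) _.
  rewrite -[X in _ _ _ (X + _)]mul1r; apply: cdiffM (cderP _ (dq_ent ephi)).
  exact: cdiff_id.
have ed := dq_ent ephi; have ec := cder_ent ed.
rewrite E tcD//; last first.
  by move=> z; have [d hd] := ec z; exists (1 * cder (dq phi) z + z * d); apply: cdiffM (cdiff_id z) hd.
by rewrite tcM_id// IH// -!tcS -[in RHS]natr1; ring.
Qed.

Lemma ent1_id0 phi : ent1 phi -> (exists2 dl, 0 < dl & forall z, nm z < dl -> phi z = 0) ->
  forall z, phi z = 0.
Proof.
move=> ephi [dl dl0 H]; apply: tc_zero => // k.
have : forall z, nm z < dl -> iter k dq phi z = 0.
  elim: k => [//|k IH] z hz /=.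
  have ek := iter_dq_ent k.+1 ephi.
  have nz w : nm w < dl -> w != 0 -> iter k.+1 dq phi w = 0.
    move=> hw w0; have := dqE (iter k dq phi) w; rewrite !IH ?nm0// add0r => /esym/eqP.
    by rewrite mulf_eq0 (negbTE w0) => /eqP.
  have [->|z0] := eqVneq z 0; last exact: nz.
  apply/eqP; rewrite -nm_eq0 eq_le nm_ge0 andbT; apply/ler_addgt0Pr => e e0; rewrite add0r.
  have [d d0 hd] := ent1_cont ek 0 e0.
  have m0 : 0 < Num.min d dl by rewrite lt_min d0.
  have [h h0] := rc_lt_ex m0; rewrite lt_min => /andP[h1 h2].
  by have := hd h h1; rewrite add0r (nz h h2 h0) sub0r nmN.
by apply; rewrite nm0.
Qed.

End Taylor.

(** * The complex exponential *)

Section ExpC.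
Variable R : realType.
Local Notation C := R[i].

Lemma expCE (w : C) : expC w = rc (expR (complex.Re w)) * circ 1 (complex.Im w).
Proof. by rewrite /expC /circ mul1r. Qed.

Lemma circD (s t : R) : circ 1 (s + t) = circ 1 s * circ 1 t.
Proof.
by rewrite /circ !mul1r cosD sinD; apply: ceq; rewrite ?cReM ?cImM /= addrC//; ring.
Qed.

Lemma expCD (v w : C) : expC (v + w) = expC v * expC w.
Proof. by rewrite !expCE cReD cImD expRD circD rmorphM /=; ring. Qed.

Lemma expC0 : expC (0 : C) = 1.
Proof. by rewrite expCE expR0 /circ /= cos0 sin0 !mul1r. Qed.

Lemma nm_expC (w : C) : nm (expC w) = expR (complex.Re w).
Proof. by rewrite expCE nmM nm_rc nm_circ// mulr1 ger0_norm// expR_ge0. Qed.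

Lemma expC_neq0 (w : C) : expC w != 0.
Proof. by rewrite -nm_gt0 nm_expC expR_gt0. Qed.

Lemma expCN (w : C) : expC (- w) = (expC w)^-1.
Proof.
by apply: (mulfI (expC_neq0 w)); rewrite -expCD subrr expC0 divff// expC_neq0.
Qed.

Lemma expC_surj (u : C) : u != 0 -> exists w, expC w = u.
Proof.
move=> u0; have n0 : 0 < nm u by rewrite nm_gt0.
have [t _ E] := circP (ltW n0) (erefl (nm u)).
exists ((ln (nm u)) +i* t)%C; by rewrite expCE /= lnK ?posrE// [RHS]E /circ mul1r.
Qed.

Lemma cdiff_expC0 : cdiff (@expC R) 0 1.
Proof.
move=> e e0; rewrite expC0.
pose e' := Num.min 1 (e / 4).
have e'0 : 0 < e' by rewrite lt_min ltr01 divr_gt0.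
have e'1 : e' <= 1 by rewrite ge_min lexx.
have e'4 : e' * 4 <= e by rewrite -ler_pdivlMr// ge_min lexx orbT.
have [a a0 ha] := rdiff_Re (is_derive_expR (0 : R)) e'0.
have [b b0 hb] := circ_rdiff 1 0 e'0.
have [c c0 hc] := rdiff_cont (circ_rdiff (1 : R)) 0 e'0.
exists (Num.min a (Num.min b c)); first by rewrite !lt_min a0 b0.
move=> h; rewrite !lt_min => /andP[h1 /andP[h2 h3]].
have rx := nm_Re h; have ry := nm_Im h.
rewrite add0r mulr1 expCE; set x := complex.Re h in rx *; set y := complex.Im h in ry *.
have := ha x (le_lt_trans rx h1); rewrite add0r expR0 mulr1 => p.
have E1 : circ (1 : R) 0 = 1 by rewrite /circ cos0 sin0 mul1r.
have := hb y (le_lt_trans ry h2); rewrite add0r E1 mulr1 => q.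
have := hc y; rewrite subr0 E1 => /(_ (le_lt_trans ry h3)) r.
have -> : rc (expR x) * circ 1 y - 1 - h =
  (rc (expR x - 1 - x)) * circ 1 y + (circ 1 y - 1 - rc y * 'i) + rc x * (circ 1 y - 1).
  by rewrite {1}(cE h) -/x -/y !rmorphB /= !rc1; ring.
apply: le_trans (nmD _ _) _; apply: le_trans (lerD (nmD _ _) (lexx _)) _.
rewrite (nmM (rc (expR x - 1 - x))) (nmM (rc x)) !nm_rc nm_circ// mulr1.
have x0 := normr_ge0 x; have y0 := normr_ge0 y.
have := nm_ge0 (circ 1 y - 1); nra.
Qed.

Lemma cdiff_expC (w : C) : cdiff (@expC R) w (expC w).
Proof.
move=> e e0; have n0 : 0 < nm (expC w) by rewrite nm_gt0 expC_neq0.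
have [a a0 ha] := cdiff_expC0 (divr_gt0 e0 n0); exists a => // h hh.
have := ha h hh; rewrite add0r expC0 expCD mulr1 => p.
rewrite (_ : _ - _ - _ = expC w * (expC h - 1 - h)); last by ring.
rewrite nmM; apply: le_trans (ler_wpM2l (ltW n0) p) _.
by rewrite mulrA mulrCA divff ?mulr1// gt_eqF.
Qed.

Lemma ent1_expC : ent1 (@expC R).
Proof. by move=> w; exists (expC w); exact: cdiff_expC. Qed.

End ExpC.

(** * A Jensen type estimate *)

Section Jensen.
Variable R : realType.
Local Notation C := R[i].
Implicit Types f g phi psi chi F : C -> C.

Lemma prim_root_ex n : (0 < n)%N -> exists w : C, n.-primitive_root w.
Proof.
move=> n0; pose p : {poly C} := 'X^n - 1; have [r Dp] := closed_field_poly_normal p.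
move: Dp; rewrite lead_coefE size_XnsubC// coefB coefXn eqxx coef1 eqn0Ngt n0 subr0 scale1r => Dp.
have rn1 : all n.-unity_root r by apply/allP => z; rewrite -root_prod_XsubC -Dp.
have sz_r : (n < (size r).+1)%N by rewrite -(size_prod_XsubC r id) -Dp size_XnsubC.
have [|z] := hasP (cyclic.has_prim_root n0 rn1 _ sz_r); last by exists z.
by rewrite -separable.separable_prod_XsubC -Dp cyclotomic.separable_Xn_sub_1// pnatr_eq0 -lt0n.
Qed.

Lemma prim_root_sum n (w : C) m : n.-primitive_root w -> ~~ (n %| m)%N ->
  \sum_(j < n) w ^+ (j * m) = 0.
Proof.
move=> pw nm; have w1 : w ^+ m - 1 != 0 by rewrite subr_eq0 -(prim_order_dvd pw).
apply: (mulfI w1); under eq_bigr do rewrite mulnC exprM.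
by rewrite -subrX1 -exprM mulnC exprM (prim_expr_order pw) expr1n subrr mulr0.
Qed.

Lemma nm_prim_root n (w : C) : n.-primitive_root w -> nm w = 1.
Proof.
move=> pw; have n0 := prim_order_gt0 pw.
have := congr1 (@nm R) (prim_expr_order pw); rewrite nmX nm1 => /eqP.
by rewrite pexpr_eq1 ?nm_ge0// => /eqP.
Qed.

Lemma ent1M f g : ent1 f -> ent1 g -> ent1 (fun z => f z * g z).
Proof. by move=> ef eg z; exists (cder f z * g z + f z * cder g z); apply: cdiffM; exact: cderP. Qed.

Lemma ent1D f g : ent1 f -> ent1 g -> ent1 (fun z => f z + g z).
Proof. by move=> ef eg z; exists (cder f z + cder g z); apply: cdiffD; exact: cderP. Qed.

Lemma ent1_cst (c : C) : ent1 (fun=> c).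
Proof. by move=> z; exists 0; exact: cdiff_cst. Qed.

Lemma ent1_id : ent1 (fun z : C => z).
Proof. by move=> z; exists 1; exact: cdiff_id. Qed.

Lemma ent1_comp f g : ent1 f -> ent1 g -> ent1 (fun z => f (g z)).
Proof. by move=> ef eg z; exists (cder g z * cder f (g z)); apply: cdiff_comp; exact: cderP. Qed.

Lemma ent1_prod (I : Type) (s : seq I) (F : I -> C -> C) : (forall i, ent1 (F i)) ->
  ent1 (fun z => \prod_(i <- s) F i z).
Proof.
move=> eF; elim: s => [|i s IH].
  by rewrite (_ : (fun z => _) = fun=> 1); [exact: ent1_cst|apply/funext => z; rewrite big_nil].
rewrite (_ : (fun z => _) = fun z => F i z * \prod_(i <- s) F i z); first exact: ent1M.
by apply/funext => z; rewrite big_cons.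
Qed.

Lemma ent1_sum (I : Type) (s : seq I) (F : I -> C -> C) : (forall i, ent1 (F i)) ->
  ent1 (fun z => \sum_(i <- s) F i z).
Proof.
move=> eF; elim: s => [|i s IH].
  by rewrite (_ : (fun z => _) = fun=> 0); [exact: ent1_cst|apply/funext => z; rewrite big_nil].
rewrite (_ : (fun z => _) = fun z => F i z + \sum_(i <- s) F i z); first exact: ent1D.
by apply/funext => z; rewrite big_cons.
Qed.

(* A discrete Jensen inequality: rotating [F] by the [n]-th roots of unity and
   taking the product replaces the mean of [ln |F|] over the circle. *)
Lemma discrete_jensen F n (w : C) r : (0 < n)%N -> n.-primitive_root w -> 0 < r -> ent1 F ->
  F 0 != 0 -> exists2 z, nm z = r & (forall j : 'I_n, F (w ^+ j * z) != 0) /\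
    n%:R * ln (nm (F 0) / 2) <= \sum_(j < n) ln (nm (F (w ^+ j * z))).
Proof.
move=> n0 pw r0 eF F0; pose G z := \prod_(j < n) F (w ^+ j * z).
have eG : ent1 G.
  apply: ent1_prod => j; apply: (ent1_comp eF).
  by apply: ent1M; [exact: ent1_cst|exact: ent1_id].
have F0' : 0 < nm (F 0) by rewrite nm_gt0.
have [z hz K] : exists2 z, nm z = r & (nm (F 0) / 2) ^+ n < nm (G z).
  apply: contrapT => K.
  (* A product bounded by [(|F 0| / 2)^n] on the circle would be so at the centre, where its modulus
     is [|F 0|^n]. The division by 2 makes these two numbers differ. *)
  have := @max_center R G 0 r ((nm (F 0) / 2) ^+ n) r0 eG.
  have -> : nm (G 0) = nm (F 0) ^+ n.
    by rewrite /G nm_prod; under eq_bigr do rewrite mulr0; rewrite prodr_const card_ord.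
  rewrite expr_div_n leNgt => /(_ _)/negP; apply.
    by move=> z hz; rewrite add0r leNgt -expr_div_n; apply/negP => h; apply: K; exists z.
  by rewrite ltr_pdivrMr ?exprn_gt0// ltr_pMr ?exprn_gt0// exprn_egt1// ?ltr1n// -lt0n.
exists z => //.
have G0 : G z != 0 by rewrite -nm_gt0; apply: lt_trans K; rewrite exprn_gt0// divr_gt0.
have nz (j : 'I_n) : F (w ^+ j * z) != 0 by move: G0; rewrite /G prodf_seq_neq0 => /allP/(_ j); apply; rewrite mem_index_enum.
split=> //; rewrite [n%:R * _]mulr_natl -lnXn; last by rewrite divr_gt0.
have -> : \sum_(j < n) ln (nm (F (w ^+ j * z))) = ln (nm (G z)).
  apply: expR_inj; rewrite expR_sum lnK ?posrE ?nm_gt0// /G nm_prod.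
  by apply: eq_bigr => j _; rewrite lnK ?posrE ?nm_gt0.
by rewrite ler_ln ?posrE ?nm_gt0 ?exprn_gt0 ?divr_gt0// ltW.
Qed.

(* On the circle [ln |N1|] and [ln |N2|] are at most [ln M], and by Jensen [ln |N2|] is at least
   [ln |N2 0|] in the mean; as [Re dlt = ln |N1| - ln |N2|], this bounds the mean of [|Re dlt|]. *)
Lemma quotient_tc (dlt N1 N2 : C -> C) r M k : 0 < r -> ent1 dlt -> ent1 N1 -> ent1 N2 ->
  (forall z, N1 z = expC (dlt z) * N2 z) ->
  (forall z, nm z = r -> nm (N1 z) <= M /\ nm (N2 z) <= M) -> N2 0 != 0 -> (0 < k)%N ->
  nm (tc dlt k) * r ^+ k <= 4 * (ln M - ln (nm (N2 0) / 2)) - 2 * complex.Re (dlt 0).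
Proof.
move=> r0 ed e1 e2 E HM N0 k0.
have r4 : 0 < 4 * r by lra.
have [M' M'0 HM'] := circle_bounded 0 (ltW r4) ed.
apply/ler_addgt0Pr => eps eps0.
have e4 : 0 < eps / (16 * M' + 1) by rewrite divr_gt0//; lra.
have [K0 hK0] := hp_small e4.
(* The Taylor polynomial of degree below [K] is accurate to [eps / 4] on the circle. With
   [n = K + k] points the weight [w ^+ (j * (n - k))] isolates its coefficient [k], whereas its
   conjugate produces only the frequencies [- (m + k)] with [0 < m + k < n], which sum to zero. *)
pose K := (maxn K0 k.+1); pose n := (K + k)%N.
have kK : (k < K)%N by rewrite leq_maxr.
have Kn : (K <= n)%N by rewrite leq_addr.
have kn : (k < n)%N by apply: leq_trans kK Kn.
have n0 : (0 < n)%N by apply: leq_trans kn.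
have [w pw] := prim_root_ex n0.
have w1 := nm_prim_root pw.
have [z hz [nz J]] := discrete_jensen n0 pw r0 e2 N0.
pose zj (j : 'I_n) := w ^+ j * z.
have nzj j : nm (zj j) = r by rewrite nmM nmX w1 expr1n mul1r.
pose er := eps / 4.
pose S x := \sum_(m < K) tc dlt m * x ^+ m.
have rem j : nm (dlt (zj j) - S (zj j)) <= er.
  have := @taylor_rem_hp R dlt (4 * r) M' K (zj j) r4 ed M'0.
  rewrite nzj => /(_ _ _)H; apply: le_trans (H _ _) _.
  - by move=> x /HM'; rewrite add0r.
  - lra.
  have := hK0 K (leq_maxl _ _); rewrite ltr_pdivlMr; last lra.
  by rewrite /er; have := hp_gt0 R K; nra.
pose h j := complex.Re (dlt (zj j)).
have gen (a : nat -> C) (x : C) s I :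
   \sum_(j < n) (\sum_(m < K) a m * (x * w ^+ (j * s)) ^+ m) * w ^+ (j * I) =
   \sum_(m < K) a m * x ^+ m * \sum_(j < n) w ^+ (j * (s * m + I)).
  under eq_bigr do rewrite mulr_suml.
  rewrite exchange_big /=; apply: eq_bigr => m _; rewrite mulr_sumr; apply: eq_bigr => j _.
  by rewrite exprMn -exprM mulnDr exprD mulnA; ring.
have zjE j : zj j = z * w ^+ (j * 1) by rewrite muln1 mulrC.
have K1 : (0 < K)%N by apply: leq_trans kK.
have S0 : \sum_(j < n) S (zj j) = n%:R * dlt 0.
  transitivity (\sum_(j < n) (\sum_(m < K) tc dlt m * (z * w ^+ (j * 1)) ^+ m) * w ^+ (j * 0)).
    by apply: eq_bigr => j _; rewrite muln0 mulr1 -zjE.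
  rewrite gen (bigD1 (Ordinal K1)) //= [X in _ + X]big1 ?addr0.
    by rewrite mulr1 mulrC; under eq_bigr do rewrite mul1n addn0 muln0 expr0; rewrite sumr_const card_ord.
  move=> m m0; rewrite (prim_root_sum pw) ?mulr0// mul1n addn0.
  have m0' : (0 < m)%N by rewrite lt0n; apply: contra m0 => /eqP m00; apply/eqP/val_inj.
  by rewrite gtnNdvd//; exact: leq_trans (ltn_ord m) Kn.
have Sk : \sum_(j < n) S (zj j) * w ^+ (j * (n - k)) = n%:R * (tc dlt k * z ^+ k).
  transitivity (\sum_(j < n) (\sum_(m < K) tc dlt m * (z * w ^+ (j * 1)) ^+ m) * w ^+ (j * (n - k))).
    by apply: eq_bigr => j _; rewrite -zjE.
  rewrite gen (bigD1 (Ordinal kK)) //= [X in _ + X]big1 ?addr0.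
    rewrite mul1n subnKC 1?ltnW//; under eq_bigr do rewrite mulnC exprM (prim_expr_order pw) expr1n.
    by rewrite sumr_const card_ord mulrC.
  move=> m mk; rewrite (prim_root_sum pw) ?mulr0// mul1n.
  have mk' : m != k :> nat by apply: contra mk => /eqP mk0; apply/eqP/val_inj.
  have mn : (m < n)%N by exact: leq_trans (ltn_ord m) Kn.
  apply/negP => /dvdnP[q Eq].
  have : (m + (n - k) = k + (n - k) %[mod n])%N by rewrite subnKC 1?ltnW// Eq modnMl modnn.
  by move/eqP; rewrite eqn_modDr !modn_small// (negbTE mk').
have Sc : \sum_(j < n) (S (zj j))^*%C * w ^+ (j * (n - k)) = 0.
  have wc : (w^*)%C = w ^+ (n - 1).
    apply: (mulfI (x := w)); first by rewrite -nm_gt0 w1.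
    rewrite -exprS subn1 prednK// (prim_expr_order pw).
    by rewrite -sqr_normc nmE w1 expr1n.
  transitivity (\sum_(j < n) (\sum_(m < K) (tc dlt m)^*%C * (z^*%C * w ^+ (j * (n - 1))) ^+ m) * w ^+ (j * (n - k))).
    apply: eq_bigr => j _; rewrite /S rmorph_sum; congr (_ * _); apply: eq_bigr => m _.
    by rewrite /= rmorphM rmorphXn /= zjE muln1 rmorphM rmorphXn /= wc -exprM mulnC.
  rewrite (gen (fun m => (tc dlt m)^*%C) (z^*%C) (n - 1)%N (n - k)%N) big1// => m _.
  rewrite (prim_root_sum pw) ?mulr0//.
  apply/negP => hdv.
  have : (n %| ((n - 1) * m + (n - k)) + (m + k))%N.
    have -> : ((n - 1) * m + (n - k) + (m + k) = n * m.+1)%N.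
      move: (ltnW kn) n0; clear; case: n => // n' kn _.
      by rewrite subn1 /= mulSn mulnS; move: (n' * m)%N kn => x; lia.
    exact: dvdn_mulr.
  rewrite dvdn_addr// gtnNdvd//; first by rewrite addn_gt0 k0 orbT.
  by rewrite /n ltn_add2r.
have conjB (x y : C) : nm (x^*%C - y^*%C) = nm (x - y) by rewrite -rmorphB nm_conj.
have w1j j i : nm (w ^+ (j * i)) = 1 by rewrite nmX w1 expr1n.
have ne : n%:R * er = \sum_(j < n) er by rewrite sumr_const card_ord mulr_natl.
have T1 : nm (\sum_(j < n) dlt (zj j) * w ^+ (j * (n - k)) - n%:R * (tc dlt k * z ^+ k)) <= n%:R * er.
  rewrite -Sk -sumrB ne; apply: le_trans (nm_sum _ _ _) _; apply: ler_sum => j _.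
  by rewrite -mulrBl nmM w1j mulr1.
have T2 : nm (\sum_(j < n) (dlt (zj j))^*%C * w ^+ (j * (n - k))) <= n%:R * er.
  rewrite -[X in nm X]subr0 -[X in nm (_ - X)]Sc -sumrB ne; apply: le_trans (nm_sum _ _ _) _; apply: ler_sum => j _.
  by rewrite -mulrBl nmM w1j mulr1 conjB.
(* Adding the conjugate sum, which is nearly zero, replaces [dlt] by twice its real part. *)
have T3 : nm (\sum_(j < n) dlt (zj j) * w ^+ (j * (n - k)) + \sum_(j < n) (dlt (zj j))^*%C * w ^+ (j * (n - k)))
    <= 2 * \sum_(j < n) `|h j|.
  rewrite -big_split mulr_sumr; apply: le_trans (nm_sum _ _ _) _; apply: ler_sum => j _ /=.
  by rewrite -mulrDl nmM w1j mulr1 addcJ nmM nm_rc nm_natr.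
have Re_sum (G : 'I_n -> C) : complex.Re (\sum_(j < n) G j) = \sum_(j < n) complex.Re (G j).
  by elim/big_rec2: _ => [//|j x y _ <-]; rewrite cReD.
have T4 : n%:R * complex.Re (dlt 0) - n%:R * er <= \sum_(j < n) h j.
  have : nm (\sum_(j < n) dlt (zj j) - n%:R * dlt 0) <= n%:R * er.
    rewrite -S0 -sumrB ne; apply: le_trans (nm_sum _ _ _) _; exact: ler_sum.
  move=> /(le_trans (nm_Re _)); rewrite cReB Re_sum -(rmorph_nat (real_complex R)) cReM /= mul0r subr0.
  by rewrite ler_norml; lra.
have M0 : 0 < M.
  have j0 := Ordinal n0; apply: lt_le_trans (HM (zj j0) (nzj j0)).2.
  by rewrite nm_gt0; exact: nz.
(* The absolute value is twice the positive part minus [h j], and [|N1| <= M] bounds the positive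
   part by [ln M - ln |N2|]. *)
have hw j : `|h j| <= 2 * (ln M - ln (nm (N2 (zj j)))) - h j.
  have [a b] := HM (zj j) (nzj j); have N20 : 0 < nm (N2 (zj j)) by rewrite nm_gt0; exact: nz.
  have w0 : 0 <= ln M - ln (nm (N2 (zj j))) by rewrite subr_ge0 ler_ln ?posrE.
  have h1 : h j <= ln M - ln (nm (N2 (zj j))).
    move: a; rewrite E nmM nm_expC -ler_ln ?posrE ?mulr_gt0 ?expR_gt0// lnM ?posrE ?expR_gt0// expRK.
    by rewrite /h; lra.
  by rewrite ler_norml; apply/andP; split; lra.
have T5 : \sum_(j < n) `|h j| <= 2 * (n%:R * ln M - n%:R * ln (nm (N2 0) / 2)) - \sum_(j < n) h j.
  apply: le_trans (ler_sum _ (fun j _ => hw j)) _.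
  rewrite sumrB lerD2r -mulr_sumr ler_pM2l// sumrB sumr_const card_ord mulr_natl.
  by rewrite lerD2l lerN2.
have T6 : n%:R * (nm (tc dlt k) * r ^+ k) <= 2 * \sum_(j < n) `|h j| + 2 * (n%:R * er).
  rewrite -hz -nmX -nmM -nm_natr -nmM nm_natr.
  move: T1 T2 T3; set X := \sum_(j < n) _; set Y := \sum_(j < n) (_ * _); set Z := n%:R * _ => T1 T2 T3.
  have -> : Z = (X + Y) - (X - Z) - Y by ring.
  apply: le_trans (nmB _ _) _; apply: le_trans (lerD (nmB _ _) (lexx _)) _; lra.
have n0' : 0 < n%:R :> R by rewrite ltr0n.
rewrite -(ler_pM2l n0'); move: T4 T5 T6; rewrite /er; lra.
Qed.

End Jensen.

(** * Entire functions of several variables *)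

Section AbstractDiff.
Variables (K : numFieldType) (V W : normedModType K).

Lemma diff_of_eps (f : V -> W) (L : {linear V -> W}) z : continuous L ->
  (forall eps, 0 < eps -> exists2 dl, 0 < dl & forall h, `|h| < dl ->
     `|f (z + h) - f z - L h| <= eps * `|h|) ->
  differentiable f z /\ 'd f z = L :> (V -> W).
Proof.
move=> cL H.
have E : f \o shift z = cst (f z) + L +o_ 0 id.
  apply/eqaddoP => eps e0; have [dl dl0 hd] := H eps e0.
  apply/nbhs_ballP; exists dl => //= h; rewrite -ball_normE /= sub0r normrN => /hd.
  have -> : (f \o +%R^~ z - (cst (f z) + L)) h = f (h + z) - (f z + L h) by [].
  by rewrite [h + z]addrC opprD addrA.
have D := diff_unique cL E; split=> //.
by apply/diff_locallyP; rewrite D.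
Qed.

Lemma eps_of_diff (f : V -> W) z : differentiable f z ->
  forall eps, 0 < eps -> exists2 dl, 0 < dl & forall h, `|h| < dl ->
     `|f (z + h) - f z - 'd f z h| <= eps * `|h|.
Proof.
move=> /diff_locally/eqaddoP H eps e0.
have /nbhs_ballP[dl /= dl0 hd] := H eps e0; exists dl => // h hh.
have := hd h; rewrite -ball_normE /= sub0r normrN => /(_ hh).
have -> : (f \o +%R^~ z - (cst (f z) + 'd f z)) h = f (h + z) - (f z + 'd f z h) by [].
by rewrite [h + z]addrC opprD addrA.
Qed.

End AbstractDiff.

Section Frechet.
Variables (R : realType) (n : nat).
Local Notation C := R[i].
Local Notation E := 'rV[C]_n.
Implicit Types (f g : E -> C) (z h : E) (d : 'I_n -> C).

(** The sum norm with values in [R]; the norm of ['rV[C]_n] is the maximum norm and takes its values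
    in [C]. *)
Definition nv z : R := \sum_j nm (z 0 j).

Lemma nv_ge0 z : 0 <= nv z.
Proof. by apply: sumr_ge0 => j _; exact: nm_ge0. Qed.
Lemma nv0 : nv 0 = 0.
Proof. by rewrite /nv big1// => j _; rewrite mxE nm0. Qed.
Lemma nvD z h : nv (z + h) <= nv z + nv h.
Proof. by rewrite /nv -big_split; apply: ler_sum => j _; rewrite mxE nmD. Qed.
Lemma nvZ (a : C) z : nv (a *: z) = nm a * nv z.
Proof. by rewrite /nv mulr_sumr; apply: eq_bigr => j _; rewrite mxE nmM. Qed.
Lemma nv_coord z j : nm (z 0 j) <= nv z.
Proof.
rewrite /nv (bigD1 j)//= lerDl; apply: sumr_ge0 => k _; exact: nm_ge0.
Qed.
Lemma nv_eq0 z : nv z = 0 -> z = 0.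
Proof.
move=> z0; apply/rowP => j; rewrite mxE; apply/eqP; rewrite -nm_eq0 eq_le nm_ge0 andbT.
by rewrite -z0 nv_coord.
Qed.
Lemma nv_gt0 z : (0 < nv z) = (z != 0).
Proof.
apply/idP/idP => [|z0]; first by apply: contraTneq => ->; rewrite nv0 ltxx.
by rewrite lt_def nv_ge0 andbT; apply: contra_neq z0 => /nv_eq0.
Qed.

Definition hasD f z d := forall e, 0 < e -> exists2 dl, 0 < dl & forall h, nv h < dl ->
  nm (f (z + h) - f z - \sum_j h 0 j * d j) <= e * nv h.

Lemma mx_norm_nv h : `|h| <= rc (nv h).
Proof.
rewrite -[`|h|]/(mx_norm h) mx_normE.
elim/big_ind: _ => [|x y hx hy|[i j] _] /=.
- by rewrite ler0c nv_ge0.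
- by rewrite /Num.max; case: ifP.
- by rewrite nmE lecR (ord1 i) nv_coord.
Qed.

Lemma nv_mx_norm h : rc (nv h) <= n%:R * `|h|.
Proof.
rewrite rmorph_sum /= mulr_natl -[X in _ *+ X]card_ord -sumr_const.
apply: ler_sum => j _; rewrite -nmE -[`|h|]/(mx_norm h) mx_normE.
apply: (le_trans (y := (widen_itv `|h (0, j).1 (0, j).2|%:itv : {nonneg C})%:num)) => //.
rewrite num_le; exact: (le_bigmax _ (fun i : 'I_1 * 'I_n => widen_itv `|h i.1 i.2|%:itv : {nonneg C}) (0, j)).
Qed.

Lemma cpos_rc (x : C) : 0 < x -> x = rc (complex.Re x) /\ 0 < complex.Re x.
Proof. by rewrite ltcE /= => /andP[/eqP e r]; split=> //; apply: ceq. Qed.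

Definition lform d h : C := \sum_j h 0 j * d j.
Lemma lform_lin d : linear (lform d : E -> C^o).
Proof.
move=> a x y; rewrite /lform scaler_sumr -big_split; apply: eq_bigr => j _ /=.
by rewrite !mxE mulrDl -mulrA.
Qed.
HB.instance Definition _ d := GRing.isLinear.Build C E C^o _ (lform d) (lform_lin d).

Lemma lform_delta d j : lform d (delta_mx 0 j) = d j.
Proof.
rewrite /lform (bigD1 j)//= mxE !eqxx mul1r big1 ?addr0// => k kj.
by rewrite mxE eqxx (negbTE kj) mul0r.
Qed.

Lemma lform_cont d : continuous (lform d : E -> C).
Proof.
suff H (s : seq 'I_n) : continuous (fun h : E => \sum_(j <- s) h 0 j * d j : C) by exact: H.
elim: s => [|j s IH] h.
  rewrite (_ : (fun h : E => _) = cst 0); first exact: cst_continuous.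
  by apply/funext => x; rewrite big_nil.
rewrite (_ : (fun h : E => _) = (fun h : E => h 0 j * d j : C) + (fun h => \sum_(j <- s) h 0 j * d j)); last first.
  by apply/funext => x; rewrite big_cons.
apply: continuousD; last exact: IH.
by apply: continuousM; [exact: coord_continuous|exact: cst_continuous].
Qed.

Lemma norm_rc h : exists2 q : R, 0 <= q & `|h| = rc q.
Proof.
exists (complex.Re `|h|); have : 0 <= `|h| by [].
  by rewrite lecE /= => /andP[].
by rewrite lecE /= => /andP[/eqP ei er]; apply: ceq.
Qed.

Lemma hasD_diff f z d : hasD f z d ->
  differentiable f z /\ 'd f z = lform d :> (E -> C).
Proof.
move=> H; apply: diff_of_eps; first exact: lform_cont.
move=> eps /cpos_rc[-> e0].
have n1 : 0 < n%:R + 1 :> R by rewrite ltr_wpDl.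
have e'0 : 0 < complex.Re eps / (n%:R + 1) by rewrite divr_gt0.
have [dl dl0 hd] := H _ e'0.
exists (rc (dl / (n%:R + 1))); first by rewrite (ltcR 0) divr_gt0.
move=> h hh; have nh := nv_mx_norm h.
have [q q0 qE] := norm_rc h.
rewrite qE ltcR ltr_pdivlMr// in hh.
rewrite qE -(rmorph_nat (real_complex R)) -rmorphM lecR in nh.
have k : nv h < dl by lra.
have := hd h k => K; rewrite qE nmE -rmorphM lecR; apply: le_trans K _.
rewrite -mulrA ler_pM2l// ler_pdivrMl//; lra.
Qed.

Lemma diff_hasD f z : differentiable f z -> hasD f z (fun j => pderiv j f z).
Proof.
move=> df e e0; have e0' : (0 : C) < rc e by rewrite (ltcR 0).
have [dl /cpos_rc[dlE dl0] hd] := eps_of_diff df e0'.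
exists (complex.Re dl) => // h hh.
have mh := mx_norm_nv h; have [q q0 qE] := norm_rc h.
have hq : q <= nv h by move: mh; rewrite qE lecR.
have := hd h; rewrite dlE qE ltcR => /(_ (le_lt_trans hq hh)).
rewrite nmE -rmorphM lecR.
have -> : 'd f z h = \sum_j h 0 j * pderiv j f z.
  rewrite {1}(row_sum_delta h) linear_sum; apply: eq_bigr => j _.
  by rewrite linearZ /pderiv deriveE.
by move=> K; apply: le_trans K _; rewrite ler_wpM2l// ltW.
Qed.

Lemma hasD_pderiv f z d j : hasD f z d -> pderiv j f z = d j.
Proof. by move=> /hasD_diff[df E]; rewrite /pderiv deriveE// E lform_delta. Qed.

Lemma entireP f : entire f <-> forall z, exists d, hasD f z d.
Proof.
split=> H z; first by exists (fun j => pderiv j f z); exact: diff_hasD.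
by have [d /hasD_diff[]] := H z.
Qed.

End Frechet.

Lemma eps_continuous (R : realType) (T : pseudoMetricType R) (f : T -> R) :
  (forall x e, 0 < e -> exists2 d, 0 < d & forall y, ball x d y -> `|f x - f y| <= e) ->
  continuous f.
Proof.
move=> H x; apply/cvgrPdist_le => e e0; have [d d0 hd] := H x e e0.
by apply/nbhs_ballP; exists d.
Qed.

(** * Rules of differentiation and local bounds in several variables *)

Section FrechetCalculus.
Variables (R : realType) (n : nat).
Local Notation C := R[i].
Local Notation E := 'rV[C]_n.
Implicit Types (f g : E -> C) (z h v : E) (d : 'I_n -> C).

Definition dnorm d : R := \sum_j nm (d j).

Lemma dnorm_ge0 d : 0 <= dnorm d.
Proof. by apply: sumr_ge0 => j _; exact: nm_ge0. Qed.

Lemma lform_le d h : nm (lform d h) <= dnorm d * nv h.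
Proof.
rewrite /lform /dnorm mulr_suml; apply: le_trans (nm_sum _ _ _) _; apply: ler_sum => j _.
by rewrite nmM mulrC ler_wpM2l ?nm_ge0// nv_coord.
Qed.

Lemma hasD_cont1 f z d : hasD f z d -> forall e, 0 < e -> exists2 dl, 0 < dl &
  forall h, nv h < dl -> nm (f (z + h) - f z) <= e.
Proof.
move=> H e e0; have [dl dl0 hd] := H 1 ltr01.
have K0 : 0 < dnorm d + 1 by have := dnorm_ge0 d; lra.
exists (Num.min dl (e / (dnorm d + 1))); first by rewrite lt_min dl0 divr_gt0.
move=> h; rewrite lt_min => /andP[h1 h2].
have := hd h h1; rewrite mul1r -/(lform d h) => p.
have := nmD (f (z + h) - f z - lform d h) (lform d h); rewrite subrK => q.
by have := lform_le d h; move: h2; rewrite ltr_pdivlMr//; lra.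
Qed.

Lemma lformD d d' h : lform (fun j => d j + d' j) h = lform d h + lform d' h.
Proof. by rewrite /lform -big_split; apply: eq_bigr => j _; rewrite mulrDr. Qed.
Lemma lformZ a d h : lform (fun j => a * d j) h = a * lform d h.
Proof. by rewrite /lform mulr_sumr; apply: eq_bigr => j _; rewrite mulrCA. Qed.
Lemma lformZr a d h : lform d (a *: h) = a * lform d h.
Proof. by rewrite /lform mulr_sumr; apply: eq_bigr => j _; rewrite mxE mulrA. Qed.

Lemma hasD_cst c z : hasD (fun=> c) z (fun=> 0).
Proof.
move=> e e0; exists 1 => // h _; rewrite subrr big1; last by move=> j _; rewrite mulr0.
by rewrite subrr nm0 mulr_ge0 ?nv_ge0 ?(ltW e0).
Qed.

Lemma hasD_coord j z : hasD (fun z => z 0 j) z (fun k => (k == j)%:R).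
Proof.
move=> e e0; exists 1 => // h _; rewrite (bigD1 j)//= eqxx mulr1 big1 ?addr0.
  by rewrite mxE (addrC (z 0 j)) addrK subrr nm0 mulr_ge0 ?nv_ge0 ?(ltW e0).
by move=> k kj; rewrite (negbTE kj) mulr0.
Qed.

Lemma hasD_add f g z a b : hasD f z a -> hasD g z b ->
  hasD (fun x => f x + g x) z (fun j => a j + b j).
Proof.
move=> hf hg e e0; have e2 : 0 < e / 2 by lra.
have [x x0 hx] := hf _ e2; have [y y0 hy] := hg _ e2.
exists (Num.min x y); first by rewrite lt_min x0.
move=> h; rewrite lt_min => /andP[h1 h2]; rewrite -/(lform _ h) lformD.
have -> : f (z + h) + g (z + h) - (f z + g z) - (lform a h + lform b h) =
  (f (z + h) - f z - lform a h) + (g (z + h) - g z - lform b h) by ring.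
by apply: le_trans (nmD _ _) _; have := hx h h1; have := hy h h2; rewrite -!/(lform _ h); lra.
Qed.

Lemma hasD_comp f (phi : C -> C) z a b : hasD f z a -> cdiff phi (f z) b ->
  hasD (fun x => phi (f x)) z (fun j => b * a j).
Proof.
move=> hg hf e e0; have ae := dnorm_ge0 a; have be := nm_ge0 b.
pose K := dnorm a + nm b + 2.
have K0 : 0 < K by rewrite /K; lra.
pose e' := Num.min 1 (e / K).
have e'0 : 0 < e' by rewrite lt_min ltr01 divr_gt0.
have eK : e' * K <= e by rewrite -ler_pdivlMr// ge_min lexx orbT.
have e'1 : e' <= 1 by rewrite ge_min lexx.
have [x x0 hx] := hf _ e'0; have [y y0 hy] := hg _ e'0.
have x2 : 0 < x / 2 by lra.
have [w w0 hw] := hasD_cont1 hg x2.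
exists (Num.min y w); first by rewrite !lt_min y0.
move=> h; rewrite !lt_min => /andP[h1 h2]; rewrite -/(lform _ h) lformZ.
have r := hw h h2; have q := hy h h1; rewrite -/(lform _ h) in q.
have hh := nv_ge0 h.
pose k := f (z + h) - f z.
have kx : nm k < x by rewrite /k; lra.
have p := hx k kx; rewrite {1}/k [f z + _]addrC subrK in p.
have -> : phi (f (z + h)) - phi (f z) - b * lform a h =
  (phi (f (z + h)) - phi (f z) - k * b) + (k - lform a h) * b by ring.
apply: le_trans (nmD _ _) _; rewrite nmM.
have kb : nm k <= (dnorm a + 1) * nv h.
  have := nmD (k - lform a h) (lform a h); rewrite subrK => s.
  by have := lform_le a h; rewrite -/k in q; nra.
have b1 : nm (phi (f (z + h)) - phi (f z) - k * b) <= e' * ((dnorm a + 1) * nv h).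
  by apply: le_trans p _; rewrite ler_wpM2l// ltW.
have b2 : nm (k - lform a h) * nm b <= e' * nv h * nm b by rewrite ler_wpM2r.
apply: le_trans (lerD b1 b2) _.
have -> : e' * ((dnorm a + 1) * nv h) + e' * nv h * nm b = (e' * (K - 1)) * nv h by rewrite /K; ring.
rewrite ler_wpM2r//; nra.
Qed.

Lemma hasD_scale c f z a : hasD f z a -> hasD (fun x => c * f x) z (fun j => c * a j).
Proof.
move=> hf; apply: (hasD_comp (phi := fun x => c * x) hf).
by rewrite -[X in cdiff _ _ X]mulr1; apply: cdiffZ; exact: cdiff_id.
Qed.

(** Polarisation: [4 f g = (f + g)^2 - (f - g)^2], and the chain rule [hasD_comp] covers squares. *)
Lemma hasD_mul f g z a b : hasD f z a -> hasD g z b ->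
  hasD (fun x => f x * g x) z (fun j => a j * g z + f z * b j).
Proof.
have sq u c : hasD u z c -> hasD (fun x => u x ^+ 2) z (fun j => 2 * u z * c j).
  move=> hu; apply: (hasD_comp (phi := fun x => x ^+ 2) hu).
  by have := cdiff_exp 2 (cdiff_id (u z)); rewrite mulr1 expr1.
move=> hf hg.
have hg' := hasD_scale (- 1) hg.
have S := hasD_add (sq _ _ (hasD_add hf hg)) (hasD_scale (- 1) (sq _ _ (hasD_add hf hg'))).
have := hasD_scale 4^-1 S.
rewrite (_ : (fun x => 4^-1 * _) = fun x => f x * g x); last by apply/funext => x; field.
by rewrite (_ : (fun j => 4^-1 * _) = fun j => a j * g z + f z * b j)//; apply/funext => j; field.
Qed.

Lemma hasD_shift f z a c : hasD f (z + c) a -> hasD (fun x => f (x + c)) z a.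
Proof.
move=> H e e0; have [dl dl0 hd] := H e e0; exists dl => // h /hd.
by have -> : z + h + c = z + c + h by rewrite addrAC.
Qed.

Lemma hasD_line f z v (w : C) d : hasD f (z + w *: v) d ->
  cdiff (fun w => f (z + w *: v)) w (lform d v).
Proof.
move=> H e e0; have v1 : 0 < nv v + 1 by have := nv_ge0 v; lra.
have [dl dl0 hd] := H _ (divr_gt0 e0 v1); exists (dl / (nv v + 1)); first by rewrite divr_gt0.
move=> k; rewrite ltr_pdivlMr// => hk.
have hn : nv (k *: v) < dl.
  by rewrite nvZ; apply: le_lt_trans hk; rewrite ler_wpM2l ?nm_ge0//; lra.
have := hd _ hn; rewrite -/(lform d _) lformZr scalerDl addrA => p.
apply: le_trans p _; rewrite nvZ.
have -> : e / (nv v + 1) * (nm k * nv v) = (e * nm k) * (nv v / (nv v + 1)) by field; lra.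
rewrite ler_piMr ?mulr_ge0 ?nm_ge0 ?(ltW e0)// ler_pdivrMr//; lra.
Qed.

Lemma entD f z : entire f -> hasD f z (fun j => pderiv j f z).
Proof. by move=> ef; exact: diff_hasD. Qed.

Lemma ent_of (f : E -> C) (d : E -> 'I_n -> C) : (forall z, hasD f z (d z)) -> entire f.
Proof. by move=> H; apply/entireP => z; exists (d z). Qed.

Lemma ent_cst (c : C) : entire (fun _ : E => c).
Proof. by apply: ent_of => z; exact: hasD_cst. Qed.
Lemma ent_coord j : entire (fun z : E => z 0 j).
Proof. by apply: ent_of => z; exact: hasD_coord. Qed.
Lemma ent_add f g : entire f -> entire g -> entire (fun z => f z + g z).
Proof. by move=> ef eg; apply: ent_of => z; apply: hasD_add; exact: entD. Qed.
Lemma ent_mul f g : entire f -> entire g -> entire (fun z => f z * g z).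
Proof. by move=> ef eg; apply: ent_of => z; apply: hasD_mul; exact: entD. Qed.
Lemma ent_scale c f : entire f -> entire (fun z => c * f z).
Proof. by move=> ef; apply: ent_of => z; apply: hasD_scale; exact: entD. Qed.
Lemma ent_opp f : entire f -> entire (fun z => - f z).
Proof.
move=> /(ent_scale (- 1)); congr entire; by apply/funext => z; rewrite mulN1r.
Qed.
Lemma ent_sub f g : entire f -> entire g -> entire (fun z => f z - g z).
Proof. by move=> ef /ent_opp; exact: ent_add. Qed.
Lemma ent_comp f (phi : C -> C) : entire f -> ent1 phi -> entire (fun z => phi (f z)).
Proof.
move=> ef ephi; apply: ent_of => z; apply: hasD_comp (entD z ef) _.
exact: cderP.
Qed.
Lemma ent_exp f : entire f -> entire (fun z => expC (f z)).
Proof. by move=> ef; apply: ent_comp => //; exact: ent1_expC. Qed.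
Lemma ent_shift f c : entire f -> entire (fun z => f (z + c)).
Proof. by move=> ef; apply: ent_of => z; apply: hasD_shift; exact: entD. Qed.
Lemma ent_inv f : entire f -> (forall z, f z != 0) -> entire (fun z => (f z)^-1).
Proof.
move=> ef f0; apply: ent_of => z; apply: (hasD_comp (phi := fun x => x^-1) (entD z ef)).
exact: cdiff_inv.
Qed.
Lemma ent_sum (I : Type) (s : seq I) (F : I -> E -> C) : (forall i, entire (F i)) ->
  entire (fun z => \sum_(i <- s) F i z).
Proof.
move=> eF; elim: s => [|i s IH].
  by rewrite (_ : (fun z => _) = fun=> 0); [exact: ent_cst|apply/funext => z; rewrite big_nil].
rewrite (_ : (fun z => _) = fun z => F i z + \sum_(i <- s) F i z); first exact: ent_add.
by apply/funext => z; rewrite big_cons.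
Qed.

Lemma pd_add j f g z : entire f -> entire g ->
  pderiv j (fun z => f z + g z) z = pderiv j f z + pderiv j g z.
Proof. by move=> ef eg; rewrite (hasD_pderiv j (hasD_add (entD z ef) (entD z eg))). Qed.
Lemma pd_mul j f g z : entire f -> entire g ->
  pderiv j (fun z => f z * g z) z = pderiv j f z * g z + f z * pderiv j g z.
Proof. by move=> ef eg; rewrite (hasD_pderiv j (hasD_mul (entD z ef) (entD z eg))). Qed.
Lemma pd_scale j c f z : entire f -> pderiv j (fun z => c * f z) z = c * pderiv j f z.
Proof. by move=> ef; rewrite (hasD_pderiv j (hasD_scale c (entD z ef))). Qed.
Lemma pd_cst j (c : C) (z : E) : pderiv j (fun=> c) z = 0.
Proof. by rewrite (hasD_pderiv j (hasD_cst c z)). Qed.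
Lemma pd_coord j k (z : E) : pderiv j (fun z => z 0 k) z = (j == k)%:R.
Proof. by rewrite (hasD_pderiv j (hasD_coord k z)). Qed.
Lemma pd_exp j f z : entire f -> pderiv j (fun z => expC (f z)) z = expC (f z) * pderiv j f z.
Proof. by move=> ef; rewrite (hasD_pderiv j (hasD_comp (entD z ef) (cdiff_expC _))). Qed.
Lemma pd_shift j f c z : entire f -> pderiv j (fun z => f (z + c)) z = pderiv j f (z + c).
Proof. by move=> ef; rewrite (hasD_pderiv j (hasD_shift (entD (z + c) ef))). Qed.

Definition dird f v z : C := lform (fun j => pderiv j f z) v.

Lemma line_cdiff f z v w : entire f -> cdiff (fun w => f (z + w *: v)) w (dird f v (z + w *: v)).
Proof. by move=> ef; apply: hasD_line; exact: entD. Qed.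
Lemma ent1_line f z v : entire f -> ent1 (fun w => f (z + w *: v)).
Proof. by move=> ef w; exists (dird f v (z + w *: v)); exact: line_cdiff. Qed.

(** Compactness is taken from real boxes: [io] carries a box of real dimension [2 n] onto a set that
    contains the ball, and [|f|] is continuous on the box. *)
Lemma ent_bounded f r : entire f -> exists2 M, 0 <= M & forall z, nv z <= r -> nm (f z) <= M.
Proof.
move=> ef; pose io (x : 'rV[R]_(n + n)) : E := \row_j (x 0 (lshift n j) +i* x 0 (rshift n j))%C.
pose A : set 'rV[R]_(n + n) := [set x | forall i, `[- `|r|, `|r|]%classic (x ord0 i)]%classic.
have cA : compact A.
  exact: (@rV_compact R (n + n) (fun=> `[- `|r|, `|r|]%classic) (fun=> @segment_compact _ _ _)).
have A0 : (A !=set0)%classic.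
  exists 0 => i; rewrite mxE /= in_itv /=; have := normr_ge0 r; lra.
have cont : continuous (fun x : 'rV[R]_(n + n) => nm (f (io x))).
  apply: eps_continuous => x e e0.
  have [dl dl0 hd] := hasD_cont1 (entD (io x) ef) e0.
  have m1 : 0 < (n + n)%:R + 1 :> R by rewrite ltr_wpDl.
  exists (dl / ((n + n)%:R + 1)); first by rewrite divr_gt0.
  move=> y [_ xy].
  have xyj j : `|x 0 j - y 0 j| < dl / ((n + n)%:R + 1) by exact: xy.
  have nio : nv (io y - io x) < dl.
    apply: (@le_lt_trans _ _ (\sum_(j < n) 2 * (dl / ((n + n)%:R + 1)))).
      apply: ler_sum => j _; apply: le_trans (nm_le _) _.
      rewrite !mxE cReB cImB /= [`|_ - _|]distrC [X in _ + X]distrC.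
      by have := xyj (lshift n j); have := xyj (rshift n j); lra.
    rewrite sumr_const card_ord -[_ *+ n]mulr_natl.
    have -> : n%:R * (2 * (dl / ((n + n)%:R + 1))) = dl * ((n + n)%:R / ((n + n)%:R + 1)).
      by rewrite natrD in m1 *; field; lra.
    rewrite gtr_pMr// ltr_pdivrMr//; lra.
  have := hd _ nio; rewrite [io x + _]addrC subrK.
  have := nmD (f (io y) - f (io x)) (f (io x)); have := nmD (f (io x) - f (io y)) (f (io y)).
  by rewrite !subrK (nmBC (f (io x))) ler_norml => *; apply/andP; split; lra.
have [c _ hc] := compact_EVT_max A0 cA (continuous_subspaceT (A := A) cont).
exists (nm (f (io c))); first exact: nm_ge0.
move=> z zr; pose x : 'rV[R]_(n + n) := row_mx (\row_j complex.Re (z 0 j)) (\row_j complex.Im (z 0 j)).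
have -> : z = io x.
  apply/rowP => j; rewrite mxE row_mxEl row_mxEr !mxE; by case: (z 0 j).
apply: hc; rewrite inE => i; rewrite /= in_itv /= -ler_norml.
have rr : r <= `|r| := ler_norm r.
rewrite /x -(splitK i); case: (fintype.split i) => j /=; rewrite ?row_mxEl ?row_mxEr mxE.
  by apply: le_trans (nm_Re _) _; apply: le_trans (nv_coord _ _) _; lra.
by apply: le_trans (nm_Im _) _; apply: le_trans (nv_coord _ _) _; lra.
Qed.

Lemma dird_le f v z r M : 0 < r -> entire f ->
  (forall w, nm w = r -> nm (f (z + w *: v)) <= M) -> nm (dird f v z) <= 2 * M / r.
Proof.
move=> r0 ef H; have c0 := line_cdiff z v 0 ef; rewrite scale0r addr0 in c0.
rewrite -(cderE c0); apply: cauchy_cder => //; first exact: ent1_line.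
by move=> w hw; rewrite add0r; exact: H.
Qed.

Lemma dird_delta f j z : dird f (delta_mx 0 j) z = pderiv j f z.
Proof. exact: lform_delta. Qed.

Lemma nv_delta j : nv (delta_mx 0 j : E) = 1.
Proof.
rewrite /nv (bigD1 j)//= mxE !eqxx nm1 big1 ?addr0// => k kj.
by rewrite mxE eqxx (negbTE kj) nm0.
Qed.

Lemma pd_le f j z r M : 0 < r -> entire f ->
  (forall x, nv (x - z) <= r -> nm (f x) <= M) -> nm (pderiv j f z) <= 2 * M / r.
Proof.
move=> r0 ef H; rewrite -dird_delta; apply: dird_le => // w hw; apply: H.
by rewrite addrC addKr nvZ nv_delta mulr1 hw.
Qed.

(** On the line through [z] and [z + h] the unit ball has radius [1 / nv h], and [taylor_rem] with
    [K = 2] gives the factor [2 * 3 * M]. As only the supremum of [f] enters, the estimate passes to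
    limits. *)
Lemma quad_rem f z h M : entire f -> nv h <= 1 / 2 ->
  (forall x, nv (x - z) <= 1 -> nm (f x) <= M) ->
  nm (f (z + h) - f z - dird f h z) <= 6 * M * nv h ^+ 2.
Proof.
move=> ef hh H; have [->|h0] := eqVneq h 0.
  rewrite addr0 subrr nv0 expr0n mulr0 /dird /lform big1 ?subr0 ?nm0//.
  by move=> j _; rewrite mxE mul0r.
have n0 : 0 < nv h by rewrite nv_gt0.
have ni : 0 < (nv h)^-1 by rewrite invr_gt0.
have e1 := ent1_line z h ef.
have := @taylor_rem R (fun w => f (z + w *: h)) (nv h)^-1 M 2 1 ni e1.
rewrite 2!big_ord_recl big_ord0 /= addr0 !mulr1 nm1 invrK mul1r.
rewrite tcS !tc0 scale0r addr0 scale1r /dq /dqa eqxx.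
have c0 := line_cdiff z h 0 ef; rewrite (cderE c0) scale0r addr0 opprD addrA => K.
apply: le_trans (K _ _) _.
- by move=> w hw; apply: H; rewrite addrC addKr nvZ hw mulVf// lt0r_neq0.
- have : 2 <= (nv h)^-1 by rewrite -[2]invrK lef_pV2 ?posrE ?invr_gt0//; lra.
  lra.
- by rewrite le_eqVlt; apply/orP; left; apply/eqP; ring.
Qed.

End FrechetCalculus.

(** * Limits of entire functions and polynomial functions *)

Section Entire.
Variables (R : realType) (n : nat).
Local Notation C := R[i].
Local Notation E := 'rV[C]_n.
Implicit Types (f g : E -> C) (z h v : E).

Lemma cauchy_real (a : nat -> R) (K : R -> nat) :
  (forall e, 0 < e -> forall k l, (K e <= k)%N -> (K e <= l)%N -> `|a k - a l| <= e) ->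
  exists s, forall e, 0 < e -> forall k, (K e <= k)%N -> `|a k - s| <= e.
Proof.
move=> H; pose S := [set x | exists N, forall k, (N <= k)%N -> x <= a k]%classic.
have low e : 0 < e -> S (a (K e) - e).
  by move=> e0; exists (K e) => k hk; have := H e e0 k (K e) hk (leqnn _); rewrite ler_norml; lra.
have up e x : 0 < e -> S x -> x <= a (K e) + e.
  move=> e0 [N hN]; have h1 := hN _ (leq_maxl N (K e)).
  by have := H e e0 (maxn N (K e)) (K e) (leq_maxr _ _) (leqnn _); rewrite ler_norml; lra.
have hS : has_sup S.
  by split; [exists (a (K 1) - 1); exact: low|exists (a (K 1) + 1) => x; exact: up].
exists (sup S) => e e0 k hk; apply/ler_addgt0Pr => d d0.
have m0 : 0 < Num.min d 1 by rewrite lt_min d0 ltr01.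
pose k' := maxn (K e) (K (d / 2)).
have d2 : 0 < d / 2 by lra.
have := H e e0 k (maxn k (K (d / 2))) hk (leq_trans hk (leq_maxl _ _)).
have := H (d / 2) d2 (maxn k (K (d / 2))) (K (d / 2)) (leq_maxr _ _) (leqnn _).
have s1 : a (K (d / 2)) - d / 2 <= sup S by apply: ub_le_sup; [exact: hS.2|exact: low].
have s2 : sup S <= a (K (d / 2)) + d / 2 by apply: ge_sup; [exact: hS.1|move=> x; exact: up].
rewrite !ler_norml; lra.
Qed.

Lemma cauchy_complex (a : nat -> C) (K : R -> nat) :
  (forall e, 0 < e -> forall k l, (K e <= k)%N -> (K e <= l)%N -> nm (a k - a l) <= e) ->
  exists s, forall e, 0 < e -> forall k, (K e <= k)%N -> nm (a k - s) <= 2 * e.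
Proof.
move=> H.
have [x hx] : exists s, forall e, 0 < e -> forall k, (K e <= k)%N -> `|complex.Re (a k) - s| <= e.
  by apply: cauchy_real => e e0 k l hk hl; rewrite -cReB; apply: le_trans (nm_Re _) (H _ _ _ _ _ _).
have [y hy] : exists s, forall e, 0 < e -> forall k, (K e <= k)%N -> `|complex.Im (a k) - s| <= e.
  by apply: cauchy_real => e e0 k l hk hl; rewrite -cImB; apply: le_trans (nm_Im _) (H _ _ _ _ _ _).
exists (x +i* y)%C => e e0 k hk; apply: le_trans (nm_le _) _.
by rewrite cReB cImB /=; have := hx e e0 k hk; have := hy e e0 k hk; lra.
Qed.

(** Weierstrass' theorem: by Cauchy estimates the partial derivatives form Cauchy sequences, and the
    remainder bound of [quad_rem] is uniform in [k], so it holds for the limit. *)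
Lemma ent_limit (F : nat -> E -> C) f : (forall k, entire (F k)) ->
  (forall r e, 0 < e -> exists K, forall k, (K <= k)%N -> forall z, nv z <= r ->
     nm (F k z - f z) <= e) -> entire f.
Proof.
move=> eF H; apply/entireP => z; pose r := nv z + 1.
have /choice[K hK] : forall e : R, exists K : nat, 0 < e -> forall k, (K <= k)%N -> forall x, nv x <= r ->
    nm (F k x - f x) <= e.
  move=> e; have [e0|e0] := ltP 0 e; last by exists 0%N.
  by have [N hN] := H r e e0; exists N.
have nb x : nv (x - z) <= 1 -> nv x <= r by move=> hx; have := nvD (x - z) z; rewrite subrK /r; lra.
have [M1 M10 HM1] := ent_bounded r (eF (K 1%R)).
pose M := M1 + 2.
have HM k x : (K 1%R <= k)%N -> nv (x - z) <= 1 -> nm (F k x) <= M.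
  move=> hk /nb hx; have := hK 1 ltr01 k hk x hx; have := hK 1 ltr01 (K 1%R) (leqnn _) x hx.
  have := HM1 x hx; have := nmD (F k x - f x) (- (F (K 1%R) x - f x) + F (K 1) x).
  rewrite (_ : F k x - f x + (- (F (K 1%R) x - f x) + F (K 1) x) = F k x); last by ring.
  by have := nmD (- (F (K 1%R) x - f x)) (F (K 1%R) x); rewrite nmN /M; lra.
have PC j e : 0 < e -> forall k l, (K (e / 4) <= k)%N -> (K (e / 4) <= l)%N ->
   nm (pderiv j (F k) z - pderiv j (F l) z) <= e.
  move=> e0 k l hk hl; have e4 : 0 < e / 4 by lra.
  have eN : entire (fun x => -1 * F l x) by apply: ent_scale; exact: eF.
  have -> : pderiv j (F k) z - pderiv j (F l) z = pderiv j (fun x => F k x + -1 * F l x) z.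
    by rewrite (pd_add _ _ (eF k) eN) (pd_scale _ _ _ (eF l)) mulN1r.
  have -> : e = 2 * (e / 4 + e / 4) / 1 by clear; field.
  apply: pd_le; [exact: ltr01|exact: (ent_add (eF k) eN)|].
  move=> x /nb hx; have := hK _ e4 k hk x hx; have := hK _ e4 l hl x hx => p q.
  rewrite mulN1r (_ : F k x - F l x = (F k x - f x) - (F l x - f x)); last by ring.
  by apply: le_trans (nmB _ _) _; lra.
have /choice[d hd] : forall j, exists s, forall e, 0 < e -> forall k, (K (e / 4) <= k)%N ->
    nm (pderiv j (F k) z - s) <= 2 * e.
  by move=> j; apply: (cauchy_complex (K := fun e => K (e / 4))); exact: PC.
exists d => e e0.
have M0 : 0 <= M by rewrite /M; lra.
exists (Num.min (1 / 2) (e / (6 * M + 1))).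
  by rewrite lt_min !divr_gt0//; lra.
move=> h; rewrite lt_min => /andP[h1]; rewrite ltr_pdivlMr; last by lra.
move=> h2; have hh := nv_ge0 h.
suff Q : nm (f (z + h) - f z - lform d h) <= 6 * M * nv h ^+ 2 by apply: le_trans Q _; nra.
apply/ler_addgt0Pr => q q0; pose q' := q / (2 + 2 * nv h).
have q'0 : 0 < q' by rewrite divr_gt0//; lra.
have q'4 : 0 < q' / 4 by lra.
pose k := maxn (K 1%R) (maxn (K (q' / 4)) (K q')).
have k1 : (K 1%R <= k)%N by rewrite leq_maxl.
have k2 : (K (q' / 4) <= k)%N by rewrite /k leq_max leq_maxl orbT.
have k3 : (K q' <= k)%N by rewrite /k leq_max leq_maxr orbT.
have Qk := @quad_rem R n (F k) z h M (eF k) ltac:(lra) (fun x hx => HM k x k1 hx).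
have zr : nv z <= r by rewrite /r; lra.
have zhr : nv (z + h) <= r by apply: nb; rewrite addrC addKr; lra.
have a1 := hK _ q'4 k k2 z zr; have a2 := hK _ q'4 k k2 (z + h) zhr.
have a3 : nm (dird (F k) h z - lform d h) <= nv h * (2 * q').
  rewrite /dird /lform -sumrB /nv mulr_suml; apply: le_trans (nm_sum _ _ _) _.
  by apply: ler_sum => j _; rewrite -mulrBr nmM ler_wpM2l ?nm_ge0// hd.
have -> : f (z + h) - f z - lform d h = (F k (z + h) - F k z - dird (F k) h z) - (F k (z + h) - f (z + h))
   + (F k z - f z) + (dird (F k) h z - lform d h) by ring.
apply: le_trans (nmD _ _) _; apply: le_trans (lerD (nmD _ _) (lexx _)) _.
apply: le_trans (lerD (lerD (nmB _ _) (lexx _)) (lexx _)) _.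
have qE : q = q' * (2 + 2 * nv h) by rewrite /q' divfK//; lra.
rewrite [in leRHS]qE; lra.
Qed.

(** The difference quotients with step [2^-k] are entire and converge uniformly on balls by
    [quad_rem]. *)
Lemma ent_pd j f : entire f -> entire (pderiv j f).
Proof.
move=> ef; pose F k z := (rc (hp R k))^-1 * (f (z + (rc (hp R k)) *: delta_mx 0 j) - f z).
have hp0' k : rc (hp R k) != 0 :> C by rewrite -nm_gt0 nm_rc gtr0_norm ?hp_gt0.
apply: (ent_limit (F := F)) => [k|r e e0].
  by apply: ent_scale; apply: ent_sub => //; exact: ent_shift.
have [M M0 HM] := ent_bounded (r + 1) ef.
have e6 : 0 < e / (6 * M + 1) by rewrite divr_gt0//; lra.
have [K hK] := hp_small e6; exists (maxn K 1) => k hk z zr.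
have kK : (K <= k)%N by apply: leq_trans hk; rewrite leq_maxl.
have k1 : (1 <= k)%N by apply: leq_trans hk; rewrite leq_maxr.
have nh : nv (rc (hp R k) *: delta_mx 0 j : E) = hp R k.
  by rewrite nvZ nv_delta mulr1 nm_rc gtr0_norm ?hp_gt0.
have h2 : hp R k <= 1 / 2.
  by case: k {hk kK nh} k1 => // k _; rewrite hpS; have := hp_le1 R k; lra.
have := @quad_rem R n f z (rc (hp R k) *: delta_mx 0 j) M ef; rewrite nh => /(_ h2)Q.
have {}Q := Q (fun x hx => HM x ltac:(by have := nvD (x - z) z; rewrite subrK; lra)).
rewrite /dird lformZr lform_delta in Q.
rewrite /F; set a := rc (hp R k) in Q *.
have -> : a^-1 * (f (z + a *: delta_mx 0 j) - f z) - pderiv j f z =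
   a^-1 * (f (z + a *: delta_mx 0 j) - f z - a * pderiv j f z) by field; exact: hp0'.
rewrite nmM nmV nm_rc gtr0_norm ?hp_gt0// ler_pdivrMl ?hp_gt0//; apply: le_trans Q _.
have := hK k kK; rewrite ltr_pdivlMr; last by lra.
by have := hp_gt0 R k; nra.
Qed.

Lemma ent_dird f v : entire f -> entire (dird f v).
Proof. by move=> ef; apply: ent_sum => j; apply: ent_scale; exact: ent_pd. Qed.

(** On the line from [z0] to [z], [f] has no zero near [z0], so [g] vanishes there and then on the
    whole line. This makes the ring of entire functions a domain. *)
Lemma ent_id0 f g z0 : entire f -> entire g -> (forall z, f z * g z = 0) -> f z0 != 0 ->
  forall z, g z = 0.
Proof.
move=> ef eg H f0 z.
have := ent1_id0 (ent1_line z0 (z - z0) eg) _ 1; rewrite scale1r [z0 + _]addrC subrK; apply.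
have f0' : 0 < nm (f z0) / 2 by rewrite divr_gt0// nm_gt0.
have [dl dl0 hd] := ent1_cont (ent1_line z0 (z - z0) ef) 0 f0'.
exists dl => // w hw; have := hd w hw; rewrite add0r scale0r addr0 => p.
have := H (z0 + w *: (z - z0)) => /eqP; rewrite mulf_eq0 => /orP[/eqP E0|/eqP//].
by move: p; rewrite E0 sub0r nmN => p; exfalso; move: f0' p; lra.
Qed.

Lemma cder0_cst (phi : C -> C) : ent1 phi -> (forall w, cder phi w = 0) -> forall w, phi w = phi 0.
Proof.
move=> ephi H w; have ec := cder_ent ephi.
have Z k : tc (cder phi) k = 0.
  have -> : cder phi = fun=> 0 by apply/funext => x; exact: H.
  elim: k => [//|k IH]; rewrite tcS.
  have [|x|_ ->//] := @dq_uniq R (fun=> 0) (fun=> 0) 0.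
    by move=> z e e0; exists 1 => // h _; rewrite subrr nm0 ltW.
  by rewrite mulr0 addr0.
rewrite dqE (tc_zero (dq_ent ephi)) ?mulr0 ?addr0// => k.
have := Z k; rewrite tc_cder// -tcS => /eqP; rewrite mulf_eq0 pnatr_eq0 /=.
by move/eqP.
Qed.

Lemma pf_ind (Q : (E -> C) -> Prop) :
  (forall c, Q (fun=> c)) -> (forall j, Q (fun z => z 0 j)) ->
  (forall f g, Q f -> Q g -> Q (fun z => f z + g z)) ->
  (forall f g, Q f -> Q g -> Q (fun z => f z * g z)) ->
  forall f, polynomial_fun f -> Q f.
Proof.
move=> Qc Qx Qa Qm f [P fE].
have Qs (I : Type) (s : seq I) (F : I -> E -> C) : (forall i, Q (F i)) -> Q (fun z => \sum_(i <- s) F i z).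
  move=> eF; elim: s => [|i s IH].
    by rewrite (_ : (fun z => _) = fun=> 0)//; apply/funext => z; rewrite big_nil.
  rewrite (_ : (fun z => _) = fun z => F i z + \sum_(i <- s) F i z); first exact: Qa.
  by apply/funext => z; rewrite big_cons.
have Qp (I : Type) (s : seq I) (F : I -> E -> C) : (forall i, Q (F i)) -> Q (fun z => \prod_(i <- s) F i z).
  move=> eF; elim: s => [|i s IH].
    by rewrite (_ : (fun z => _) = fun=> 1)//; apply/funext => z; rewrite big_nil.
  rewrite (_ : (fun z => _) = fun z => F i z * \prod_(i <- s) F i z); first exact: Qm.
  by apply/funext => z; rewrite big_cons.
have QX g k : Q g -> Q (fun z => g z ^+ k).
  move=> Qg; elim: k => [|k IH]; first by rewrite (_ : (fun z => _) = fun=> 1).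
  by rewrite (_ : (fun z => _) = fun z => g z * g z ^+ k); [exact: Qm|apply/funext => z; rewrite exprS].
have -> : f = fun z => \sum_(m <- msupp P) mcoeff m P * \prod_i z 0 i ^+ m i.
  by apply/funext => z; rewrite fE /pfun mevalE.
by apply: (Qs _ _ (fun m z => mcoeff m P * \prod_i z 0 i ^+ m i)) => m; apply: Qm => //; apply: Qp => i; apply: QX.
Qed.

Lemma pf_cst c : polynomial_fun (fun _ : E => c).
Proof. by exists (mpolyC n c) => z; rewrite /pfun mevalC. Qed.
Lemma pf_coord j : polynomial_fun (fun z : E => z 0 j).
Proof. by exists (mpolyX C (mnm1 j)) => z; rewrite /pfun mevalXU. Qed.
Lemma pf_add f g : polynomial_fun f -> polynomial_fun g -> polynomial_fun (fun z => f z + g z).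
Proof. by move=> [P fE] [Q gE]; exists (P + Q) => z; rewrite /pfun mevalD fE gE. Qed.
Lemma pf_mul f g : polynomial_fun f -> polynomial_fun g -> polynomial_fun (fun z => f z * g z).
Proof. by move=> [P fE] [Q gE]; exists (P * Q) => z; rewrite /pfun mevalM fE gE. Qed.
Lemma pf_scale c f : polynomial_fun f -> polynomial_fun (fun z => c * f z).
Proof. by apply: pf_mul; exact: pf_cst. Qed.
Lemma pf_opp f : polynomial_fun f -> polynomial_fun (fun z => - f z).
Proof. by move=> [P fE]; exists (- P) => z; rewrite /pfun mevalN fE. Qed.
Lemma pf_sub f g : polynomial_fun f -> polynomial_fun g -> polynomial_fun (fun z => f z - g z).
Proof. by move=> hf /pf_opp; exact: pf_add. Qed.
Lemma pf_exp f k : polynomial_fun f -> polynomial_fun (fun z => f z ^+ k).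
Proof. by move=> [P fE]; exists (P ^+ k) => z; rewrite /pfun rmorphXn /= fE. Qed.
Lemma pf_sum (I : Type) (s : seq I) (F : I -> E -> C) : (forall i, polynomial_fun (F i)) ->
  polynomial_fun (fun z => \sum_(i <- s) F i z).
Proof.
move=> eF; elim: s => [|i s IH].
  by rewrite (_ : (fun z => _) = fun=> 0); [exact: pf_cst|apply/funext => z; rewrite big_nil].
rewrite (_ : (fun z => _) = fun z => F i z + \sum_(i <- s) F i z); first exact: pf_add.
by apply/funext => z; rewrite big_cons.
Qed.
Lemma pf_pfun P : polynomial_fun (pfun P : E -> C).
Proof. by exists P. Qed.
Lemma pf_ext f g : f =1 g -> polynomial_fun f -> polynomial_fun g.
Proof. by move=> fg [P fE]; exists P => z; rewrite -fg. Qed.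

Lemma pf_ent f : polynomial_fun f -> entire f.
Proof.
by apply: (pf_ind (Q := @entire R n)); [exact: ent_cst|exact: ent_coord|exact: ent_add|exact: ent_mul].
Qed.

Lemma pf_shift c f : polynomial_fun f -> polynomial_fun (fun z => f (z + c)).
Proof.
apply: (pf_ind (Q := fun f => polynomial_fun (fun z => f (z + c)))) => [a|j|f' g|f' g].
- exact: pf_cst.
- apply: (pf_ext (f := fun z => z 0 j + c 0 j)) => [z|]; first by rewrite mxE.
  by apply: pf_add; [exact: pf_coord|exact: pf_cst].
- exact: pf_add.
- exact: pf_mul.
Qed.

Lemma pf_pd j f : polynomial_fun f -> polynomial_fun (pderiv j f).
Proof.
move=> pf; suff : polynomial_fun f /\ polynomial_fun (pderiv j f) by case.
move: f pf; apply: (pf_ind (Q := fun f => polynomial_fun f /\ polynomial_fun (pderiv j f))) => [a|k|f g [pf df] [pg dg]|f g [pf df] [pg dg]].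
- split; first exact: pf_cst.
  by apply: (pf_ext (f := fun=> 0)) => [z|]; [rewrite pd_cst|exact: pf_cst].
- split; first exact: pf_coord.
  by apply: (pf_ext (f := fun=> (j == k)%:R)) => [z|]; [rewrite pd_coord|exact: pf_cst].
- split; first exact: pf_add.
  apply: (pf_ext (f := fun z => pderiv j f z + pderiv j g z)); last exact: pf_add.
  by move=> z; rewrite pd_add//; exact: pf_ent.
- split; first exact: pf_mul.
  apply: (pf_ext (f := fun z => pderiv j f z * g z + f z * pderiv j g z)).
    by move=> z; rewrite pd_mul//; exact: pf_ent.
  by apply: pf_add; exact: pf_mul.
Qed.

Definition pgrowth f := exists A d, forall z, nm (f z) <= A * (1 + nv z) ^+ d.

Lemma pgrowth_pos f : pgrowth f -> exists A d, 0 <= A /\ forall z, nm (f z) <= A * (1 + nv z) ^+ d.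
Proof.
move=> [A [d H]]; exists A, d; split=> //.
by have := H 0; rewrite nv0 addr0 expr1n mulr1; apply: le_trans; exact: nm_ge0.
Qed.

Lemma pgrowth_add f g : pgrowth f -> pgrowth g -> pgrowth (fun z => f z + g z).
Proof.
move=> /pgrowth_pos[A [d [A0 H]]] /pgrowth_pos[B [e [B0 K]]]; exists (A + B), (d + e)%N => z.
have z1 : 1 <= 1 + nv z by have := nv_ge0 z; lra.
apply: le_trans (nmD _ _) _; rewrite mulrDl; apply: lerD.
  by apply: le_trans (H z) _; rewrite ler_wpM2l// ler_weXn2l// leq_addr.
by apply: le_trans (K z) _; rewrite ler_wpM2l// ler_weXn2l// leq_addl.
Qed.

Lemma pgrowth_mul f g : pgrowth f -> pgrowth g -> pgrowth (fun z => f z * g z).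
Proof.
move=> [A [d H]] [B [e K]]; exists (A * B), (d + e)%N => z.
by rewrite nmM exprD mulrACA; apply: ler_pM; rewrite ?nm_ge0.
Qed.

Lemma pf_growth f : polynomial_fun f -> pgrowth f.
Proof.
apply: (pf_ind (Q := pgrowth)) => [c|j||]; [|..|exact: pgrowth_add|exact: pgrowth_mul].
- by exists (nm c), 0%N => z; rewrite expr0 mulr1.
- by exists 1, 1%N => z; rewrite mul1r expr1; have := nv_coord z j; lra.
Qed.

(** Lagrange interpolation at [0, ..., d]. It recovers coefficients linearly from values, which is
    how polynomial dependence of coefficients on a parameter is obtained below. *)
Lemma interpolation d : exists l : 'I_d.+1 -> {poly C}, forall q : {poly C}, (size q <= d.+1)%N ->
  q = \sum_(i < d.+1) q.[i%:R] *: l i.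
Proof.
pose m (i : 'I_d.+1) : {poly C} := \prod_(k < d.+1 | k != i) ('X - (k%:R)%:P).
have mi i : (m i).[i%:R] != 0.
  rewrite horner_prod; apply/prodf_neq0 => k ki.
  by rewrite hornerXsubC subr_eq0 eqr_nat; apply: contra ki => /eqP h; apply/eqP/val_inj.
have mk i k : i != k -> (m i).[k%:R] = 0.
  move=> ik; rewrite horner_prod (bigD1 k) 1?eq_sym//= hornerXsubC subrr mul0r//.
exists (fun i => ((m i).[i%:R])^-1 *: m i) => q sq; apply/eqP; rewrite -subr_eq0; apply/eqP.
set p := _ - _.
have sm i : (size (m i) <= d.+1)%N.
  rewrite /m -big_filter size_prod_XsubC size_filter -sum1_count ltnS.
  have cd : #|predC1 i| = d by rewrite cardC1 card_ord.
  by apply: leq_trans (eq_leq cd); rewrite -sum1_card; apply: eq_leq; apply: eq_bigl.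
have sp : (size p <= d.+1)%N.
  apply: (leq_trans (size_polyD _ _)); rewrite size_polyN geq_max sq /=.
  apply: (leq_trans (size_sum _ _ _)); apply/bigmax_leqP => i _.
  by do 2!apply: (leq_trans (size_scale_leq _ _)).
apply/eqP; apply/negPn/negP => p0.
have := @max_poly_roots _ p [seq i%:R | i <- iota 0 d.+1] p0.
rewrite size_map size_iota ltnNge sp => H; suff : false by []; apply: H.
  apply/allP => x /mapP[k]; rewrite mem_iota add0n => /andP[_ kd] ->.
  rewrite /root /p hornerD hornerN horner_sum (bigD1 (Ordinal kd))//= big1 => [|i ik].
    by rewrite !hornerZ mulVf ?(mi (Ordinal kd))// mulr1 addr0 subrr.
  by rewrite !hornerZ (mk i (Ordinal kd))// !mulr0.
by rewrite map_inj_uniq ?iota_uniq// => x y /eqP; rewrite eqr_nat => /eqP.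
Qed.

End Entire.

(** * Polynomial growth *)

Section Growth.
Variables (R : realType) (n : nat).
Local Notation C := R[i].
Local Notation E := 'rV[C]_n.
Implicit Types (f g h : E -> C) (z v e : E).

Lemma ent1_poly (phi : C -> C) d (A : R) : ent1 phi -> (forall r, 1 <= r ->
    forall w, nm w = r -> nm (phi w) <= A * r ^+ d) ->
  forall w, phi w = \sum_(k < d.+1) tc phi k * w ^+ k.
Proof.
move=> ephi H w; rewrite (taylor phi d.+1 w) (tc_zero (iter_dq_ent d.+1 ephi)) ?mulr0 ?addr0// => k.
rewrite /tc -iterD -/(tc phi (k + d.+1)) addnC; apply/eqP; rewrite -nm_eq0; apply/eqP.
have A0 : 0 <= A.
  by have := H 1 (lexx _) 1 (nm1 _); rewrite expr1n mulr1; apply: le_trans; exact: nm_ge0.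
apply/le_anti; rewrite nm_ge0 andbT; apply/ler_addgt0Pr => e e0; rewrite add0r.
pose r := 1 + A / e; have r1 : 1 <= r by rewrite lerDl divr_ge0// ltW.
have r0 : 0 < r by lra.
have := @tc_le _ phi r _ (d.+1 + k) r0 ephi (H r r1).
have -> : r ^+ (d.+1 + k) = r ^+ d * (r * r ^+ k) by rewrite addSn exprS exprD mulrCA.
have rd : 0 < r ^+ d by rewrite exprn_gt0.
have rk : 1 <= r ^+ k by rewrite exprn_ege1.
rewrite mulrCA [_ * r ^+ d]mulrC ler_pM2l//; set t := nm _ => Q.
have t0 : 0 <= t by exact: nm_ge0.
have : t * r <= A by apply: le_trans Q; rewrite ler_wpM2l// ler_peMr// ltW.
by rewrite -ler_pdivlMr// => /le_trans; apply; rewrite ler_pdivrMr// /r mulrDr mulr1 mulrC divfK ?gt_eqF//; lra.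
Qed.

Lemma line_poly f A d z e : entire f -> (forall z, nm (f z) <= A * (1 + nv z) ^+ d) ->
  forall w, f (z + w *: e) = \sum_(k < d.+1) tc (fun w => f (z + w *: e)) k * w ^+ k.
Proof.
move=> ef H; have A0 : 0 <= A.
  by have := H 0; rewrite nv0 addr0 expr1n mulr1; apply: le_trans; exact: nm_ge0.
have zz := nv_ge0 z; have ee := nv_ge0 e.
apply: (@ent1_poly _ d (A * (1 + nv z + nv e) ^+ d)) => [|r r1 w wr]; first exact: ent1_line.
apply: le_trans (H _) _; rewrite -mulrA -exprMn ler_wpM2l// lerXn2r ?nnegrE ?addr_ge0 ?nv_ge0//; first by nra.
by have := nvD z (w *: e); rewrite nvZ wr; nra.
Qed.

Lemma ent_bounded_cst f A : entire f -> (forall z, nm (f z) <= A) -> forall z, f z = f 0.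
Proof.
move=> ef H z; have := @line_poly f A 0 0 z ef _; have H' x : nm (f x) <= A * (1 + nv x) ^+ 0 by rewrite expr0 mulr1.
by move=> /(_ H'){}H; have := H 1; have := H 0; rewrite !big_ord1 !expr0 !mulr1 scale0r scale1r addr0 add0r => -> ->.
Qed.

Lemma pf_horner (p : {poly C}) f : polynomial_fun f -> polynomial_fun (fun z => p.[f z]).
Proof.
move=> pf; apply: (pf_ext (f := fun z => \sum_(i < size p) p`_i * f z ^+ i)).
  by move=> z; rewrite horner_coef.
by apply: pf_sum => i; apply: pf_scale; exact: pf_exp.
Qed.

Lemma line_interpolation f A d z e (l : 'I_d.+1 -> {poly C}) : entire f ->
  (forall z, nm (f z) <= A * (1 + nv z) ^+ d) ->
  (forall q : {poly C}, (size q <= d.+1)%N -> q = \sum_(i < d.+1) q.[i%:R] *: l i) ->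
  let q := \poly_(k < d.+1) tc (fun w => f (z + w *: e)) k in
  (forall w, q.[w] = f (z + w *: e)) /\ q = \sum_(i < d.+1) f (z + i%:R *: e) *: l i.
Proof.
move=> ef H Hl q; have qE w : q.[w] = f (z + w *: e).
  by rewrite (line_poly z e ef H) /q horner_poly.
split=> //; rewrite [LHS](Hl q (size_poly _ _)); apply: eq_bigr => i _; by rewrite qE.
Qed.

(** The coordinates are released one at a time. In each of them [f] is a polynomial of degree at
    most [d], and interpolation expresses it through [d + 1] fixed values of that coordinate. *)
Lemma growth_poly f : entire f -> pgrowth f -> polynomial_fun f.
Proof.
move=> ef [A [d H]]; have [l Hl] := interpolation R d.
pose mix k (z w : E) : E := \row_j (if (j < k)%N then z 0 j else w 0 j).
have key k w : (k <= n)%N -> polynomial_fun (fun z => f (mix k z w)).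
  elim: k w => [|k IH] w kn.
    apply: (pf_ext (f := fun=> f w)); last exact: pf_cst.
    by move=> z; congr f; apply/rowP => j; rewrite mxE.
  pose o := Ordinal kn; pose w0 (t : C) : E := \row_j (if j == o then t else w 0 j).
  have mE z t : mix k z (w0 0) + t *: delta_mx 0 o = mix k z (w0 t).
    apply/rowP => j; rewrite !mxE eqxx /=.
    have [->|jo] := eqVneq j o; first by rewrite ltnn mulr1 add0r.
    by rewrite mulr0 addr0.
  apply: (pf_ext (f := fun z => \sum_(i < d.+1) f (mix k z (w0 i%:R)) * (l i).[z 0 o])) => [z|].
    have [qE q2] := line_interpolation (mix k z (w0 0)) (delta_mx 0 o) ef H Hl.
    have -> : mix k.+1 z w = mix k z (w0 (z 0 o)).
      apply/rowP => j; rewrite !mxE ltnS leq_eqVlt.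
      have [->|jo] := eqVneq j o; first by rewrite eqxx ltnn.
      by have -> : (j == k :> nat) = false by apply: contraNF jo => /eqP h; apply/eqP/val_inj.
    by rewrite -mE -qE q2 horner_sum; apply: eq_bigr => i _; rewrite hornerZ mE.
  by apply: pf_sum => i; apply: pf_mul; [apply: IH; exact: ltnW|apply: pf_horner; exact: pf_coord].
apply: pf_ext (key n 0 (leqnn _)) => z; congr f; apply/rowP => j; by rewrite mxE ltn_ord.
Qed.

(* With [d] minimal such that [|f z| <= A (1 + |z|)^d], the coefficient of [w^d] in [f (z + w e)] is a
   bounded polynomial in [z], hence a constant; it cannot vanish for all [e] by minimality of [d]. *)
Lemma monic_direction f : polynomial_fun f -> (exists z, f z != 0) ->
  exists (e : E) d (c : C) (q : E -> {poly C}), [/\ c != 0,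
    forall z, (size (q z) <= d.+1)%N, forall z, (q z)`_d = c,
    forall k, polynomial_fun (fun z => (q z)`_k) &
    forall z w, (q z).[w] = f (z + w *: e)].
Proof.
move=> pf [z0 fz0]; have ef := pf_ent pf.
have ex : exists d, `[< exists A, forall z, nm (f z) <= A * (1 + nv z) ^+ d >].
  by have [A [d H]] := pf_growth pf; exists d; apply/asboolP; exists A.
case: (ex_minnP ex) => d /asboolP[A H] dmin; have [l Hl] := interpolation R d.
have A0 : 0 <= A.
  by have := H 0; rewrite nv0 addr0 expr1n mulr1; apply: le_trans; exact: nm_ge0.
pose q e z : {poly C} := \poly_(k < d.+1) tc (fun w => f (z + w *: e)) k.
have qE e z w : (q e z).[w] = f (z + w *: e) by have [] := line_interpolation z e ef H Hl.
have qp e k : polynomial_fun (fun z => (q e z)`_k).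
  apply: (pf_ext (f := fun z => \sum_(i < d.+1) f (z + i%:R *: e) * (l i)`_k)) => [z|].
    have [_] := line_interpolation z e ef H Hl; rewrite -/(q e z) => ->.
    by rewrite coef_sum; apply: eq_bigr => i _; rewrite coefZ.
  by apply: pf_sum => i; apply: pf_mul; [exact: pf_shift|exact: pf_cst].
have qd e z : (q e z)`_d = (q e 0)`_d.
  apply: (ent_bounded_cst (f := fun z => (q e z)`_d) (A := A * (1 + nv e) ^+ d) (pf_ent (qp e d))) => {}z.
  have z1 : 0 < 1 + nv z by have := nv_ge0 z; lra.
  rewrite coef_poly ltnSn -(ler_pM2r (exprn_gt0 d z1)).
  apply: tc_le => // [|w wr]; first exact: ent1_line.
  apply: le_trans (H _) _; rewrite -mulrA -exprMn ler_wpM2l//.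
  have ee := nv_ge0 e; have zz := nv_ge0 z.
  rewrite lerXn2r ?nnegrE ?addr_ge0 ?nv_ge0//; first by nra.
  by have := nvD z (w *: e); rewrite nvZ wr; nra.
have [[e qe]|qe] := pselect (exists e, (q e 0)`_d != 0).
  by exists e, d, (q e 0)`_d, (q e); split=> // z; exact: size_poly.
have {}qe e z : (q e z)`_d = 0.
  by rewrite qd; apply/eqP; apply/negPn/negP => h; apply: qe; exists e.
have {}qe e z : tc (fun w => f (z + w *: e)) d = 0 by rewrite -(qe e z) coef_poly ltnSn.
exfalso; clear ex l Hl q qE qp qd; case: d H dmin qe => [|d] H dmin qe.
  have := qe 0 z0; rewrite /tc /= scale0r addr0 => f0.
  by rewrite f0 eqxx in fz0.
have : (d.+1 <= d)%N; last by rewrite ltnn.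
(* Without the top coefficients [f z] is a sum of [d + 1] terms of degree at most [d] in [r]; on the
   unit circle of a direction of norm at most 1, Cauchy's estimate bounds the coefficients by
   [A * 2 ^+ d.+1]. *)
apply: dmin; apply/asboolP; exists (d.+1%:R * (A * 2 ^+ d.+1)) => z.
have zz := nv_ge0 z; pose r := 1 + nv z; have r1 : 1 <= r by rewrite /r; lra.
pose e := rc r^-1 *: z; have ez : z = 0 + rc r *: e.
  by rewrite add0r /e scalerA -rmorphM /= divff ?gt_eqF ?scale1r//; lra.
have ee : nv e <= 1.
  rewrite nvZ nm_rc gtr0_norm ?invr_gt0; last by lra.
  by rewrite mulrC ler_pdivrMr /r; lra.
rewrite ez (line_poly 0 e ef H) big_ord_recr /=.
rewrite qe mul0r addr0.
apply: le_trans (nm_sum _ _ _) _.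
rewrite -mulrA mulr_natl (_ : _ *+ d.+1 = \sum_(k < d.+1) A * 2 ^+ d.+1 * (1 + nv (0 + rc r *: e)) ^+ d); last first.
  by rewrite sumr_const card_ord.
apply: ler_sum => k _; rewrite nmM nmX nm_rc gtr0_norm; last by lra.
apply: ler_pM; rewrite ?nm_ge0 ?exprn_ge0//; [by lra| |].
  have := @tc_le _ (fun w => f (0 + w *: e)) 1 (A * 2 ^+ d.+1) k ltr01 (ent1_line 0 e ef).
  rewrite expr1n mulr1; apply=> w w1.
  apply: le_trans (H _) _; rewrite ler_wpM2l// lerXn2r ?nnegrE ?addr_ge0 ?nv_ge0//.
  by have := nv_ge0 e; rewrite add0r nvZ w1; lra.
rewrite -ez -/r; apply: ler_weXn2l => //; by rewrite -ltnS.
Qed.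

(* The reversed conjugate polynomial has the modulus of [q] on the unit circle and the conjugate of
   [q`_d] as value at [0]. *)
Lemma rev_poly_bound (q : {poly C}) d (phi : C -> C) M : (size q <= d.+1)%N -> ent1 phi ->
  (forall w, nm w = 1 -> nm (q.[w] * phi w) <= M) -> nm (q`_d * phi 0) <= M.
Proof.
move=> sq ephi H; pose p := \poly_(k < d.+1) (conjc q`_(d - k)).
have pE w : nm w = 1 -> nm p.[w] = nm q.[w].
  move=> w1; have w0 : w != 0 by rewrite -nm_eq0 w1 oner_eq0.
  have cw : conjc w = w^-1.
    apply: (mulfI w0); rewrite mulfV//; case: w w1 {w0} => a b; rewrite /nm /= => /(congr1 (fun x => x ^+ 2)).
    rewrite expr1n sqr_sqrtr ?addr_ge0 ?sqr_ge0// => ab.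
    by apply/ceq; rewrite ?cReM ?cImM /=; [rewrite -ab|]; ring.
  rewrite -[RHS]nm_conj horner_poly (horner_coef_wide _ sq) rmorph_sum /=.
  have -> : \sum_(k < d.+1) conjc q`_(d - k) * w ^+ k = w ^+ d * \sum_(k < d.+1) conjc (q`_k * w ^+ k).
    rewrite (reindex_inj rev_ord_inj) /= mulr_sumr; apply: eq_bigr => k _.
    have kd : (k <= d)%N by rewrite -ltnS.
    rewrite subSS subKn// rmorphM rmorphXn /= cw mulrCA; congr (_ * _).
    have := exprD w (d - k) k; rewrite subnK// => ->.
    by rewrite -mulrA -exprMn mulfV// expr1n mulr1.
  by rewrite nmM nmX w1 expr1n mul1r.
have ep : ent1 (fun w => p.[w]).
  have -> : (fun w => p.[w]) = fun w => \sum_(k < size p) p`_k * \prod_(j < k) w.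
    by apply/funext => w; rewrite horner_coef; apply: eq_bigr => k _; rewrite prodr_const card_ord.
  by apply: ent1_sum => k; apply: ent1M; [exact: ent1_cst|apply: ent1_prod => j; exact: ent1_id].
have := @max_center _ (fun w => p.[w] * phi w) 0 1 M ltr01 (ent1M ep ephi).
rewrite horner_poly big_ord_recl expr0 mulr1 big1 ?addr0 => [|k _]; last by rewrite expr0n mulr0.
rewrite subn0 !nmM nm_conj; apply => w w1; rewrite add0r nmM pE// -nmM; exact: H.
Qed.

(** In the direction of [monic_direction] the polynomial [P] has the constant leading coefficient
    [c], and [rev_poly_bound] bounds [c * h z] by the values of [P h] on a unit circle: dividing by
    [P] costs only constants. *)
Lemma division P h : polynomial_fun P -> (exists z, P z != 0) -> entire h ->
  pgrowth (fun z => P z * h z) -> polynomial_fun h.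
Proof.
move=> pP P0 eh [A [D H]]; have [e [d [c [q [c0 sq qd _ qE]]]]] := monic_direction pP P0.
have A0 : 0 <= A.
  by have := H 0; rewrite nv0 addr0 expr1n mulr1; apply: le_trans; exact: nm_ge0.
have nc : 0 < nm c by rewrite nm_gt0.
apply: growth_poly => //; exists (A * (1 + nv e) ^+ D / nm c), D => z.
rewrite mulrAC ler_pdivlMr// mulrC -nmM -(qd z).
have := @rev_poly_bound (q z) d (fun w => h (z + w *: e)); rewrite scale0r addr0; apply=> //.
  exact: ent1_line.
move=> w w1; rewrite qE; apply: le_trans (H _) _; rewrite -mulrA -exprMn ler_wpM2l//.
have ee := nv_ge0 e; have zz := nv_ge0 z.
rewrite lerXn2r ?nnegrE ?addr_ge0 ?nv_ge0//; first by nra.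
by have := nvD z (w *: e); rewrite nvZ w1; nra.
Qed.

End Growth.

(** * Logarithms of zero-free entire functions *)

Section Logarithm.
Variables (R : realType) (n : nat).
Local Notation C := R[i].
Local Notation E := 'rV[C]_n.
Implicit Types (f g h : E -> C) (z v e : E).

Lemma log_line (phi : C -> C) (w0 : C) : ent1 phi -> (forall w, phi w != 0) -> expC w0 = phi 0 ->
  let F := cprim (fun w => cder phi w / phi w) in
  forall w, phi w = expC (w0 + (F w - F 0)).
Proof.
move=> ephi p0 w00 F w; have ec := cder_ent ephi.
have ei : ent1 (fun w => cder phi w / phi w).
  move=> z; have [a ha] := ec z; have [b hb] := ephi z.
  by eexists; exact: cdiffM ha (cdiff_comp hb (cdiff_inv (p0 z))).
pose G w := phi w * expC (- (w0 + (F w - F 0))).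
have dG (z : C) : cdiff G z 0.
  have dF : cdiff (fun w => - (w0 + (F w - F 0))) z (- (0 + (cder phi z / phi z - 0))).
    apply: cdiffN; apply: cdiffD; first exact: cdiff_cst.
    by apply: cdiffB; [exact: cprimP|exact: cdiff_cst].
  have := cdiffM (cderP z ephi) (cdiff_comp dF (cdiff_expC _)).
  rewrite -[X in cdiff G z X](_ : cder phi z * expC (- (w0 + (F z - F 0))) + phi z * (- (0 + (cder phi z / phi z - 0)) *
            expC (- (w0 + (F z - F 0)))) = 0)//.
  by field; exact: p0.
have GE : G w = G 0.
  by apply: cder0_cst => [x|x]; [exists 0|apply: cderE].
have : G w = 1 by rewrite GE /G subrr addr0 expCN -w00 divff ?expC_neq0.
rewrite /G expCN => /(congr1 (fun x => x * expC (w0 + (F w - F 0)))).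
by rewrite divfK ?expC_neq0// mul1r.
Qed.

(** Cauchy's estimate on circles of radius 1 about points of [[0, 1]] bounds the derivative of [psi]
    by [2 * B]; hence the bound is required up to [|w| = 2]. *)
Lemma riemann_step (F psi : C -> C) (B a b : R) : ent1 psi -> (forall w, cdiff F w (psi w)) ->
  (forall w, nm w <= 2 -> nm (psi w) <= B) -> 0 <= a -> a <= b -> b <= 1 ->
  nm (F (rc b) - F (rc a) - rc (b - a) * psi (rc a)) <= 2 * B * (b - a) ^+ 2.
Proof.
move=> epsi dF HB a0 ab b1.
have B0 : 0 <= B by apply: le_trans (nm_ge0 (psi 0)) (HB 0 _); rewrite nm0; lra.
have D t : 0 <= t <= 1 -> nm (cder psi (rc t)) <= 2 * B.
  move=> /andP[t0 t1]; rewrite -[leRHS]divr1; apply: cauchy_cder => // z z1; apply: HB.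
  by apply: le_trans (nmD _ _) _; rewrite nm_rc ger0_norm// z1; lra.
have rl (phi d : C -> C) t : (forall w, cdiff phi w (d w)) -> rdiff (fun t => phi (rc t)) t (d (rc t)).
  move=> H; have := @cdiff_line R phi 0 1 t (d (rc t)).
  rewrite mulr1 add0r mul1r (_ : (fun t => phi (0 + rc t * 1)) = fun t => phi (rc t)); first by apply; exact: H.
  by apply/funext => x; rewrite mulr1 add0r.
have P t : a <= t <= b -> nm (psi (rc t) - psi (rc a)) <= 2 * B * (b - a).
  move=> /andP[h1 h2]; apply: le_trans (@rdiff_mvt R (fun t => psi (rc t)) (fun t => cder psi (rc t)) a t (2 * B) h1 _ _) _.
  - by move=> s _; apply: rl => w; exact: cderP.
  - by move=> s /andP[? ?]; apply: D; apply/andP; split; lra.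
  - by nra.
have -> : F (rc b) - F (rc a) - rc (b - a) * psi (rc a) =
   (F (rc b) - psi (rc a) * rc b) - (F (rc a) - psi (rc a) * rc a) by rewrite rmorphB /=; ring.
have -> : 2 * B * (b - a) ^+ 2 = 2 * B * (b - a) * (b - a) by rewrite expr2 mulrA.
apply: (@rdiff_mvt R (fun t => F (rc t) - psi (rc a) * rc t) (fun t => psi (rc t) - psi (rc a))) => //.
move=> t _; apply: rdiffB; first exact: rl.
rewrite -[X in rdiff _ _ X]mulr1; apply: rdiffZ.
by apply: (rl id (fun=> 1)) => w; exact: cdiff_id.
Qed.

Lemma riemann_sum (F psi : C -> C) (B : R) k : ent1 psi -> (forall w, cdiff F w (psi w)) ->
  (forall w, nm w <= 2 -> nm (psi w) <= B) ->
  nm (\sum_(m < (2 ^ k)%N) rc (hp R k) * psi (rc (m%:R * hp R k)) - (F 1 - F 0)) <= 2 * B * hp R k.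
Proof.
move=> epsi dF HB; pose N := (2 ^ k)%N.
have Nh : N%:R * hp R k = 1 by rewrite /N /hp natrX -exprMn divff ?expr1n// pnatr_eq0.
have h0 := hp_gt0 R k.
pose x m := m%:R * hp R k.
have tel : F 1 - F 0 = \sum_(m < N) (F (rc (x m.+1)) - F (rc (x m))).
  rewrite -(big_mkord xpredT (fun m => F (rc (x m.+1)) - F (rc (x m)))) telescope_sumr//.
  by rewrite /x Nh mul0r rc0 rc1.
rewrite tel -sumrB; apply: le_trans (nm_sum _ _ _) _.
have -> : 2 * B * hp R k = \sum_(m < N) 2 * B * hp R k ^+ 2.
  by rewrite sumr_const card_ord -mulr_natr expr2 -[X in X = _]mulr1 -{2}Nh; ring.
apply: ler_sum => m _; rewrite nmBC.
have dx : x m.+1 - x m = hp R k by rewrite /x -natr1; ring.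
rewrite -{1 3}dx; apply: riemann_step => //.
- by rewrite mulr_ge0// ltW.
- by rewrite -subr_ge0 dx ltW.
- by rewrite -Nh /x ler_pM2r// ler_nat.
Qed.

Lemma ent_dilate f (a : C) : entire f -> entire (fun z => f (a *: z)).
Proof.
move=> ef; apply: (ent_of (d := fun z j => a * pderiv j f (a *: z))) => z e e0.
have na := nm_ge0 a; have a1 : 0 < nm a + 1 by lra.
have [dl dl0 hd] := entD (a *: z) ef (divr_gt0 e0 a1).
exists (dl / (nm a + 1)) => [|h]; first by rewrite divr_gt0.
rewrite ltr_pdivlMr// => hh; have h0 := nv_ge0 h.
have ah : nv (a *: h) < dl by rewrite nvZ; nra.
have := hd _ ah; rewrite -scalerDr nvZ.
have -> : \sum_j (a *: h) 0 j * pderiv j f (a *: z) = \sum_j h 0 j * (a * pderiv j f (a *: z)).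
  by apply: eq_bigr => j _; rewrite mxE mulrCA mulrA.
move/le_trans; apply; rewrite mulrAC -mulrA ler_wpM2l ?(ltW e0)//.
by rewrite ler_pdivrMr//; nra.
Qed.

(** The logarithm is the integral of [dU / U] along the segment from [0] to [z], which is correct on
    each line by [log_line]. Its Riemann sums are entire in [z], and the explicit error of
    [riemann_sum] makes them converge uniformly on balls. *)
Lemma log_ent U : entire U -> (forall z, U z != 0) -> exists2 h, entire h & forall z, U z = expC (h z).
Proof.
move=> eU U0; have [h0 h0E] := expC_surj (U0 0).
pose V j z := pderiv j U z / U z.
have eV j : entire (V j) by apply: ent_mul; [exact: ent_pd|exact: ent_inv].
pose psi z w := \sum_j z 0 j * V j (w *: z).
have psiE z w : psi z w = cder (fun w => U (0 + w *: z)) w / U (0 + w *: z).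
  rewrite (cderE (line_cdiff 0 z w eU)) /dird /lform mulr_suml add0r.
  by apply: eq_bigr => j _; rewrite /V mulrA.
have psi2 z : psi z = fun w => cder (fun w => U (0 + w *: z)) w / U (0 + w *: z).
  by apply/funext => w; rewrite psiE.
have epsi z : ent1 (psi z).
  rewrite /psi; apply: ent1_sum => j; apply: ent1M; first exact: ent1_cst.
  have := ent1_line 0 z (eV j); congr ent1; by apply/funext => w; rewrite add0r.
pose F z := cprim (psi z); pose h z := h0 + (F z 1 - F z 0).
exists h => [|z]; last first.
  have := @log_line (fun w => U (0 + w *: z)) h0 (ent1_line 0 z eU) _ _ 1.
  by rewrite -psi2 /= scale0r addr0 scale1r add0r => ->.
apply: (ent_limit (F := fun k z => h0 + \sum_(m < (2 ^ k)%N) rc (hp R k) * psi z (rc (m%:R * hp R k)))) => [k|r e e0].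
  apply: ent_add; first exact: ent_cst.
  apply: ent_sum => m; apply: ent_scale; apply: ent_sum => j; apply: ent_mul; first exact: ent_coord.
  exact: ent_dilate.
pose r' := Num.max r 0; have r0 : 0 <= r' by rewrite le_max lexx orbT.
have /choice[M HM] : forall j, exists M, 0 <= M /\ forall z, nv z <= 2 * r' -> nm (V j z) <= M.
  by move=> j; have [M M0 HM] := ent_bounded (2 * r') (eV j); exists M.
pose B := r' * \sum_j M j.
have B0 : 0 <= B by rewrite mulr_ge0// sumr_ge0// => j _; case: (HM j).
have e2 : 0 < e / (2 * B + 1) by rewrite divr_gt0//; lra.
have [K hK] := hp_small e2; exists K => k /hK kK z zr.
have zr' : nv z <= r' by rewrite le_max zr.
rewrite /h opprD addrACA subrr add0r.
apply: le_trans (@riemann_sum (F z) (psi z) B k (epsi z) _ _) _.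
- by move=> w; apply: cprimP.
- move=> w w2; rewrite /psi /B mulr_sumr; apply: le_trans (nm_sum _ _ _) _; apply: ler_sum => j _.
  rewrite nmM; apply: ler_pM; rewrite ?nm_ge0//; first exact: le_trans (nv_coord _ _) zr'.
  by case: (HM j) => _; apply; rewrite nvZ; apply: ler_pM; rewrite ?nm_ge0 ?nv_ge0.
- by move: kK; rewrite ltr_pdivlMr; have := hp_gt0 R k; nra.
Qed.

End Logarithm.

(** * Entire factors of an irreducible polynomial *)

Section FactorOneVar.
Variable R : realType.
Local Notation C := R[i].

Lemma ent1_horner (p : {poly C}) : ent1 (fun w => p.[w]).
Proof.
have -> : (fun w => p.[w]) = fun w => \sum_(k < size p) p`_k * \prod_(j < k) w.
  by apply/funext => w; rewrite horner_coef; apply: eq_bigr => k _; rewrite prodr_const card_ord.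
by apply: ent1_sum => k; apply: ent1M; [exact: ent1_cst|apply: ent1_prod => j; exact: ent1_id].
Qed.

Lemma cder_horner (p : {poly C}) w : cdiff (fun w => p.[w]) w p^`().[w].
Proof.
elim/poly_ind: p => [|p c IH].
  rewrite deriv0 horner0 (_ : (fun w => _) = fun=> 0); first exact: cdiff_cst.
  by apply/funext => x; rewrite horner0.
rewrite derivD derivC addr0 derivM derivX mulr1 hornerD hornerM hornerX.
rewrite (_ : (fun w => _) = fun w => p.[w] * w + c); last by apply/funext => x; rewrite hornerMXaddC.
rewrite -[X in cdiff _ _ X]addr0; apply: cdiffD; last exact: cdiff_cst.
by rewrite -[X in cdiff _ _ (_ + X)]mulr1; apply: cdiffM => //; exact: cdiff_id.
Qed.

(** At a root [a] the whole expression equals [t.[a]], so [|t.[a]| <= 2 eps] by [max_half]. On the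
    circle [|w - a| >= rho / 2 >= 1], so dividing by [w - a] removes the root and leaves the error
    [3 eps]. Thus a function small on the circle has a small remainder, uniformly in the position of
    the roots. *)
Lemma remainder_bound (s : seq C) (S : C -> C) (t : {poly C}) rho eps :
  2 <= rho -> (forall a, a \in s -> nm a <= rho / 2) -> ent1 S -> (size t <= size s)%N ->
  (forall w, nm w = rho -> nm ((\prod_(a <- s) (w - a)) * S w + t.[w]) <= eps) ->
  forall w, nm w <= rho / 2 -> nm t.[w] <= 2 * (1 + 3 * rho) ^+ size s * eps.
Proof.
move=> rho2; have rho0 : 0 < rho by lra.
elim: s t eps => [|a s IH] t eps sa eS st H w hw.
  have -> : t = 0 by apply/eqP; rewrite -size_poly_leq0.
  have e0 : 0 <= eps.
    have := H (rc rho); rewrite nm_rc gtr0_norm// => /(_ erefl); apply: le_trans; exact: nm_ge0.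
  by rewrite horner0 nm0 expr0 mulr1; lra.
have e0 : 0 <= eps.
  have := H (rc rho); rewrite nm_rc gtr0_norm// => /(_ erefl); apply: le_trans; exact: nm_ge0.
have aa : nm a <= rho / 2 by apply: sa; rewrite mem_head.
pose t1 := t %/ ('X - a%:P).
have tE : t = t1 * ('X - a%:P) + t.[a]%:P by rewrite {1}(divp_eq t ('X - a%:P)) modp_XsubC.
have tw x : t.[x] = (x - a) * t1.[x] + t.[a].
  by rewrite {1}tE hornerD hornerM hornerXsubC hornerC mulrC.
have st1 : (size t1 <= size s)%N.
  by rewrite /t1 size_divp ?polyXsubC_eq0// size_XsubC leq_subLR.
pose F x := (\prod_(a <- a :: s) (x - a)) * S x + t.[x].
have eF : ent1 F.
  apply: ent1D; last exact: ent1_horner.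
  apply: ent1M => //; apply: ent1_prod => b; apply: ent1D; [exact: ent1_id|exact: ent1_cst].
have Fa : F a = t.[a] by rewrite /F big_cons subrr !mul0r add0r.
have ta : nm t.[a] <= 2 * eps.
  rewrite -Fa -[a]add0r; apply: (max_half rho0 eF _ aa) => z hz; rewrite add0r; exact: H.
have H1 x : nm x = rho -> nm ((\prod_(a <- s) (x - a)) * S x + t1.[x]) <= 3 * eps.
  move=> hx; have := H x hx; rewrite big_cons tw -mulrA addrA -mulrDr; set y := _ + t1.[x] => Hx.
  have xa : rho / 2 <= nm (x - a) by have := nmD (x - a) a; rewrite subrK hx; lra.
  have : nm ((x - a) * y) <= 3 * eps.
    by have := nmB ((x - a) * y + t.[a]) t.[a]; rewrite addrK; lra.
  by rewrite nmM; have := nm_ge0 y; nra.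
have sa1 b : b \in s -> nm b <= rho / 2 by move=> hb; apply: sa; rewrite inE hb orbT.
have := IH t1 (3 * eps) sa1 eS st1 H1 w hw.
have X1 : 1 <= (1 + 3 * rho) ^+ size s by rewrite exprn_ege1//; lra.
rewrite tw /= exprS; set X := _ ^+ _ in X1 * => h1.
apply: le_trans (nmD _ _) _; rewrite nmM.
have : nm (w - a) <= rho by have := nmB w a; lra.
have := nm_ge0 (w - a); have := nm_ge0 t1.[w].
move: (nm (w - a)) (nm t1.[w]) h1 => x y h1 y0 x0 xr.
have : x * y <= rho * (2 * X * (3 * eps)) by apply: ler_pM.
have : eps <= X * eps by rewrite ler_peMl.
by move: ta; nra.
Qed.

Lemma ent1_cancel (G : C -> C) a : ent1 G -> (forall w, (w - a) * G w = 0) -> forall w, G w = 0.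
Proof.
move=> eG H; have off w : w != a -> G w = 0.
  by move=> wa; have /eqP := H w; rewrite mulf_eq0 subr_eq0 (negbTE wa) => /eqP.
move=> w; have [->|/off//] := eqVneq w a; apply/eqP; rewrite -nm_eq0; apply/eqP/le_anti.
rewrite nm_ge0 andbT; apply/ler_addgt0Pr => e e0; rewrite add0r.
have [dl dl0 hd] := ent1_cont eG a e0; have [h h0 hl] := rc_lt_ex dl0.
have := hd h hl; rewrite (off (a + h)) ?sub0r ?nmN//.
by rewrite -subr_eq0 addrC addKr.
Qed.

(** Each root is a zero of one of the two factors and is divided out there. *)
Lemma factor_line (phi psi : C -> C) (s : seq C) (c : C) : ent1 phi -> ent1 psi ->
  (forall w, phi w * psi w = c * \prod_(a <- s) (w - a)) ->
  exists s1 s2 u v, [/\ perm_eq s (s1 ++ s2), ent1 u, ent1 v,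
    (forall w, phi w = (\prod_(a <- s1) (w - a)) * u w) /\
    (forall w, psi w = (\prod_(a <- s2) (w - a)) * v w) & forall w, u w * v w = c].
Proof.
elim: s phi psi => [|a s IH] phi psi ephi epsi H.
  exists [::], [::], phi, psi; split=> //; first by split=> w; rewrite big_nil mul1r.
  by move=> w; rewrite H big_nil mulr1.
have cancel1 (f g : C -> C) : ent1 f -> ent1 g -> f a = 0 ->
    (forall w, f w * g w = c * \prod_(a <- a :: s) (w - a)) ->
    forall w, dqa f a w * g w = c * \prod_(a <- s) (w - a).
  move=> ef eg fa Hfg w; apply/eqP; rewrite -subr_eq0 -mulN1r; apply/eqP.
  apply: (ent1_cancel (G := fun w => dqa f a w * g w + -1 * (c * \prod_(a <- s) (w - a))) (a := a)).
    apply: ent1D; first by apply: ent1M => //; exact: dqa_ent.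
    do 2!(apply: ent1M; first exact: ent1_cst).
    by apply: ent1_prod => b; apply: ent1D; [exact: ent1_id|exact: ent1_cst].
  move=> x; transitivity ((x - a) * dqa f a x * g x - c * ((x - a) * \prod_(a <- s) (x - a))); first by ring.
  by have := dqaE f a x; rewrite fa add0r => <-; rewrite Hfg big_cons subrr.
have /eqP := H a; rewrite big_cons subrr mul0r mulr0 mulf_eq0 => /orP[/eqP fa|/eqP ga].
  have [|s1 [s2 [u [v [ps eu ev [pu pv] uv]]]]] := IH (dqa phi a) psi (dqa_ent a ephi) epsi.
    exact: cancel1.
  exists (a :: s1), s2, u, v; split=> //; first by rewrite /= perm_cons.
  by split=> // w; rewrite (dqaE phi a) fa add0r pu big_cons mulrA.
have [|s1 [s2 [u [v [ps eu ev [pu pv] uv]]]]] := IH phi (dqa psi a) ephi (dqa_ent a epsi).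
  by move=> w; rewrite mulrC; apply: cancel1 => // x; rewrite mulrC.
exists s1, (a :: s2), u, v; split=> //.
  by rewrite perm_sym -[a :: s2]cat1s perm_catCA /= perm_cons perm_sym.
by split=> // w; rewrite (dqaE psi a) ga add0r pv big_cons mulrA.
Qed.

Lemma horner_prodX (s : seq C) w : (\prod_(a <- s) ('X - a%:P)).[w] = \prod_(a <- s) (w - a).
Proof. by rewrite horner_prod; apply: eq_bigr => a _; rewrite hornerXsubC. Qed.

(** With [phi = P1 u] and [psi = P2 v] one has [psi phi' = (u v) P1' P2 + P1 P2 (v u')]. So
    [c P1' P2], of lower degree than [P1 P2], is the remainder of [psi phi'], a function that does
    not refer to the splitting of the roots. *)
Lemma factor_line_rem (phi psi : C -> C) (s1 s2 : seq C) (u v : C -> C) c : ent1 u -> ent1 v ->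
  (forall w, phi w = (\prod_(a <- s1) (w - a)) * u w) ->
  (forall w, psi w = (\prod_(a <- s2) (w - a)) * v w) -> (forall w, u w * v w = c) ->
  let P1 := \prod_(a <- s1) ('X - a%:P) in let P2 := \prod_(a <- s2) ('X - a%:P) in
  exists2 S, ent1 S & forall w, psi w * cder phi w =
     (\prod_(a <- s1 ++ s2) (w - a)) * S w + (c *: (P1^`() * P2)).[w].
Proof.
move=> eu ev pu pv uv P1 P2; exists (fun w => v w * cder u w).
  by apply: ent1M => //; exact: cder_ent.
move=> w; rewrite big_cat /= -!horner_prodX -/P1 -/P2.
have -> : phi = fun w => P1.[w] * u w by apply/funext => x; rewrite pu horner_prodX.
rewrite (cderE (cdiffM (cder_horner P1 w) (cderP w eu))).
by rewrite pv -horner_prodX -/P2 hornerZ hornerM -(uv w); ring.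
Qed.

Lemma prodX_bound (s : seq C) B w : 0 <= B -> (forall a, a \in s -> nm a <= B) ->
  let P := \prod_(a <- s) ('X - a%:P) in
  nm P.[w] <= (1 + nm w + B) ^+ size s /\ nm P^`().[w] <= (1 + nm w + B) ^+ size s.
Proof.
move=> B0 sB; have w0 := nm_ge0 w; elim: s sB => [|a s IH] sB.
  by rewrite /= big_nil -polyC1 derivC horner0 hornerC nm0 nm1 expr0 ler01 lexx.
have [h1 h2] := IH (fun b hb => sB b ltac:(by rewrite inE hb orbT)).
have wa : nm (w - a) <= nm w + B by apply: le_trans (nmB _ _) _; rewrite lerD2l sB// mem_head.
rewrite big_cons /= exprS derivM derivXsubC mul1r hornerD !hornerM hornerXsubC nmM.
move: h1 h2; set X := _ ^+ _ => h1 h2; have wa0 := nm_ge0 (w - a).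
have X0 : 0 <= X by apply: le_trans h1; exact: nm_ge0.
have n1 := nm_ge0 (\prod_(a <- s) ('X - a%:P)).[w]; have n2 := nm_ge0 (\prod_(a <- s) ('X - a%:P))^`().[w].
split; first by apply: ler_pM => //; lra.
apply: le_trans (nmD _ _) _; rewrite nmM -addrA mulrDl mul1r; apply: lerD => //.
exact: ler_pM.
Qed.

Lemma root_bound (q : {poly C}) d (c a : C) : (size q <= d.+1)%N -> q`_d = c -> c != 0 -> q.[a] = 0 ->
  nm a <= 1 + \sum_(i < d) nm q`_i / nm c.
Proof.
move=> sq qd c0 qa; have c0' : 0 < nm c by rewrite nm_gt0.
have S0 : 0 <= \sum_(i < d) nm q`_i / nm c by apply: sumr_ge0 => i _; rewrite divr_ge0// nm_ge0.
have [a1|/ltW a1] := leP (nm a) 1; first by lra.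
case: d sq qd S0 => [|d] sq qd S0.
  by move: qa c0; rewrite (horner_coef_wide _ sq) big_ord1 expr0 mulr1 qd => ->; rewrite eqxx.
suff : nm a <= \sum_(i < d.+1) nm q`_i / nm c by lra.
rewrite -mulr_suml ler_pdivlMr//.
have ad : 0 < nm a ^+ d by rewrite exprn_gt0//; lra.
rewrite -(ler_pM2r ad) mulrAC -exprS mulr_suml.
move: qa; rewrite (horner_coef_wide _ sq) big_ord_recr /= qd => /eqP; rewrite addrC addr_eq0 => /eqP.
move=> /(congr1 (@nm R)); rewrite nmN nmM nmX mulrC => ->; apply: le_trans (nm_sum _ _ _) _.
apply: ler_sum => i _; rewrite nmM nmX ler_wpM2l ?nm_ge0// ler_weXn2l//; by rewrite -ltnS.
Qed.

End FactorOneVar.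

(** * Polynomial dependence of the splitting of roots on the line *)

Section Factor.
Variables (R : realType) (n : nat).
Local Notation C := R[i].
Local Notation E := 'rV[C]_n.

Lemma pd_pfun j (P : mpoly n C) z : pderiv j (pfun P) z = pfun (mderiv j P) z.
Proof.
move: P; suff gen (Q : mpoly n C -> Prop) : (forall c, Q (mpolyC n c)) ->
    (forall k, Q (mpolyX C (mnm1 k))) -> (forall A B, Q A -> Q B -> Q (A + B)) ->
    (forall A B, Q A -> Q B -> Q (A * B)) -> forall P, Q P.
  apply: gen => [c|k|A B hA hB|A B hA hB].
  - rewrite mderivC /pfun meval0 (_ : (fun z : E => _) = fun=> c) ?pd_cst//.
    by apply/funext => x; rewrite mevalC.
  - rewrite (_ : pfun _ = fun z : E => z 0 k); last by apply/funext => x; rewrite /pfun mevalXU.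
    rewrite pd_coord mderivX /pfun mevalZ mnm1E eq_sym.
    have [->|_] := eqVneq k j; last by rewrite mul0r.
    rewrite (_ : mnm_sub (mnm1 j) (mnm1 j) = mnm0) ?mpolyX0 ?meval1 ?mulr1//.
    by apply/mnmP => i; rewrite !mnmE subnn.
  - rewrite (_ : pfun _ = fun z : E => pfun A z + pfun B z); last by apply/funext => x; rewrite /pfun mevalD.
    by rewrite pd_add ?hA ?hB ?mderivD /pfun ?mevalD//; apply: pf_ent; exact: pf_pfun.
  - rewrite (_ : pfun _ = fun z : E => pfun A z * pfun B z); last by apply/funext => x; rewrite /pfun mevalM.
    by rewrite pd_mul ?hA ?hB ?mderivM /pfun ?mevalD ?mevalM//; apply: pf_ent; exact: pf_pfun.
move=> Qc Qx Qa Qm P.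
have QX m : Q (mpolyX C m).
  rewrite mpolyXE_id; elim/big_ind: _ => [|A B|i _]; [exact: (Qc 1)|exact: Qm|].
  by elim: (m i) => [|k IH]; [rewrite expr0; exact: (Qc 1)|rewrite exprS; exact: Qm].
elim/mpolyind: P => [|a m P _ _ IH]; first exact: (Qc 0).
by apply: Qa => //; rewrite -mul_mpolyC; apply: Qm.
Qed.

(** The constant coefficient is the value at [0]; differentiation reduces the other coefficients to
    it. *)
Lemma pfun_eq0 (P : mpoly n C) : (forall z, pfun P z = 0) -> P = 0.
Proof.
move=> H; apply/mpolyP => m; rewrite mcoeff0.
have [k] := ubnP (mdeg m); elim: k m P H => // k IH m P H; rewrite ltnS => mk.
have P0 : pfun P 0 = mcoeff mnm0 P.
  elim/mpolyind: P {H} => [|a m' P _ _ IHP]; first by rewrite /pfun meval0 mcoeff0.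
  rewrite /pfun mevalD mevalZ mcoeffD mcoeffZ mcoeffX -IHP mevalX; congr (_ * _ + _).
  have [->|m0] := eqVneq m' mnm0.
    by rewrite big1 // => i _; rewrite mnmE expr0.
  have /existsP[i mi] : [exists i, m' i != 0%N].
    apply: contraNT m0; rewrite negb_exists => /forallP h; apply/eqP/mnmP => i.
    by rewrite mnmE; apply/eqP; move: (h i); rewrite negbK.
  by rewrite (bigD1 i)//= mxE expr0n (negbTE mi) mul0r.
have [->|m0] := eqVneq m mnm0; first by rewrite -P0 H.
have /existsP[i mi] : [exists i, m i != 0%N].
  apply: contraNT m0; rewrite negb_exists => /forallP h; apply/eqP/mnmP => i.
  by rewrite mnmE; apply/eqP; move: (h i); rewrite negbK.
have mE : m = mnm_add (mnm_sub m (mnm1 i)) (mnm1 i).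
  by apply/mnmP => l; rewrite !mnmE; have [<-|_] := eqVneq i l; [rewrite subnK// lt0n|rewrite subn0 addn0].
have := IH (mnm_sub m (mnm1 i)) (mderiv i P).
rewrite mcoeff_deriv -mE => h; apply/eqP; move: h.
have mk' : (mdeg (mnm_sub m (mnm1 i)) < k)%N by rewrite mE mdegD mdeg1 addn1 in mk.
move=> /(_ _ mk')h; have /eqP : mcoeff m P *+ (mnm_sub m (mnm1 i) i).+1 = 0.
  apply: h => z; rewrite -pd_pfun (_ : pfun P = fun=> 0) ?pd_cst//; by apply/funext => x; rewrite H.
by rewrite -mulr_natl mulf_eq0 pnatr_eq0.
Qed.

(** The coefficient of [w^(k+1)] is [1 / (k + 1)] times that of [w^k] for the directional
    derivative. *)
Lemma ent_tc Phi (e : E) k : entire Phi -> entire (fun z => tc (fun w => Phi (z + w *: e)) k).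
Proof.
elim: k Phi => [|k IH] Phi eP.
  by move: (eP); congr entire; apply/funext => z; rewrite tc0 scale0r addr0.
have := ent_scale (k.+1%:R^-1) (IH _ (ent_dird e eP)); congr entire; apply/funext => z.
have -> : (fun w => dird Phi e (z + w *: e)) = cder (fun w => Phi (z + w *: e)).
  by apply/funext => w; rewrite (cderE (line_cdiff z e w eP)).
by rewrite tc_cder ?mulKf ?pnatr_eq0//; exact: ent1_line.
Qed.

Variables (U V : E -> C) (e : E) (d : nat) (c : C) (q : E -> {poly C}).
Variables (eU : entire U) (eV : entire V) (c0 : c != 0).
Variables (sq : forall z, (size (q z) <= d.+2)%N) (qd : forall z, (q z)`_d.+1 = c).
Variables (qp : forall k, polynomial_fun (fun z => (q z)`_k)).

Lemma size_q z : size (q z) = d.+2.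
Proof.
apply/eqP; rewrite eqn_leq sq /= ltnNge; apply/negP => h.
by move: c0; rewrite -(qd z) nth_default ?eqxx.
Qed.

Lemma q_neq0 z : q z != 0.
Proof. by rewrite -size_poly_gt0 size_q. Qed.

Lemma size_modX z k : (size ('X^k %% q z)%R <= d.+1)%N.
Proof. by rewrite -ltnS -(size_q z) ltn_modp q_neq0. Qed.

(** Multiplication by [X] is followed by the subtraction of a multiple of [q z]; the only division
    is by the constant [c], so the coefficients remain polynomial in [z]. *)
Lemma modX_pf k i : polynomial_fun (fun z => ('X^k %% q z)`_i).
Proof.
elim: k i => [|k IH] i.
  apply: (pf_ext (f := fun=> (i == 0)%:R)) => [z|]; last exact: pf_cst.
  by rewrite expr0 modp_small ?size_poly1 ?size_q// coef1.
pose t z : {poly C} := ('X^k %% q z)%R.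
have step z : ('X^(k.+1) %% q z)%R = 'X * t z - ((t z)`_d / c) *: q z.
  rewrite exprS -modp_mul -/(t z) -{1}(subrK (((t z)`_d / c) *: q z) ('X * t z)).
  rewrite -mul_polyC addrC modp_addl_mul_small// size_q ltnS.
  apply/leq_sizeP => j; rewrite leq_eqVlt => /orP[/eqP<-|dj].
    by rewrite coefB mul_polyC coefZ qd divfK// coefXM /= subrr.
  rewrite coefB mul_polyC coefZ coefXM (nth_default _ (leq_trans (sq z) dj)) mulr0 subr0.
  case: j dj => // j dj /=; exact: (nth_default _ (leq_trans (size_modX z k) dj)).
apply: (pf_ext (f := fun z => (if i == 0 then 0 else (t z)`_i.-1) - (t z)`_d / c * (q z)`_i)) => [z|].
  by rewrite step coefB coefXM coefZ.
apply: pf_sub; first by case: (i == 0); [exact: pf_cst|exact: IH].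
apply: pf_mul => //; apply: (pf_ext (f := fun z => c^-1 * (t z)`_d)) => [z|]; first by rewrite mulrC.
by apply: pf_scale; exact: IH.
Qed.

(** The roots of [q z] allotted to [U] and to [V] are chosen for each [z] separately, without any
    regularity in [z]. The aim is [zeros_pf]: the polynomial [P1 z] with roots [s1 z] has
    coefficients polynomial in [z]. *)
Variables (s1 s2 : E -> seq C) (u v : E -> C -> C).
Variables (eu : forall z, ent1 (u z)) (ev : forall z, ent1 (v z)).
Variables (Uu : forall z w, U (z + w *: e) = (\prod_(a <- s1 z) (w - a)) * u z w).
Variables (Vv : forall z w, V (z + w *: e) = (\prod_(a <- s2 z) (w - a)) * v z w).
Variables (uv : forall z w, u z w * v z w = c).
Variables (qs : forall z, q z = c *: \prod_(a <- s1 z ++ s2 z) ('X - a%:P)).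

Let P1 z : {poly C} := \prod_(a <- s1 z) ('X - a%:P).
Let P2 z : {poly C} := \prod_(a <- s2 z) ('X - a%:P).
Let r z : {poly C} := c *: ((P1 z)^`() * P2 z).

Lemma size_roots z : size (s1 z ++ s2 z) = d.+1.
Proof. by have := size_q z; rewrite qs size_scale// size_prod_XsubC => -[]. Qed.

Lemma size_r z : (size (r z) <= d.+1)%N.
Proof.
rewrite size_scale//; apply: leq_trans (size_polyMleq _ _) _.
have h1 : (size (P1 z)^`() <= size (s1 z))%N.
  rewrite -ltnS -(size_prod_XsubC (s1 z) id); apply: lt_size_deriv.
  exact: monic_neq0 (monic_prod_XsubC _ _ _).
by rewrite size_prod_XsubC addnS /= -(size_roots z) size_cat leq_add2r.
Qed.

Lemma roots_growth : exists A D, 1 <= A /\ forall z a, a \in s1 z ++ s2 z -> nm a <= A * (1 + nv z) ^+ D.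
Proof.
have /choice[A /choice[D H]] : forall i : 'I_d.+1, exists A D, 0 <= A /\ forall z, nm (q z)`_i <= A * (1 + nv z) ^+ D.
  by move=> i; exact: pgrowth_pos (pf_growth (qp i)).
have nc : 0 < nm c by rewrite nm_gt0.
exists (1 + \sum_i A i / nm c), (\sum_i D i)%N; split.
  by rewrite lerDl sumr_ge0// => i _; rewrite divr_ge0 ?nm_ge0//; case: (H i).
move=> z a az; have z1 : 1 <= 1 + nv z by have := nv_ge0 z; lra.
have X1 k : 1 <= (1 + nv z) ^+ k by rewrite exprn_ege1.
apply: le_trans (root_bound (sq z) (qd z) c0 (a := a) _) _.
  rewrite qs hornerZ horner_prodX; apply/eqP; rewrite mulf_eq0 (negbTE c0) /= prodf_seq_eq0.
  by apply/hasP; exists a; rewrite // subrr eqxx.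
rewrite mulrDl mul1r; apply: lerD => //; rewrite mulr_suml; apply: ler_sum => i _.
rewrite mulrAC ler_pM2r ?invr_gt0//; have [A0 h] := H i; apply: le_trans (h z) _.
by rewrite ler_wpM2l// ler_weXn2l// (bigD1 i)//= leq_addr.
Qed.

(* On the line through [z] with direction [e], [r z] is the remainder of [V (dU/de)] modulo [q z]; the
   remainders of the Taylor polynomials of [V (dU/de)] depend analytically on [z] and converge to it. *)
Lemma r_ent w : entire (fun z => (r z).[w]).
Proof.
pose Phi z := V z * dird U e z; have ePhi : entire Phi by apply: ent_mul => //; exact: ent_dird.
pose phi k z := tc (fun w => Phi (z + w *: e)) k.
have [A [D [A1 rg]]] := roots_growth.
apply: (ent_limit (F := fun K z => (\sum_(k < K) phi k z *: ('X^k %% q z)).[w])) => [K|b eps eps0].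
  have -> : (fun z => (\sum_(k < K) phi k z *: ('X^k %% q z)).[w]) =
      fun z => \sum_(k < K) phi k z * \sum_(i < d.+1) w ^+ i * ('X^k %% q z)`_i.
    apply/funext => z; rewrite horner_sum; apply: eq_bigr => k _; rewrite hornerZ.
    by rewrite (horner_coef_wide _ (size_modX z k)); congr (_ * _); apply: eq_bigr => i _; rewrite mulrC.
  apply: ent_sum => k; apply: ent_mul; first exact: ent_tc.
  by apply: ent_sum => i; apply: ent_scale; apply: pf_ent; exact: modX_pf.
pose b' := Num.max b 0; have b0 : 0 <= b' by rewrite le_max lexx orbT.
pose B := A * (1 + b') ^+ D; have X1 : 1 <= (1 + b') ^+ D by rewrite exprn_ege1//; lra.
have B1 : 1 <= B by rewrite /B; nra.
(* Half of this radius covers the point [w] and the roots of [q z] for all [z] in the ball. *)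
have w0 := nm_ge0 w; pose rho := 2 * (B + nm w).
have rho2 : 2 <= rho by rewrite /rho; lra.
have [M M0 HM] := ent_bounded (b' + 4 * rho * nv e) ePhi.
pose Q := 2 * (1 + 3 * rho) ^+ d.+1 * (4 * M); have Q0 : 0 <= Q.
  by rewrite /Q !mulr_ge0// exprn_ge0//; lra.
have [K hK] := hp_small (divr_gt0 eps0 (ltac:(lra) : 0 < Q + 1)).
exists K => k /hK kK z zb; have zb' : nv z <= b' by rewrite le_max zb.
have za a : a \in s1 z ++ s2 z -> nm a <= rho / 2.
  move=> /rg /le_trans; apply; rewrite (_ : rho / 2 = B + nm w); last by rewrite /rho; field.
  apply: (@le_trans _ _ B); last by lra.
  rewrite /B ler_wpM2l ?lerXn2r ?nnegrE//; have := nv_ge0 z; lra.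
have [S eS SE] := factor_line_rem (eu z) (ev z) (Uu z) (Vv z) (uv z).
pose Dv := \sum_(i < k) phi i z *: ('X^i %/ q z).
pose T := \sum_(i < k) phi i z *: ('X^i %% q z).
(* [r z - T] is the remainder modulo [q z] of [V (dU/de)] minus its Taylor polynomial, a difference
   that is small on the circle. *)
have key : nm (r z - T).[w] <= 2 * (1 + 3 * rho) ^+ size (s1 z ++ s2 z) * (4 * M * hp R k).
  apply: (@remainder_bound _ _ (fun w => S w - c * Dv.[w])) => //.
  - rewrite (_ : (fun w => _) = fun w => S w + (- c) * Dv.[w]).
      by apply: ent1D => //; apply: ent1M; [exact: ent1_cst|exact: ent1_horner].
    by apply/funext => x; rewrite mulNr.
  - rewrite size_roots; apply: leq_trans (size_polyD _ _) _; rewrite size_polyN geq_max size_r /=.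
    apply: leq_trans (size_sum _ _ _) _; apply/bigmax_leqP => i _.
    exact: leq_trans (size_scale_leq _ _) (size_modX _ _).
  - move=> x xr.
    have -> : \prod_(a <- s1 z ++ s2 z) (x - a) * (S x - c * Dv.[x]) + (r z - T).[x] =
        Phi (z + x *: e) - \sum_(i < k) phi i z * x ^+ i.
      have -> : \sum_(i < k) phi i z * x ^+ i = Dv.[x] * (q z).[x] + T.[x].
        rewrite /Dv /T !horner_sum mulr_suml -big_split; apply: eq_bigr => i _.
        by rewrite /= !hornerZ -mulrA -mulrDr -hornerM -hornerD -divp_eq hornerXn.
      rewrite /Phi -(cderE (line_cdiff z e x eU)) SE -/(P1 z) -/(P2 z) -/(r z) hornerD hornerN.
      have -> : (q z).[x] = c * \prod_(a <- s1 z ++ s2 z) (x - a) by rewrite qs hornerZ horner_prodX.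
      by ring.
    apply: (taylor_rem_hp (r := 4 * rho)) => //; [lra|exact: ent1_line| |lra].
    move=> y y4; apply: HM; apply: le_trans (nvD _ _) _; rewrite nvZ y4; lra.
  - rewrite /rho; lra.
rewrite -[(\sum_(i < k) _).[w]]opprK nmBC.
have -> : (r z).[w] - - - T.[w] = (r z - T).[w] by rewrite hornerD hornerN opprK.
apply: le_trans key _; rewrite size_roots mulrA -/Q; move: kK; rewrite ltr_pdivlMr; last by lra.
by have := hp_gt0 R k; nra.
Qed.

(** The roots of [q z] grow polynomially in [z], hence so does the entire function [z |-> (r
    z).[w]]. *)
Lemma r_pf w : polynomial_fun (fun z => (r z).[w]).
Proof.
apply: growth_poly; first exact: r_ent.
have [A [D [A1 rg]]] := roots_growth; have w0 := nm_ge0 w.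
exists (nm c * (1 + nm w + A) ^+ d.+1), (D * d.+1)%N => z.
have z1 : 1 <= 1 + nv z by have := nv_ge0 z; lra.
have X1 : 1 <= (1 + nv z) ^+ D by rewrite exprn_ege1.
pose B := A * (1 + nv z) ^+ D; have B0 : 0 <= B by rewrite /B; nra.
have [_ h1] := @prodX_bound R (s1 z) B w B0 (fun a ha => rg z a ltac:(by rewrite mem_cat ha)).
have [h2 _] := @prodX_bound R (s2 z) B w B0 (fun a ha => rg z a ltac:(by rewrite mem_cat ha orbT)).
rewrite hornerZ hornerM !nmM -mulrA ler_wpM2l ?nm_ge0// exprM -exprMn.
apply: le_trans (ler_pM (nm_ge0 _) (nm_ge0 _) h1 h2) _.
rewrite -exprD -size_cat size_roots lerXn2r ?nnegrE//; [lra|by rewrite mulr_ge0//; lra|].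
rewrite /B; nra.
Qed.

Lemma r_coef_pf i : polynomial_fun (fun z => (r z)`_i).
Proof.
have [l Hl] := interpolation R d.
apply: (pf_ext (f := fun z => \sum_(k < d.+1) (r z).[k%:R] * (l k)`_i)) => [z|].
  by rewrite [in RHS](Hl _ (size_r z)) coef_sum; apply: eq_bigr => k _; rewrite coefZ.
by apply: pf_sum => k; apply: pf_mul; [exact: r_pf|exact: pf_cst].
Qed.

(* The coefficients of [q P1' = r P1]: as [r`_d = c deg P1], this determines the coefficients of [P1]
   from the top one downwards, polynomially in those of [q] and [r]. *)
Lemma coef_rec z j : (P1 z)`_j * (c * j%:R - (r z)`_d) =
  \sum_(i < d) (r z)`_i * (P1 z)`_(d + j - i)
  - \sum_(i < d.+1) (q z)`_i * ((P1 z)`_(d.+1 + j - i) * (d.+1 + j - i)%:R).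
Proof.
have E0 : q z * ('X * (P1 z)^`()) = 'X * (r z * P1 z).
  rewrite qs big_cat /= -/(P1 z) -/(P2 z) /r -!mul_polyC; ring.
have XP k : ('X * (P1 z)^`())`_k = (P1 z)`_k * k%:R.
  by rewrite coefXM; case: k => [|k] /=; rewrite ?mulr0// coef_deriv mulr_natr.
have := congr1 (fun p : {poly C} => p`_(d.+1 + j)) E0.
rewrite /= coefXM /= coefM [in RHS]coefM.
rewrite -[((d.+1 + j).+1)%N]/(d.+2 + j)%N -[((d + j).+1)%N]/(d.+1 + j)%N.
rewrite !big_split_ord /= [X in _ + X]big1 => [|i _]; last first.
  by rewrite nth_default ?mul0r// (leq_trans (sq z))// leq_addr.
rewrite addr0 [X in _ = _ + X]big1 => [|i _]; last first.
  by rewrite nth_default ?mul0r// (leq_trans (size_r z))// leq_addr.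
rewrite addr0 big_ord_recr /= [in RHS]big_ord_recr /= qd XP !addKn.
rewrite (eq_bigr (fun i : 'I_d.+1 => (q z)`_i * ((P1 z)`_(d.+1 + j - i) * (d.+1 + j - i)%:R))); last first.
  by move=> i _; rewrite XP.
move=> H; rewrite -[X in _ = X - _](addrK ((r z)`_d * (P1 z)`_j)) -H; ring.
Qed.

Lemma size_P1 z : size (P1 z) = (size (s1 z)).+1.
Proof. by rewrite size_prod_XsubC. Qed.

Lemma P1_lead z : (P1 z)`_(size (s1 z)) = 1.
Proof. by have := monic_prod_XsubC (s1 z) xpredT id; rewrite monicE lead_coefE size_P1 => /eqP. Qed.

(** For [j] equal to the degree of [P1 z] every term on the right of [coef_rec] has an index beyond
    that degree. *)
Lemma r_lead z : (r z)`_d = c * (size (s1 z))%:R.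
Proof.
have := coef_rec z (size (s1 z)); rewrite P1_lead mul1r !big1 => [|i _|i _].
- by rewrite subr0 => /eqP; rewrite subr_eq0 => /eqP.
- by rewrite [(P1 z)`_(_)]nth_default ?mul0r ?mulr0// size_prod_XsubC; have := ltn_ord i; lia.
- by rewrite [(P1 z)`_(_)]nth_default ?mulr0// size_prod_XsubC; have := ltn_ord i; lia.
Qed.

(** By [r_lead] the degree of [P1 z] is, up to the factor [c], a polynomial function of [z]; it is
    bounded, hence constant. *)
Lemma size_s1 z : size (s1 z) = size (s1 0).
Proof.
have b x : nm (r x)`_d <= nm c * d.+1%:R.
  rewrite r_lead nmM nm_natr ler_wpM2l ?nm_ge0// ler_nat.
  by have := size_roots x; rewrite size_cat; lia.
have := ent_bounded_cst (pf_ent (r_coef_pf d)) b z; rewrite !r_lead => /(mulfI c0)/eqP.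
by rewrite eqr_nat => /eqP.
Qed.

(** Descending recursion from the top index [m]: for [i < m] the relation [coef_rec] is divided by
    the non-zero constant [c i - c m]. *)
Lemma zeros_pf j : polynomial_fun (fun z => (P1 z)`_j).
Proof.
pose m := size (s1 0); suff gen k i : (m <= i + k)%N -> polynomial_fun (fun z => (P1 z)`_i).
  by apply: (gen m); rewrite leq_addl.
elim: k i => [|k IH] i; rewrite ?addn0 leq_eqVlt => /orP[/eqP mi|mi].
- apply: (pf_ext (f := fun=> 1)) => [z|]; last exact: pf_cst.
  by rewrite -mi /m -(size_s1 z) P1_lead.
- apply: (pf_ext (f := fun=> 0)) => [z|]; last exact: pf_cst.
  by rewrite nth_default// size_P1 size_s1.
- have [->|im] := eqVneq i m; last first.
    apply: (pf_ext (f := fun z => (c * i%:R - c * m%:R)^-1 * (\sum_(l < d) (r z)`_l * (P1 z)`_(d + i - l)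
      - \sum_(l < d.+1) (q z)`_l * ((P1 z)`_(d.+1 + i - l) * (d.+1 + i - l)%:R)))) => [z|].
      rewrite -coef_rec r_lead size_s1 mulrC mulfK// -mulrBr mulf_neq0// subr_eq0 eqr_nat//.
    apply: pf_scale; apply: pf_sub; apply: pf_sum => l.
      by apply: pf_mul; [exact: r_coef_pf|apply: IH; have := ltn_ord l; lia].
    apply: pf_mul => //; apply: pf_mul; last exact: pf_cst.
    by apply: IH; have := ltn_ord l; lia.
  apply: (pf_ext (f := fun=> 1)) => [z|]; last exact: pf_cst.
  by rewrite /m -(size_s1 z) P1_lead.
- by apply: IH; lia.
Qed.

End Factor.

(** The value at [w = 0] of the polynomials of [zeros_pf] gives polynomials [Q1], [Q2] with
    [U = Q1 u] and [V = Q2 v], where [u v = c], so [p = c Q1 Q2]. One of [Q1], [Q2] is constant by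
    irreducibility, and [u], [v] have no zeros. *)
Lemma factor_zero_free (R : realType) (n : nat) (U V : 'rV[R[i]]_n -> R[i]) (p : mpoly n R[i]) :
  entire U -> entire V -> (forall z, U z * V z = pfun p z) -> p != 0 -> irreducible_mpoly p ->
  (forall z, U z != 0) \/ (forall z, V z != 0).
Proof.
move=> eU eV UV p0 irr.
have [z0 pz0] : exists z, pfun p z != 0.
  apply: contrapT => h; move: p0; rewrite (_ : p = 0) ?eqxx//; apply: pfun_eq0 => z.
  by apply/eqP/negPn/negP => hz; apply: h; exists z.
have [e [d [c [q [c0 sq qd qp qE]]]]] := monic_direction (pf_pfun p) (ex_intro _ z0 pz0).
(* For [d = 0] the polynomial [p] is the non-zero constant [c]. *)
case: d sq qd => [|d] sq qd.
  left=> z; apply/eqP => Uz; have := qE z 0; rewrite scale0r addr0 -UV Uz mul0r.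
  by rewrite (horner_coef_wide _ (sq z)) big_ord1 expr0 mulr1 qd => /eqP; rewrite (negbTE c0).
have /choice[s1 /choice[s2 /choice[u /choice[v H]]]] : forall z, exists s1 s2 u v, [/\ ent1 u, ent1 v,
    (forall w, U (z + w *: e) = (\prod_(a <- s1) (w - a)) * u w) /\
    (forall w, V (z + w *: e) = (\prod_(a <- s2) (w - a)) * v w),
    (forall w, u w * v w = c) & q z = c *: \prod_(a <- s1 ++ s2) ('X - a%:P)].
  move=> z; have [s qs] := closed_field_poly_normal (q z).
  have lc : lead_coef (q z) = c by rewrite lead_coefE (size_q c0 sq qd) qd.
  rewrite lc in qs.
  have [w|s1 [s2 [u [v [ps eu ev UVE uvE]]]]] := @factor_line R _ _ s c (ent1_line z e eU) (ent1_line z e eV).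
    by rewrite UV -qE qs hornerZ horner_prodX.
  by exists s1, s2, u, v; split=> //; rewrite qs; congr (_ *: _); apply: perm_big.
have eu z : ent1 (u z) by case: (H z).
have ev z : ent1 (v z) by case: (H z).
have Uu z w : U (z + w *: e) = (\prod_(a <- s1 z) (w - a)) * u z w by case: (H z) => _ _ [].
have Vv z w : V (z + w *: e) = (\prod_(a <- s2 z) (w - a)) * v z w by case: (H z) => _ _ [].
have uv z w : u z w * v z w = c by case: (H z).
have qs z : q z = c *: \prod_(a <- s1 z ++ s2 z) ('X - a%:P) by case: (H z).
have vu z w : v z w * u z w = c by rewrite mulrC.
have qs' z : q z = c *: \prod_(a <- s2 z ++ s1 z) ('X - a%:P) by rewrite qs !big_cat /= mulrC.
have [Q1 Q1E] := zeros_pf eU eV c0 sq qd qp eu ev Uu Vv uv qs 0.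
have [Q2 Q2E] := zeros_pf eV eU c0 sq qd qp ev eu Vv Uu vu qs' 0.
have UE z : U z = pfun Q1 z * u z 0.
  by have := Uu z 0; rewrite scale0r addr0 -Q1E -horner_coef0 horner_prodX.
have VE z : V z = pfun Q2 z * v z 0.
  by have := Vv z 0; rewrite scale0r addr0 -Q2E -horner_coef0 horner_prodX.
have pE : p = (mpolyC n c * Q1) * Q2.
  apply/eqP; rewrite -subr_eq0; apply/eqP; apply: pfun_eq0 => z.
  rewrite /pfun mevalB !mevalM mevalC -/(pfun p z) -UV UE VE -(uv z 0) /pfun; ring.
have nz (Q : mpoly n R[i]) a : Q = mpolyC n a -> Q != 0 -> forall z : 'rV_n, pfun Q z != 0.
  move=> -> h z; rewrite /pfun mevalC; apply: contraNneq h => ->.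
  by rewrite mpolyC0.
have un z : u z 0 != 0 by apply: contraNneq c0 => h; rewrite -(uv z 0) h mul0r.
have vn z : v z 0 != 0 by apply: contraNneq c0 => h; rewrite -(uv z 0) h mulr0.
case: (irr _ _ pE) => -[a aE]; [left|right] => z.
  rewrite UE mulf_neq0//.
  have := nz _ _ aE _ z; rewrite /pfun mevalM mevalC => h.
  apply: contraNneq (h _) => [->|]; first by rewrite mulr0.
  by apply: contraNneq p0 => h0; rewrite pE h0 mul0r.
rewrite VE mulf_neq0//; apply: nz aE _ z.
by apply: contraNneq p0 => h0; rewrite pE h0 mulr0.
Qed.

(** * Slow and tame functions *)

Section Slow.
Variables (R : realType) (n : nat).
Local Notation C := R[i].
Local Notation E := 'rV[C]_n.
Variables (al be : E -> C) (eal : entire al) (ebe : entire be).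
Implicit Types (N X d : E -> C) (a z : E) (r x K : R).

Definition Msup a r : R :=
  sup [set y | exists2 z, nv (z - a) <= r & y = nm (al z) + nm (be z)]%classic.

Lemma Msup_ge a r z : nv (z - a) <= r -> nm (al z) + nm (be z) <= Msup a r.
Proof.
move=> zr; apply: ub_le_sup; last by exists z.
have [M1 _ H1] := ent_bounded (r + nv a) eal; have [M2 _ H2] := ent_bounded (r + nv a) ebe.
exists (M1 + M2) => _ [y yr ->]; have yn : nv y <= r + nv a.
  by have := nvD (y - a) a; rewrite subrK; lra.
by apply: lerD; [exact: H1|exact: H2].
Qed.

Lemma Msup_le a r B : 0 <= r -> (forall z, nv (z - a) <= r -> nm (al z) + nm (be z) <= B) ->
  Msup a r <= B.
Proof.
move=> r0 H; apply: ge_sup => [|_ [z zr ->]]; last exact: H.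
by exists (nm (al a) + nm (be a)), a => //; rewrite subrr nv0.
Qed.

Lemma Msup_ge0 a r : 0 <= r -> 0 <= Msup a r.
Proof.
move=> r0; apply: le_trans (Msup_ge (z := a) _); last by rewrite subrr nv0.
by rewrite addr_ge0 ?nm_ge0.
Qed.

Lemma Msup_mono a r s : 0 <= r -> r <= s -> Msup a r <= Msup a s.
Proof. by move=> r0 rs; apply: Msup_le => // z zr; apply: Msup_ge; exact: le_trans rs. Qed.

(** The term [ln r] makes polynomials slow; the constants 2 and 1 keep [W] at least 1 for [r >= 1],
    so that it absorbs additive constants. *)
Definition W a r : R := ln (2 + Msup a r) + ln r + 1.

Lemma W_parts a r : 1 <= r -> [/\ 0 <= ln (2 + Msup a r), 0 <= ln r & 1 <= W a r].
Proof.
move=> r1; have M0 : 0 <= Msup a r by apply: Msup_ge0; lra.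
have h1 : 0 <= ln (2 + Msup a r) by apply: ln_ge0; lra.
have h2 : 0 <= ln r by apply: ln_ge0.
by split=> //; rewrite /W; lra.
Qed.

Lemma W_mono a r s : 1 <= r -> r <= s -> W a r <= W a s.
Proof.
move=> r1 rs; have r0 : 0 <= r by lra.
have := Msup_mono a r0 rs; have := Msup_ge0 a r0 => M0 Mrs.
rewrite /W lerD2r; apply: lerD; rewrite ler_ln ?posrE//; lra.
Qed.

Definition Vw a r x q : R := x ^+ q * W a (r * (1 + x^-1)).

Lemma Vw_ge1 a r x q : 1 <= r -> 1 <= x -> 1 <= Vw a r x q.
Proof.
move=> r1 x1; have xi : 0 <= x^-1 by rewrite invr_ge0; lra.
have rx : 1 <= r * (1 + x^-1) by nra.
have [_ _ W1] := W_parts a rx; have : 1 <= x ^+ q by rewrite exprn_ege1.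
by rewrite /Vw; nra.
Qed.

Lemma Vw_mono a r x q q' : 1 <= r -> 1 <= x -> (q <= q')%N -> Vw a r x q <= Vw a r x q'.
Proof.
move=> r1 x1 qq; have xi : 0 <= x^-1 by rewrite invr_ge0; lra.
have rx : 1 <= r * (1 + x^-1) by nra.
have [_ _ W1] := W_parts a rx; rewrite /Vw ler_wpM2r//; first by lra.
exact: ler_weXn2l.
Qed.

Lemma Vw_W a r x : 1 <= r -> 1 <= x -> W a r <= Vw a r x 0.
Proof.
move=> r1 x1; have xi : 0 <= x^-1 by rewrite invr_ge0; lra.
by rewrite /Vw expr0 mul1r; apply: W_mono => //; nra.
Qed.

(** Estimates can be chained: two losses with parameter [3 x] fit into one with parameter [x],
    because [(1 + 1/(3x))^2 <= 1 + 1/x] for [x >= 1]. *)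
Lemma Vw_step a r x q : 1 <= r -> 1 <= x ->
  Vw a (r * (1 + (3 * x)^-1)) (3 * x) q <= 3 ^+ q * Vw a r x q.
Proof.
move=> r1 x1; rewrite /Vw exprMn -[_ * W _ _]mulrA.
apply: ler_wpM2l; first by rewrite exprn_ge0.
apply: ler_wpM2l; first by rewrite exprn_ge0//; lra.
have x0 : 0 < x by lra.
have xi : 0 < x^-1 by rewrite invr_gt0.
have xi1 : x^-1 <= 1 by rewrite invf_le1.
have -> : (3 * x)^-1 = x^-1 / 3 by rewrite invfM mulrC.
apply: W_mono; first by nra.
by rewrite -mulrA ler_wpM2l//; [lra|nra].
Qed.

Definition slow a N := exists K q, 0 <= K /\ forall r x z, 1 <= r -> 1 <= x ->
  nv (z - a) <= r -> nm (N z) <= expR (K * Vw a r x q).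

Definition tame a N := exists K q, 0 <= K /\ forall r x z, 1 <= r -> 1 <= x ->
  nv (z - a) <= r -> nm (N z) <= K * Vw a r x q.

Lemma slow_mul a N X : slow a N -> slow a X -> slow a (fun z => N z * X z).
Proof.
move=> [K [q [K0 H]]] [K' [q' [K'0 H']]]; exists (K + K'), (q + q')%N; split; first lra.
move=> r x z r1 x1 zr; rewrite nmM mulrDl expRD; apply: ler_pM; rewrite ?nm_ge0//.
  by apply: le_trans (H r x z r1 x1 zr) _; rewrite ler_expR ler_wpM2l// Vw_mono// leq_addr.
by apply: le_trans (H' r x z r1 x1 zr) _; rewrite ler_expR ler_wpM2l// Vw_mono// leq_addl.
Qed.

Lemma two_expR1 : 2 <= expR (1 : R).
Proof. by have := expR_ge1Dx (1 : R); lra. Qed.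

Lemma slow_add a N X : slow a N -> slow a X -> slow a (fun z => N z + X z).
Proof.
move=> [K [q [K0 H]]] [K' [q' [K'0 H']]]; exists (K + K' + 1), (q + q')%N; split; first lra.
move=> r x z r1 x1 zr; have V1 := Vw_ge1 a (q + q') r1 x1; apply: le_trans (nmD _ _) _.
have h : nm (N z) <= expR ((K + K') * Vw a r x (q + q')).
  apply: le_trans (H r x z r1 x1 zr) _; rewrite ler_expR; have := Vw_mono a r1 x1 (leq_addr q' q).
  by have := Vw_ge1 a q r1 x1; nra.
have h' : nm (X z) <= expR ((K + K') * Vw a r x (q + q')).
  apply: le_trans (H' r x z r1 x1 zr) _; rewrite ler_expR; have := Vw_mono a r1 x1 (leq_addl q q').
  by have := Vw_ge1 a q' r1 x1; nra.
apply: (@le_trans _ _ (expR ((K + K') * Vw a r x (q + q')) * expR 1)).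
  by have := two_expR1; have := expR_gt0 ((K + K') * Vw a r x (q + q')); nra.
by rewrite -expRD ler_expR; nra.
Qed.

Lemma slow_cst a (c : C) : slow a (fun=> c).
Proof.
exists (nm c), 0%N; split; first exact: nm_ge0.
move=> r x z r1 x1 _; have := Vw_ge1 a 0 r1 x1; have := nm_ge0 c => c0 V1.
by have := expR_ge1Dx (nm c * Vw a r x 0); nra.
Qed.

Lemma slow_ext a N X : N =1 X -> slow a N -> slow a X.
Proof. by move=> NX; rewrite (_ : X = N)//; apply/funext => z. Qed.

Lemma slow_pf a N : polynomial_fun N -> slow a N.
Proof.
move: N; apply: pf_ind => [c|j|f g|f g]; [exact: slow_cst| |exact: slow_add|exact: slow_mul].
apply: (slow_ext (N := fun z => (z 0 j - a 0 j) + a 0 j)) => [z|]; first by rewrite subrK.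
apply: slow_add; last exact: slow_cst.
exists 1, 0%N; split=> // r x z r1 x1 zr; rewrite mul1r.
apply: (@le_trans _ _ r); first by have := nv_coord (z - a) j; rewrite !mxE; lra.
rewrite -{1}(@lnK _ r) ?posrE; last by lra.
rewrite ler_expR; apply: le_trans (Vw_W a r1 x1); have [] := W_parts a r1; rewrite /W; lra.
Qed.

Lemma slow_base a : slow a al /\ slow a be.
Proof.
have H r x z : 1 <= r -> 1 <= x -> nv (z - a) <= r -> nm (al z) + nm (be z) <= expR (1 * Vw a r x 0).
  move=> r1 x1 zr; rewrite mul1r; have r0 : 0 <= r by lra.
  have M0 := Msup_ge0 a r0; have := Msup_ge zr => h.
  apply: (@le_trans _ _ (2 + Msup a r)); first by lra.
  rewrite -{1}(@lnK _ (2 + Msup a r)) ?posrE; last by lra.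
  rewrite ler_expR; apply: le_trans (Vw_W a r1 x1); have [] := W_parts a r1; rewrite /W; lra.
split; exists 1, 0%N; split=> // r x z r1 x1 zr; have := H r x z r1 x1 zr;
  have := nm_ge0 (al z); have := nm_ge0 (be z); lra.
Qed.

(** Cauchy's estimate on balls of radius [r / (3 x)]; the factor [1 / rho <= 3 x] raises the
    exponent of [x] by one. *)
Lemma slow_pd a j N : entire N -> slow a N -> slow a (pderiv j N).
Proof.
move=> eN [K [q [K0 H]]]; exists (6 + 3 ^+ q * K), q.+1; split; first by rewrite addr_ge0 ?mulr_ge0 ?exprn_ge0.
move=> r x z r1 x1 zr; have x0 : 0 < x by lra.
have x3 : 1 <= 3 * x by lra.
pose s := r * (1 + (3 * x)^-1); pose rho := r * (3 * x)^-1.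
have xi : 0 < (3 * x)^-1 by rewrite invr_gt0; lra.
have s1 : 1 <= s by rewrite /s; nra.
have rho0 : 0 < rho by rewrite mulr_gt0//; lra.
have rhox : 1 / rho <= 3 * x.
  by rewrite ler_pdivrMr// /rho mulrCA divff ?mulr1//; lra.
have P := @pd_le R n N j z rho (expR (K * Vw a s (3 * x) q)) rho0 eN.
have {}P : nm (pderiv j N z) <= 2 * expR (K * Vw a s (3 * x) q) / rho.
  apply: P => y yr; apply: H => //; have := nvD (y - z) (z - a); rewrite subrKA.
  by rewrite /s mulrDr mulr1 -/rho; lra.
apply: le_trans P _; have V1 := Vw_ge1 a q r1 x1.
have VS : Vw a r x q.+1 = x * Vw a r x q by rewrite /Vw exprS mulrA.
have VV : K * Vw a s (3 * x) q <= 3 ^+ q * K * Vw a r x q.+1.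
  rewrite [_ * K]mulrC -mulrA ler_wpM2l//; apply: le_trans (Vw_step a q r1 x1) _.
  by rewrite ler_wpM2l ?exprn_ge0// Vw_mono.
rewrite [in leRHS]mulrDl [in leRHS]expRD mulrAC.
have e1 : 2 / rho <= expR (6 * Vw a r x q.+1).
  apply: (@le_trans _ _ (6 * x)); first by move: rhox; rewrite mul1r; lra.
  by have := expR_ge1Dx (6 * Vw a r x q.+1); rewrite VS; nra.
have e2 : expR (K * Vw a s (3 * x) q) <= expR (3 ^+ q * K * Vw a r x q.+1) by rewrite ler_expR.
apply: ler_pM => //; rewrite ?expR_ge0// ?divr_ge0//; lra.
Qed.

Lemma slow_expC a d : tame a d -> slow a (fun z => expC (d z)).
Proof.
move=> [K [q [K0 H]]]; exists K, q; split=> // r x z r1 x1 zr; rewrite nm_expC ler_expR.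
apply: le_trans (H r x z r1 x1 zr); apply: le_trans (nm_Re _); exact: ler_norm.
Qed.

Lemma tame_scale a c d : tame a d -> tame a (fun z => c * d z).
Proof.
move=> [K [q [K0 H]]]; exists (nm c * K), q; split; first by rewrite mulr_ge0 ?nm_ge0.
by move=> r x z r1 x1 zr; rewrite nmM -mulrA ler_wpM2l ?nm_ge0// H.
Qed.

(** On lines through [a], [quotient_tc] bounds the coefficient [k] of [d] by [L * Vw / s^k] at
    radius [s = r (1 + 1/x)]. At radius [r] these bounds form a geometric series, whose sum costs
    one more factor [x]. The value [X a] is the starting point of Jensen's inequality and enters
    through [L]. *)
Lemma tame_quotient a d N X : entire d -> entire N -> entire X -> slow a N -> slow a X ->
  (forall z, N z = expC (d z) * X z) -> X a != 0 -> tame a d.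
Proof.
move=> ed eN eX [K1 [q1 [K10 H1]]] [K2 [q2 [K20 H2]]] NX Xa.
pose K := K1 + K2; pose q := (q1 + q2)%N; have K0 : 0 <= K by rewrite addr_ge0.
have HK r x z : 1 <= r -> 1 <= x -> nv (z - a) <= r -> nm (N z) <= expR (K * Vw a r x q) /\ nm (X z) <= expR (K * Vw a r x q).
  move=> r1 x1 zr; have V1 := Vw_ge1 a q r1 x1; split.
    apply: le_trans (H1 r x z r1 x1 zr) _; rewrite ler_expR.
    by have := Vw_mono a r1 x1 (leq_addr q2 q1); rewrite -/q /K; nra.
  apply: le_trans (H2 r x z r1 x1 zr) _; rewrite ler_expR.
  by have := Vw_mono a r1 x1 (leq_addl q1 q2); rewrite -/q /K; nra.
pose L := 4 * K + 4 * `|ln (nm (X a) / 2)| + 2 * nm (d a).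
have d0 := nm_ge0 (d a); have l0 := normr_ge0 (ln (nm (X a) / 2)).
have L0 : 0 <= L by rewrite /L; lra.
have T r x v k : 1 <= r -> 1 <= x -> nv v <= 1 -> (0 < k)%N ->
    nm (tc (fun w => d (a + w *: v)) k) * r ^+ k <= L * Vw a r x q.
  move=> r1 x1 v1 k0; have r0 : 0 < r by lra.
  have := @quotient_tc R (fun w => d (a + w *: v)) (fun w => N (a + w *: v)) (fun w => X (a + w *: v)) r
    (expR (K * Vw a r x q)) k r0 (ent1_line a v ed) (ent1_line a v eN) (ent1_line a v eX) (fun w => NX _).
  rewrite /= scale0r addr0 => /(_ _ Xa k0) Q; apply: le_trans (Q _) _.
    move=> w wr; apply: HK => //; rewrite addrC addKr nvZ wr; nra.
  rewrite expRK; have V1 := Vw_ge1 a q r1 x1; have := nm_Re (d a); rewrite ler_norml => /andP[h1 h2].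
  have := ler_norm (- ln (nm (X a) / 2)); rewrite normrN => h3.
  by rewrite /L; nra.
have B r x v : 1 <= r -> 1 <= x -> nv v <= 1 -> nm (d (a + rc r *: v)) <= nm (d a) + L * x * Vw a (r * (1 + x^-1)) x q.
  move=> r1 x1 v1; have x0 : 0 < x by lra.
  have xi : 0 < x^-1 by rewrite invr_gt0.
  pose s := r * (1 + x^-1); have s1 : 1 <= s by rewrite /s; nra.
  have V1 := Vw_ge1 a q s1 x1; pose phi w := d (a + w *: v); have ephi := ent1_line a v ed.
  have r4 : 0 < 4 * r by lra.
  have [M M0 HM] := circle_bounded 0 (ltW r4) ephi.
  apply/ler_addgt0Pr => eps eps0.
  have [m hm] := hp_small (divr_gt0 eps0 (ltac:(lra) : 0 < 4 * M + 1)).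
  have nr : nm (rc r) <= (4 * r) / 4 by rewrite nm_rc gtr0_norm; lra.
  have := taylor_rem_hp m.+1 r4 ephi M0 (fun (y : C) hy => ltac:(by have := HM y hy; rewrite add0r)) nr.
  have hm1 := hm m.+1 (leqnSn m); have hm0 := hp_gt0 R m.+1.
  have := nmD (phi (rc r) - \sum_(k < m.+1) tc phi k * rc r ^+ k) (\sum_(k < m.+1) tc phi k * rc r ^+ k).
  rewrite subrK -/phi => h1 h2.
  have h3 : nm (\sum_(k < m.+1) tc phi k * rc r ^+ k) <= nm (d a) + L * x * Vw a s x q.
    rewrite big_ord_recl expr0 mulr1 tc0 {1}/phi scale0r addr0.
    apply: le_trans (nmD _ _) _; rewrite lerD2l; apply: le_trans (nm_sum _ _ _) _.
    pose y := r / s; have s0 : 0 < s by lra.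
    have y0 : 0 <= y by rewrite divr_ge0; lra.
    have y1 : y < 1 by rewrite ltr_pdivrMr// mul1r /s; nra.
    (* As [y = 1 / (1 + 1/x)], the series [y + y^2 + ...] has the sum [x]. *)
    have xy : x * (1 - y) = y by rewrite /y /s; field; rewrite !gt_eqF//; lra.
    apply: (@le_trans _ _ (\sum_(k < m) L * Vw a s x q * y ^+ k.+1)).
      apply: ler_sum => k _; rewrite lift0 nmM nmX nm_rc gtr0_norm; last by lra.
      have -> : r = y * s by rewrite /y divfK// gt_eqF.
      by rewrite exprMn mulrCA mulrC ler_wpM2r ?exprn_ge0//; apply: T.
    rewrite -mulr_sumr [leRHS]mulrAC; apply: ler_wpM2l; first by rewrite mulr_ge0//; lra.
    have -> : \sum_(k < m) y ^+ k.+1 = x * (1 - y ^+ m).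
      elim: m {hm hm1 hm0 h1 h2} => [|m IH]; first by rewrite big_ord0 expr0 subrr mulr0.
      rewrite big_ord_recr /= IH exprS -[X in _ + X * _]xy; ring.
    by have := exprn_ge0 m y0; nra.
  apply: le_trans h1 _; rewrite addrC; apply: lerD => //; apply: le_trans h2 _.
  by move: hm1; rewrite ltr_pdivlMr; nra.
exists (nm (d a) + 3 * L * 3 ^+ q), q.+1; split.
  by rewrite addr_ge0// !mulr_ge0// exprn_ge0.
move=> r x z r1 x1 zr; have r0 : 0 < r by lra.
have x3 : 1 <= 3 * x by lra.
have zE : z = a + rc r *: (rc r^-1 *: (z - a)).
  by rewrite scalerA -rmorphM /= divff ?gt_eqF// scale1r addrC subrK.
have v1 : nv (rc r^-1 *: (z - a)) <= 1.
  by rewrite nvZ nm_rc gtr0_norm ?invr_gt0// mulrC ler_pdivrMr// mul1r.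
rewrite {1}zE; apply: le_trans (B r (3 * x) _ r1 x3 v1) _.
have h := Vw_step a q r1 x1; have V1 := Vw_ge1 a q r1 x1; have V2 := Vw_ge1 a q.+1 r1 x1.
have VS : Vw a r x q.+1 = x * Vw a r x q by rewrite /Vw exprS mulrA.
rewrite [leRHS]mulrDl; apply: lerD; first by nra.
have -> : 3 * L * 3 ^+ q * Vw a r x q.+1 = L * (3 * x) * (3 ^+ q * Vw a r x q) by rewrite VS; ring.
by rewrite ler_wpM2l// mulr_ge0//; lra.
Qed.

(** A property that holds off the zero set of a non-zero entire function. Finitely many such
    properties hold at a common point, since a product of non-zero entire functions is non-zero. *)
Definition gen (Pr : E -> Prop) :=
  exists Z, [/\ entire Z, exists z, Z z != 0 & forall a, Z a != 0 -> Pr a].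

Lemma gen_all (Pr : E -> Prop) : (forall a, Pr a) -> gen Pr.
Proof.
move=> H; exists (fun=> 1); split; [exact: ent_cst|by exists 0; rewrite oner_eq0|by move=> a _].
Qed.

Lemma ent_mul_neq0 N X : entire N -> entire X -> (exists z, N z != 0) -> (exists z, X z != 0) ->
  exists z, N z * X z != 0.
Proof.
move=> eN eX [z1 h1] [z2 h2]; apply: contrapT => h; move: h2.
rewrite (ent_id0 eN eX _ h1) ?eqxx// => z; apply/eqP/negPn/negP => hz; apply: h; by exists z.
Qed.

Lemma gen_and (P Q : E -> Prop) : gen P -> gen Q -> gen (fun a => P a /\ Q a).
Proof.
move=> [Z1 [e1 n1 h1]] [Z2 [e2 n2 h2]]; exists (fun z => Z1 z * Z2 z); split.
- exact: ent_mul.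
- exact: ent_mul_neq0.
- by move=> a; rewrite mulf_eq0 negb_or => /andP[? ?]; split; [apply: h1|apply: h2].
Qed.

Lemma gen_imp (P Q : E -> Prop) : (forall a, P a -> Q a) -> gen P -> gen Q.
Proof. by move=> PQ [Z [eZ nZ hZ]]; exists Z; split=> // a /hZ/PQ. Qed.

Lemma gen_ex (P : E -> Prop) : gen P -> exists a, P a.
Proof. by move=> [Z [_ [z hz] h]]; exists z; apply: h. Qed.

Definition good X := entire X /\ gen (fun a => slow a X).
Definition gtame d := gen (fun a => tame a d).

Lemma good_mul N X : good N -> good X -> good (fun z => N z * X z).
Proof.
move=> [e1 g1] [e2 g2]; split; first exact: ent_mul.
by apply: gen_imp (gen_and g1 g2) => a []; exact: slow_mul.
Qed.

Lemma good_add N X : good N -> good X -> good (fun z => N z + X z).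
Proof.
move=> [e1 g1] [e2 g2]; split; first exact: ent_add.
by apply: gen_imp (gen_and g1 g2) => a []; exact: slow_add.
Qed.

Lemma good_pf X : polynomial_fun X -> good X.
Proof. by move=> pX; split; [exact: pf_ent|apply: gen_all => a; exact: slow_pf]. Qed.

Lemma good_cst c : good (fun=> c).
Proof. by apply: good_pf; exact: pf_cst. Qed.

Lemma good_sub N X : good N -> good X -> good (fun z => N z - X z).
Proof.
move=> gN gX; have := good_add gN (good_mul (good_cst (-1)) gX); congr good.
by apply/funext => z; rewrite mulN1r.
Qed.

Lemma good_pd j X : good X -> good (pderiv j X).
Proof.
move=> [e1 g1]; split; first exact: ent_pd.
by apply: gen_imp g1 => a; exact: slow_pd.
Qed.

Lemma good_base : good al /\ good be.
Proof. by split; split=> //; apply: gen_all => a; case: (slow_base a). Qed.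

Lemma good_expC d : entire d -> gtame d -> good (fun z => expC (d z)).
Proof. by move=> ed gd; split; [exact: ent_exp|apply: gen_imp gd => a; exact: slow_expC]. Qed.

Lemma gtame_quotient d N X : entire d -> good N -> good X ->
  (forall z, N z = expC (d z) * X z) -> (exists z, X z != 0) -> gtame d.
Proof.
move=> ed [eN gN] [eX gX] NX X0; have gZ : gen (fun a => X a != 0) by exists X.
apply: gen_imp (gen_and gZ (gen_and gN gX)) => a [Xa [sN sX]].
exact: tame_quotient NX Xa.
Qed.

Lemma ent1_cancelX (G : C -> C) k : ent1 G -> (forall w, w ^+ k * G w = 0) -> forall w, G w = 0.
Proof.
elim: k => [|k IH] eG H; first by move=> w; have := H w; rewrite mul1r.
apply: IH => //; apply: (ent1_cancel (a := 0)) => [|w]; last by rewrite subr0 mulrA -exprS.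
apply: ent1M => //; rewrite (_ : (fun w => _) = fun w => \prod_(i < k) w).
  by apply: ent1_prod => i; exact: ent1_id.
by apply/funext => w; rewrite prodr_const card_ord.
Qed.

Lemma pd_sum (I : Type) (s : seq I) (F : I -> E -> C) j z : (forall i, entire (F i)) ->
  pderiv j (fun z => \sum_(i <- s) F i z) z = \sum_(i <- s) pderiv j (F i) z.
Proof.
move=> eF; elim: s => [|i s IH].
  by rewrite big_nil (_ : (fun z => _) = fun=> 0) ?pd_cst//; apply/funext => x; rewrite big_nil.
rewrite big_cons -IH -(pd_add j z (eF i) (ent_sum s eF)).
by congr (pderiv j _ z); apply/funext => x; rewrite big_cons.
Qed.

(** If [h = w^(k+1) hk], then the equation divided by [w^k] reads [(k + 1) x(0) hk(0) = 0] at the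
    origin, so the order of vanishing of [h] is infinite. In this form the zeros of [x] elsewhere do
    no harm. *)
Lemma wronskian1 (x h : C -> C) : ent1 x -> ent1 h -> x 0 != 0 -> h 0 = 0 ->
  (forall w, x w * cder h w = h w * cder x w) -> forall w, h w = 0.
Proof.
move=> ex eh x0 h0 H; apply: tc_zero => // k.
elim/ltn_ind: k => -[|k] IH; first by rewrite tc0.
pose hk := iter k.+1 (@dq R) h; have ehk : ent1 hk := iter_dq_ent k.+1 eh.
have hE : h = fun w => w ^+ k.+1 * hk w.
  apply/funext => w; rewrite (taylor h k.+1 w) big1 ?add0r// => i _.
  by rewrite IH ?mul0r// ltn_ord.
pose G w := k.+1%:R * (x w * hk w) + w * (x w * cder hk w + -1 * (hk w * cder x w)).
have eG : ent1 G.
  apply: ent1D; first by apply: ent1M; [exact: ent1_cst|exact: ent1M].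
  apply: ent1M; first exact: ent1_id.
  apply: ent1D; first by apply: ent1M => //; exact: cder_ent.
  by apply: ent1M; [exact: ent1_cst|apply: ent1M => //; exact: cder_ent].
have G0 w : w ^+ k * G w = 0.
  have := H w; rewrite hE (cderE (cdiffM (cdiff_exp k.+1 (cdiff_id w)) (cderP w ehk))) /= mulr1.
  move/eqP; rewrite -subr_eq0 => /eqP <-; rewrite /G exprS; ring.
have {}G0 w : G w = 0.
  exact: (ent1_cancelX eG G0).
have := G0 0; rewrite /G mul0r addr0 => /eqP; rewrite !mulf_eq0 pnatr_eq0 (negbTE x0) /=.
by move/eqP.
Qed.

(** The sum divided by its last term is differentiated and the denominators are cleared; [D i] and
    [U i] stand for the derivatives of [X i] and of the exponent of [e i]. *)
Lemma elim_last m (X D U e : nat -> C) : \sum_(i < m.+1) X i * e i = 0 ->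
  \sum_(i < m.+1) (D i + X i * U i) * e i = 0 ->
  \sum_(i < m) (X m * D i - X i * D m + X i * X m * (U i - U m)) * e i = 0.
Proof.
move=> H dS; transitivity (X m * (\sum_(i < m.+1) (D i + X i * U i) * e i)
    - (D m + X m * U m) * (\sum_(i < m.+1) X i * e i)); last by rewrite H dS !mulr0 subr0.
rewrite !mulr_sumr -sumrB [RHS]big_ord_recr /= [X in _ = _ + X](_ : _ = 0); last by ring.
by rewrite addr0; apply: eq_bigr => k _; ring.
Qed.

(** Induction on [m]. The coefficients left by [elim_last] are again good, so they vanish; hence
    [X i e^(u i - u m)] is a constant multiple of [X m], and if [X i] were not zero,
    [gtame_quotient] would make [u i - u m] tame. *)
Lemma borel m (X u : nat -> E -> C) : (forall i, (i < m)%N -> good (X i) /\ good (u i)) ->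
  (forall z, \sum_(i < m) X i z * expC (u i z) = 0) ->
  (forall i j, (i < j)%N -> (j < m)%N -> ~ gtame (fun z => u i z - u j z)) ->
  forall i, (i < m)%N -> forall z, X i z = 0.
Proof.
elim: m X => [//|m IH] X gX H nt.
have gXi i : (i < m.+1)%N -> good (X i) by move=> /gX[].
have gui i : (i < m.+1)%N -> good (u i) by move=> /gX[].
have [Xm|/existsNP[z0 /eqP Xm]] := pselect (forall z, X m z = 0).
  move=> i; rewrite ltnS leq_eqVlt => /orP[/eqP->//|im]; apply: IH im => [k km|z|k l kl lm].
  - by apply: gX; exact: ltnW.
  - by have := H z; rewrite big_ord_recr /= Xm mul0r addr0.
  - by apply: nt => //; exact: ltnW.
have gm : good (X m) by exact: gXi.
have gum : good (u m) by exact: gui.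
have eX i : (i < m.+1)%N -> entire (X i) by move=> /gXi[].
have eu i : (i < m.+1)%N -> entire (u i) by move=> /gui[].
have dX i z : (i < m)%N -> forall j, X m z * pderiv j (X i) z - X i z * pderiv j (X m) z
     + X i z * X m z * (pderiv j (u i) z - pderiv j (u m) z) = 0.
  move=> im j.
  apply: (IH (fun i z => X m z * pderiv j (X i) z - X i z * pderiv j (X m) z
     + X i z * X m z * (pderiv j (u i) z - pderiv j (u m) z)) _ _ _ i im) => [k km|{}z|k l kl lm].
  - have km' := ltnW km; split; last exact: gui.
    apply: good_add.
      by apply: good_sub; apply: good_mul; [exact: gm|apply: good_pd; exact: gXi|exact: gXi|exact: good_pd].
    apply: good_mul; first by apply: good_mul; [exact: gXi|exact: gm].
    by apply: good_sub; apply: good_pd; [exact: gui|exact: gum].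
  - have dS : \sum_(i < m.+1) (pderiv j (X i) z + X i z * pderiv j (u i) z) * expC (u i z) = 0.
      transitivity (pderiv j (fun z => \sum_(i < m.+1) X i z * expC (u i z)) z); last first.
        by rewrite (_ : (fun z => _) = fun=> 0) ?pd_cst//; apply/funext => x; exact: H.
      rewrite pd_sum => [|k]; last by apply: ent_mul; [exact: eX|apply: ent_exp; exact: eu].
      apply: eq_bigr => k _; have ek := eX k (ltn_ord k); have uk := eu k (ltn_ord k).
      rewrite (pd_mul j z ek (ent_exp uk)) (pd_exp j z uk).
      by rewrite mulrDl -mulrA [expC _ * _]mulrC.
    exact: (@elim_last m (fun k => X k z) (fun k => pderiv j (X k) z) (fun k => pderiv j (u k) z)
      (fun k => expC (u k z)) (H z) dS).
  - by apply: nt => //; exact: ltnW.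
have Xi0 i z : (i < m)%N -> X i z = 0.
  move=> im; have im' := ltnW im; apply/eqP/negPn/negP => Xiz; apply: (nt i m im (ltnSn m)).
  pose Y z := X i z * expC (u i z - u m z); pose k := Y z0 / X m z0.
  have eY : entire Y by apply: ent_mul; [exact: eX|apply: ent_exp; apply: ent_sub; exact: eu].
  have YX (x : E) : Y x = k * X m x.
    pose h w := Y (z0 + w *: (x - z0)) - k * X m (z0 + w *: (x - z0)).
    have exm := eX _ (ltnSn m).
    have dY j y : X m y * pderiv j Y y = Y y * pderiv j (X m) y.
      have ed : entire (fun z => u i z - u m z) by apply: ent_sub; exact: eu.
      rewrite /Y (pd_mul j y (eX i im') (ent_exp ed)) (pd_exp j y ed).
      have -> : pderiv j (fun z => u i z - u m z) y = pderiv j (u i) y - pderiv j (u m) y.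
        rewrite (_ : (fun z => _) = fun z => u i z + -1 * u m z); last by apply/funext => t; rewrite mulN1r.
        by rewrite (pd_add j y (eu i im') (ent_scale (-1) (eu m (ltnSn m)))) (pd_scale j (-1) y (eu m (ltnSn m))) mulN1r.
      have alg (xm di e xi du c : C) : xm * di - xi * c + xi * xm * du = 0 ->
          xm * (di * e + xi * (e * du)) = xi * e * c.
        move=> h0; apply/eqP; rewrite -subr_eq0; apply/eqP; rewrite -[RHS](mulr0 e) -h0; ring.
      by apply: alg; exact: dX.
    have ch w : cdiff h w (dird Y (x - z0) (z0 + w *: (x - z0)) - k * dird (X m) (x - z0) (z0 + w *: (x - z0))).
      by apply: cdiffB; [exact: line_cdiff|apply: cdiffZ; exact: line_cdiff].
    have := @wronskian1 (fun w => X m (z0 + w *: (x - z0))) h (ent1_line _ _ exm) _ _ _ _ 1.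
    rewrite /h scale0r addr0 scale1r [z0 + _]addrC subrK => W1.
    apply/eqP; rewrite -subr_eq0; apply/eqP; apply: W1 => //.
    - by move=> w; eexists; exact: ch.
    - by rewrite /k divfK// subrr.
    - move=> w; rewrite (cderE (ch w)) (cderE (line_cdiff _ _ _ exm)) mulrBr mulrBl.
      have alg2 (t p y : C) : y * p - t * (k * p) = y * p - k * t * p by ring.
      have -> : X m (z0 + w *: (x - z0)) * dird Y (x - z0) (z0 + w *: (x - z0)) =
          Y (z0 + w *: (x - z0)) * dird (X m) (x - z0) (z0 + w *: (x - z0)).
        by rewrite /dird /lform !mulr_sumr; apply: eq_bigr => j _; rewrite mulrCA dY mulrCA.
      exact: alg2.
  have eui : entire (fun z => u i z - u m z) by apply: ent_sub; exact: eu.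
  apply: (gtame_quotient eui (N := fun z => k * X m z) (X := X i)).
  - by apply: good_mul => //; exact: good_cst.
  - exact: gXi.
  - by move=> x; rewrite -YX /Y mulrC.
  - by exists z.
exfalso; have := H z0; rewrite big_ord_recr /= big1 ?add0r => [/eqP|i _]; last by rewrite Xi0 ?mul0r.
by rewrite mulf_eq0 (negbTE Xm) (negbTE (expC_neq0 _)).
Qed.

Lemma ln_le1 (x : R) : 0 < x -> ln x <= x - 1.
Proof. by move=> x0; have := expR_ge1Dx (ln x); rewrite lnK ?posrE//; lra. Qed.

(* If [y k ^ 2 <= G B^k (y k.+1)] and [y] is bounded, then [S k = y k / (G B^(k+1))] satisfies
   [S k ^ 2 <= S k.+1], so that [S 0 > 1] would make [S] unbounded. *)
Lemma square_iteration (y : nat -> R) (G B Y : R) : 1 <= G -> 1 <= B -> (forall k, 0 <= y k <= Y) ->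
  (forall k, y k ^+ 2 <= G * B ^+ k * y k.+1) -> y 0 <= G * B.
Proof.
move=> G1 B1 yY H; have G0 : 0 < G by lra.
have B0 : 0 < B by lra.
pose S k := y k / (G * B ^+ k.+1).
have P k : 0 < G * B ^+ k.+1 by rewrite mulr_gt0// exprn_gt0.
have SS k : S k ^+ 2 <= S k.+1.
  rewrite /S expr_div_n ler_pdivrMr ?exprn_gt0// mulrAC ler_pdivlMr//.
  have -> : y k.+1 * (G * B ^+ k.+1) ^+ 2 = (G * B ^+ k * y k.+1) * (G * B ^+ k.+2).
    by rewrite !exprS; ring.
  by rewrite ler_pM2r.
have SY k : S k <= Y.
  have /andP[y0 yk] := yY k; rewrite /S ler_pdivrMr//.
  have : 1 <= G * B ^+ k.+1 by have := exprn_ege1 k.+1 B1; nra.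
  by nra.
suff : S 0 <= 1 by rewrite /S ler_pdivrMr// mul1r expr1.
rewrite leNgt; apply/negP => S1; pose dl := S 0 - 1; have dl0 : 0 < dl by rewrite /dl; lra.
have L k : 1 + k.+1%:R * dl <= S k.
  elim: k => [|k IH]; first by rewrite mul1r /dl; lra.
  apply: le_trans (SS k); rewrite -[k.+2]addn1 natrD; have : 1 <= k.+1%:R :> R by rewrite ler1n.
  move=> t1; have : (1 + k.+1%:R * dl) ^+ 2 <= S k ^+ 2.
    have tp : 0 <= k.+1%:R * dl by nra.
    by rewrite lerXn2r ?nnegrE//; lra.
  have tdl : dl <= k.+1%:R * dl by nra.
  by move/(le_trans _); apply; rewrite mulrDl mul1r; move: tdl; set p := k.+1%:R * dl; nra.
have := archi_boundP (ltac:(by rewrite divr_ge0// ?(ltW dl0)//; have := yY 0%N; lra) : 0 <= Y / dl).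
set k := Num.bound _; rewrite ltr_pdivrMr// => h.
by have := L k; have := SY k; rewrite -natr1; nra.
Qed.

Lemma tame_Msup a : tame a al -> tame a be -> exists K q, 0 <= K /\
  forall r x, 1 <= r -> 1 <= x -> Msup a r <= K * Vw a r x q.
Proof.
move=> [K [q [K0 H]]] [K' [q' [K'0 H']]]; exists (K + K'), (q + q')%N; split; first lra.
move=> r x r1 x1; apply: Msup_le => [|z zr]; first lra.
rewrite mulrDl; apply: lerD.
  by apply: le_trans (H r x z r1 x1 zr) _; rewrite ler_wpM2l// Vw_mono// leq_addr.
by apply: le_trans (H' r x z r1 x1 zr) _; rewrite ler_wpM2l// Vw_mono// leq_addl.
Qed.

(** The radii [r0 (2 - 2^-k)] increase by [r0 2^-(k+1)], which a loss with [x = 4 * 2^k] allows, and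
    stay below [2 r0]. The costs [x^q] grow geometrically in [k], as [square_iteration] permits. *)
Lemma tame_log a : tame a al -> tame a be -> exists D, 0 <= D /\
  forall r, 1 <= r -> Msup a r <= D * (2 + ln r) ^+ 2.
Proof.
move=> ta tb; have [K [q [K0 H]]] := tame_Msup ta tb.
pose C0 := 2 + 3 * K * 4 ^+ q; pose B : R := 2 ^+ q.
have B1 : 1 <= B by rewrite exprn_ege1//; lra.
have q4 : 0 <= (4 : R) ^+ q by rewrite exprn_ge0.
have C2 : 2 <= C0 by rewrite /C0 lerDl !mulr_ge0.
exists ((C0 * B) ^+ 2); split; first by rewrite sqr_ge0.
move=> r0 r01; have [_ l0 _] := W_parts a r01; pose l := 2 + ln r0.
have l2 : 2 <= l by rewrite /l; lra.
pose rr k := r0 * (2 - hp R k).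
have rr1 k : 1 <= rr k by rewrite /rr; have := hp_le1 R k; nra.
have rr2 k : rr k <= 2 * r0 by rewrite /rr; have := hp_gt0 R k; nra.
(* The square root turns the logarithm into a linear bound: [ln (2 + Msup) = 2 ln y <= 2 y], so that
   [y k ^+ 2] is compared with [y k.+1]. *)
pose y k := Num.sqrt (2 + Msup a (rr k)).
have T2 k : 2 <= 2 + Msup a (rr k) by rewrite lerDl Msup_ge0//; have := rr1 k; lra.
have y1 k : 1 <= y k by rewrite -(@sqrtr1 R) /y ler_wsqrtr//; have := T2 k; lra.
have ysq k : y k ^+ 2 = 2 + Msup a (rr k) by rewrite sqr_sqrtr//; have := T2 k; lra.
have yb : y 0 <= C0 * l * B.
  apply: (@square_iteration y _ _ (Num.sqrt (2 + Msup a (2 * r0)))) => //; first by nra.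
    move=> k; rewrite (le_trans ler01 (y1 k)) /=; apply: ler_wsqrtr; rewrite lerD2l.
    by apply: Msup_mono => //; have := rr1 k; lra.
  move=> k; have h0 := hp_gt0 R k; have x1 : 1 <= 4 * 2 ^+ k :> R.
    have : 1 <= (2 : R) ^+ k by rewrite exprn_ege1//; lra.
    by lra.
  rewrite ysq; have := H (rr k) (4 * 2 ^+ k) (rr1 k) x1; rewrite /Vw.
  have xi : (4 * 2 ^+ k)^-1 = hp R k / 4 :> R by rewrite /hp invfM exprVn mulrC.
  have sr : rr k * (1 + (4 * 2 ^+ k)^-1) <= rr k.+1.
    have rE : rr k.+1 = rr k + 2 * r0 * (hp R k / 4) by rewrite /rr hpS; field.
    by rewrite xi rE mulrDr mulr1 lerD2l ler_wpM2r//; lra.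
  have s1 : 1 <= rr k * (1 + (4 * 2 ^+ k)^-1) by rewrite xi; have := rr1 k; nra.
  have := W_mono a s1 sr; set w := W a _; move=> ww.
  have Wl : W a (rr k.+1) <= 3 * (l * y k.+1).
    rewrite /W; have -> : ln (2 + Msup a (rr k.+1)) = 2 * ln (y k.+1).
      by rewrite -ysq lnXn ?mulr_natl//; have := y1 k.+1; lra.
    have yk := y1 k.+1; have := ln_le1 (ltac:(lra) : 0 < y k.+1).
    have : ln (rr k.+1) <= ln r0 + 1.
      apply: (@le_trans _ _ (ln (2 * r0))); first by rewrite ler_ln ?posrE//; have := rr1 k.+1; lra.
      rewrite lnM ?posrE; [|lra|lra]; have := ln_le1 (ltac:(lra) : 0 < (2 : R)); lra.
    move=> i1 i2; have lE : ln r0 = l - 2 by rewrite /l; ring.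
    have i3 : y k.+1 <= l * y k.+1 by nra.
    have i4 : l <= l * y k.+1 by nra.
    by rewrite lE in i1; lra.
  have bk : 1 <= B ^+ k by rewrite exprn_ege1.
  have -> : (4 * 2 ^+ k) ^+ q = 4 ^+ q * B ^+ k by rewrite exprMn /B -!exprM mulnC.
  move=> h; apply: (@le_trans _ _ (2 + K * (4 ^+ q * B ^+ k * (3 * (l * y k.+1))))).
    rewrite lerD2l; apply: le_trans h _; rewrite ler_wpM2l// ler_wpM2l//; last exact: le_trans ww Wl.
    by rewrite mulr_ge0//; lra.
  have -> : C0 * l * B ^+ k * y k.+1 = 2 * (l * B ^+ k * y k.+1) + K * (4 ^+ q * B ^+ k * (3 * (l * y k.+1))).
    by rewrite /C0; ring.
  rewrite lerD2r; have := y1 k.+1 => yk.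
  have : 1 <= l * B ^+ k by nra.
  by nra.
have r00 : rr 0 = r0 by rewrite /rr hp0; lra.
have := ysq 0; rewrite r00 => Te; have y00 := y1 0%N.
have : y 0 ^+ 2 <= (C0 * l * B) ^+ 2 by rewrite lerXn2r ?nnegrE//; nra.
by rewrite Te -/l (_ : (C0 * l * B) ^+ 2 = (C0 * B) ^+ 2 * l ^+ 2); [lra|ring].
Qed.

(** Liouville's argument. The radius is written [x^4], because [ln x <= x - 1] then gives
    [(2 + ln (x^4))^2 <= 16 x^2]. *)
Lemma log_growth_cst f D a : entire f -> (forall r z, 1 <= r -> nv (z - a) <= r -> nm (f z) <= D * (2 + ln r) ^+ 2) ->
  forall z, f z = f a.
Proof.
move=> ef H z; pose s := 1 + nv (z - a); have s0 : 0 < s by have := nv_ge0 (z - a); rewrite /s; lra.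
pose v := rc s^-1 *: (z - a); have zE : z = a + rc s *: v.
  by rewrite /v scalerA -rmorphM /= divff ?gt_eqF// scale1r addrC subrK.
have v1 : nv v <= 1.
  rewrite nvZ nm_rc gtr0_norm ?invr_gt0// mulrC ler_pdivrMr// mul1r /s; lra.
pose phi w := f (a + w *: v); have ephi : ent1 phi := ent1_line a v ef.
have T k : tc phi k.+1 = 0.
  have D0 : 0 <= D.
    have := H 1 a (lexx _) _; rewrite subrr nv0 ln1 addr0 => /(_ ltac:(lra)) h.
    by have := nm_ge0 (f a); lra.
  have t0 := nm_ge0 (tc phi k.+1).
  have B x : 1 <= x -> nm (tc phi k.+1) * x <= 16 * D.
    move=> x1; have x4 : 1 <= x ^+ 4 by rewrite exprn_ege1.
    have x40 : 0 < x ^+ 4 by lra.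
    have := @tc_le R phi (x ^+ 4) (D * (2 + ln (x ^+ 4)) ^+ 2) k.+1 x40 ephi.
    have hh : forall w, nm w = x ^+ 4 -> nm (phi w) <= D * (2 + ln (x ^+ 4)) ^+ 2.
      by move=> w wr; apply: H => //; rewrite addrC addKr nvZ wr; have := nv_ge0 v; nra.
    move=> /(_ hh); rewrite lnXn; last by lra.
    have lx := ln_le1 (ltac:(lra) : 0 < x); have l0 : 0 <= ln x by apply: ln_ge0.
    have e1 : x ^+ 4 <= (x ^+ 4) ^+ k.+1 by rewrite [leRHS]exprS -[leLHS]mulr1 ler_wpM2l ?exprn_ege1//; lra.
    have e2 : D * (2 + ln x *+ 4) ^+ 2 <= 16 * D * x ^+ 2.
      have -> : 16 * D * x ^+ 2 = D * (4 * x) ^+ 2 by ring.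
      rewrite ler_wpM2l// lerXn2r ?nnegrE//; [lra|lra|lra].
    have x2 : 1 <= x ^+ 2 by rewrite exprn_ege1.
    move=> h; have : nm (tc phi k.+1) * x ^+ 4 <= 16 * D * x ^+ 2.
      by apply: le_trans (le_trans h e2); rewrite ler_wpM2l.
    have -> : x ^+ 4 = x ^+ 2 * x ^+ 2 by ring.
    rewrite mulrA ler_pM2r; last by lra.
    by apply: le_trans; rewrite ler_wpM2l//; nra.
  apply/eqP; rewrite -nm_eq0; apply/negPn/negP => tn; have tp : 0 < nm (tc phi k.+1) by rewrite lt_def tn.
  have := B (1 + 16 * D / nm (tc phi k.+1)).
  rewrite mulrDr mulr1 [_ * (_ / _)]mulrC divfK// => h.
  have : 1 <= 1 + 16 * D / nm (tc phi k.+1) by rewrite lerDl divr_ge0//; lra.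
  by move=> /h; lra.
have dq0 : forall w, dq phi w = 0.
  by apply: tc_zero => [|k]; [exact: dq_ent|rewrite -tcS].
have := dqE phi (rc s); rewrite dq0 mulr0 addr0 /phi scale0r addr0 => <-.
by rewrite -zE.
Qed.

Lemma tame_cst : gtame al -> gtame be -> (exists k, forall z, al z = k) /\ (exists k, forall z, be z = k).
Proof.
move=> ga gb; have [a [ta tb]] := gen_ex (gen_and ga gb); have [D [D0 H]] := tame_log ta tb.
have B r z : 1 <= r -> nv (z - a) <= r -> nm (al z) + nm (be z) <= D * (2 + ln r) ^+ 2.
  by move=> r1 zr; apply: le_trans (Msup_ge zr) (H r r1).
split; [exists (al a)|exists (be a)]; apply: (@log_growth_cst _ D) => // r z r1 zr;
  have := B r z r1 zr; have := nm_ge0 (al z); have := nm_ge0 (be z); lra.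
Qed.

End Slow.

(** The comparison function is built from [d] itself, with [al = d] and [be = 0]: polynomials are
    slow, so [d] is tame, and tame exponents are constant. *)
Lemma poly_exp_cst (R : realType) (n : nat) (d P Q : 'rV[R[i]]_n -> R[i]) : entire d ->
  polynomial_fun P -> polynomial_fun Q -> (forall z, P z = expC (d z) * Q z) -> (exists z, Q z != 0) ->
  exists k, forall z, d z = k.
Proof.
move=> ed pP pQ PQ Q0; have e0 : entire (fun _ : 'rV[R[i]]_n => 0 : R[i]) by exact: ent_cst.
have gd : gtame d (fun=> 0) d.
  by apply: (gtame_quotient ed _ ed (good_pf _ _ pP) (good_pf _ _ pQ)).
have g0 : gtame d (fun=> 0) (fun=> 0).
  by apply: gen_all => a; exists 0, 0%N; split=> // r x z _ _ _; rewrite mul0r nm0.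
by case: (tame_cst ed e0 gd g0).
Qed.

(** * The exponential identity *)

Section Analysis.
Variables (R : realType) (n : nat).
Local Notation C := R[i].
Local Notation E := 'rV[C]_n.
Implicit Types (f g h : E -> C).

Definition zerof f := forall z, f z = 0.

Lemma nzerof f : ~ zerof f -> exists z, f z != 0.
Proof. by move=> /existsNP[z /eqP hz]; exists z. Qed.

(** The product [y = m1 m2 l] solves the monic equation [y^2 = d - b y] with polynomials [b] and
    [d], so it grows polynomially; [division] removes [m1 m2]. *)
Lemma quad_poly (m1 m2 n1 n2 Q l : E -> C) : polynomial_fun m1 -> polynomial_fun m2 ->
  polynomial_fun n1 -> polynomial_fun n2 -> polynomial_fun Q -> entire l ->
  ~ zerof m1 -> ~ zerof m2 -> (forall z, (m1 z * l z + n1 z) * (m2 z * l z + n2 z) = Q z) ->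
  polynomial_fun l.
Proof.
move=> p1 p2 q1 q2 pQ el /nzerof z1 /nzerof z2 H.
have pm : polynomial_fun (fun z => m1 z * m2 z) by exact: pf_mul.
apply: (division pm) => //; first exact: (ent_mul_neq0 (pf_ent p1) (pf_ent p2)).
pose b z := n1 z * m2 z + n2 z * m1 z; pose d z := m1 z * m2 z * (Q z - n1 z * n2 z).
have pb : polynomial_fun b by apply: pf_add; exact: pf_mul.
have pd : polynomial_fun d by apply: pf_mul => //; apply: pf_sub => //; exact: pf_mul.
have [A [k [A0 HA]]] := pgrowth_pos (pf_growth pb); have [B [j [B0 HB]]] := pgrowth_pos (pf_growth pd).
exists (A + B + 1), (k + j)%N => z; set y := m1 z * m2 z * l z.
have yE : y ^+ 2 = d z - b z * y by rewrite /y /d /b -H; ring.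
have z1' : 1 <= 1 + nv z by have := nv_ge0 z; lra.
have X1 i : 1 <= (1 + nv z) ^+ i by rewrite exprn_ege1.
have y0 := nm_ge0 y; have yb : nm y <= nm (b z) + nm (d z) + 1.
  have : nm y ^+ 2 <= nm (d z) + nm (b z) * nm y by rewrite -nmX yE -nmM; exact: nmB.
  by have := nm_ge0 (b z); have := nm_ge0 (d z); nra.
apply: le_trans yb _; rewrite !mulrDl mul1r; apply: lerD; last exact: X1.
apply: lerD.
  by apply: le_trans (HA z) _; rewrite ler_wpM2l// ler_weXn2l// leq_addr.
by apply: le_trans (HB z) _; rewrite ler_wpM2l// ler_weXn2l// leq_addl.
Qed.

Variables (al be : E -> C) (eal : entire al) (ebe : entire be).
Local Notation G := (good al be).
Local Notation T := (gtame al be).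

Lemma gtame_scale c d : T d -> T (fun z => c * d z).
Proof. by apply: gen_imp => a; exact: tame_scale. Qed.

Lemma gtame_eq c f g : T f -> (forall z, g z = c * f z) -> T g.
Proof. by move=> /(gtame_scale c) h fg; rewrite (_ : g = fun z => c * f z)//; apply/funext. Qed.

Lemma borel_tame (s : seq ((E -> C) * (E -> C))) : (forall t, List.In t s -> G t.1 /\ G t.2) ->
  (forall z, \sum_(t <- s) t.1 z * expC (t.2 z) = 0) ->
  (forall t, List.In t s -> zerof t.1) \/
  exists i j, (i < j < size s)%N /\
    T (fun z => (nth (fun=> 0, fun=> 0) s i).2 z - (nth (fun=> 0, fun=> 0) s j).2 z).
Proof.
move=> gs H; pose t0 : (E -> C) * (E -> C) := (fun=> 0, fun=> 0).
have [h|h] := pselect (exists i j, (i < j < size s)%N /\ T (fun z => (nth t0 s i).2 z - (nth t0 s j).2 z)).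
  by right.
have nthIn (l : seq ((E -> C) * (E -> C))) i : (i < size l)%N -> List.In (nth t0 l i) l.
  by elim: l i => [//|x l IH] [|i] /=; [left|rewrite ltnS => /IH; right].
have Innth (l : seq ((E -> C) * (E -> C))) t : List.In t l -> exists2 i, (i < size l)%N & t = nth t0 l i.
  elim: l => [//|x l IH] /= [->|/IH[i il ->]]; [by exists 0%N|by exists i.+1].
left=> t /Innth[i il ->]; apply: (borel eal ebe (m := size s) (X := fun i => (nth t0 s i).1) (u := fun i => (nth t0 s i).2)) il.
- by move=> k /nthIn/gs.
- by move=> z; rewrite -[RHS](H z) (big_nth t0) big_mkord.
- by move=> k j kj jl ht; apply: h; exists k, j; rewrite kj jl.
Qed.

(** In the application [l] is [L] of the shifted [g], and [m1], [m2], [P], [S] are non-zero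
    multiples of [a1], [a2], [b1], [b2] (the first two shifted). The hypotheses [mP], [mS], [PS]
    then express [D != 0]. *)
Variables (m1 m2 n1 n2 P S l : E -> C).
Variables (pm1 : polynomial_fun m1) (pm2 : polynomial_fun m2) (pn1 : polynomial_fun n1).
Variables (pn2 : polynomial_fun n2) (pP : polynomial_fun P) (pS : polynomial_fun S).
Variables (gl : G l).
Variables (mn1 : zerof m1 -> zerof n1) (mn2 : zerof m2 -> zerof n2).
Variables (mP : ~ (zerof m1 /\ zerof P)) (mS : ~ (zerof m2 /\ zerof S)) (PS : ~ (zerof P /\ zerof S)).

Let A z := m1 z * l z + n1 z.
Let B z := m2 z * l z + n2 z.

Variable main_eq : forall z, A z * expC (al z) + B z * expC (- al z) + P z * expC (be z)
  + S z * expC (- be z) = 0.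

Lemma goodA : G A.
Proof. exact: (good_add eal ebe (good_mul eal ebe (good_pf eal ebe pm1) gl) (good_pf eal ebe pn1)). Qed.
Lemma goodB : G B.
Proof. exact: (good_add eal ebe (good_mul eal ebe (good_pf eal ebe pm2) gl) (good_pf eal ebe pn2)). Qed.
Lemma good_al : G al. Proof. by case: (good_base eal ebe). Qed.
Lemma good_be : G be. Proof. by case: (good_base eal ebe). Qed.
Lemma goodN f : G f -> G (fun z => - f z).
Proof.
move=> gf; rewrite (_ : (fun z => - f z) = fun z => -1 * f z); last by apply/funext => z; rewrite mulN1r.
exact: (good_mul eal ebe (good_cst eal ebe _) gf).
Qed.
Lemma good_exp d : entire d -> T d -> G (fun z => expC (d z)) /\ G (fun z => expC (- d z)).
Proof.
move=> ed td; split; apply: good_expC => //; first exact: ent_opp.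
by apply: (gtame_eq (c := -1) td) => z; rewrite mulN1r.
Qed.

Lemma tame_both : T al -> T be -> exists k, forall z, be z = k.
Proof. by move=> ta tb; case: (tame_cst eal ebe ta tb). Qed.

(** The two terms in [al] merge into one slow coefficient with exponent [0]. Among [0], [be] and
    [- be] every tame difference makes [be] tame. *)
Lemma case_al : T al -> exists k, forall z, be z = k.
Proof.
move=> ta; apply: tame_both => //; have [gE gE'] := good_exp eal ta.
pose X z := A z * expC (al z) + B z * expC (- al z).
have gX : G X := good_add eal ebe (good_mul eal ebe goodA gE) (good_mul eal ebe goodB gE').
have [|z|h|[i [j [/andP[ij]]]]] := @borel_tame [:: (X, fun=> 0); (P, be); (S, fun z => - be z)].
- move=> t /= [<-|[<-|[<-|//]]] /=; split.
  + exact: gX. + exact: (good_cst eal ebe). + exact: (good_pf eal ebe). + exact: good_be. + exact: (good_pf eal ebe).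
  + by apply: goodN; exact: good_be.
- by rewrite !big_cons big_nil /= expC0 mulr1 addr0 addrA /X -(main_eq z).
- exfalso; apply: PS; split; [apply: (h (P, be))|apply: (h (S, fun z => - be z))] => /=; tauto.
- case: j ij => [//|[|[|//]]]; case: i => [|[|//]]//= _ _ tb.
  + by apply: (gtame_eq (c := -1) tb) => z; rewrite sub0r mulN1r opprK.
  + by apply: (gtame_eq (c := 1) tb) => z; rewrite sub0r mul1r opprK.
  + by apply: (gtame_eq (c := 2^-1) tb) => z; rewrite opprK; field.
Qed.

(** Unlike in [case_al], all coefficients may vanish; then [S = - e^(2 be) P] with polynomials [P]
    and [S], and [be] is constant by [poly_exp_cst]. *)
Lemma case_be : T be -> exists k, forall z, be z = k.
Proof.
move=> tb; have [gE gE'] := good_exp ebe tb.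
pose Y z := P z * expC (be z) + S z * expC (- be z).
have gY : G Y := good_add eal ebe (good_mul eal ebe (good_pf eal ebe pP) gE) (good_mul eal ebe (good_pf eal ebe pS) gE').
have [|z|h|[i [j [/andP[ij]]]]] := @borel_tame [:: (A, al); (B, fun z => - al z); (Y, fun=> 0)].
- move=> t /= [<-|[<-|[<-|//]]] /=; split.
  + exact: goodA. + exact: good_al. + exact: goodB. + by apply: goodN; exact: good_al.
  + exact: gY. + exact: (good_cst eal ebe).
- by rewrite !big_cons big_nil /= expC0 mulr1 addr0 /Y -(main_eq z) !addrA.
- have Y0 : zerof Y by apply: (h (Y, fun=> 0)) => /=; tauto.
  have SP z : S z = expC (2 * be z) * - P z.
    have := Y0 z; rewrite /Y expCN => /eqP; rewrite addr_eq0 => /eqP h0.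
    have -> : S z = - (P z * expC (be z)) * expC (be z) by rewrite h0 opprK divfK ?expC_neq0.
    have -> : 2 * be z = be z + be z by ring.
    by rewrite expCD; ring.
  have [|||z||k hk] := @poly_exp_cst R n (fun z => 2 * be z) S (fun z => - P z).
  + exact: ent_scale. + exact: pS. + exact: pf_opp. + exact: SP.
  + have [z hz] : exists z, P z != 0.
      apply: nzerof => P0; apply: PS; split=> // z; by rewrite SP P0 oppr0 mulr0.
    by exists z; rewrite oppr_eq0.
  + by exists (2^-1 * k) => z; rewrite -(hk z) mulrA mulVf ?mul1r// pnatr_eq0.
- case: j ij => [//|[|[|//]]]; case: i => [|[|//]]//= _ _ ta; apply: case_al.
  + by apply: (gtame_eq (c := 2^-1) ta) => z; rewrite opprK; field.
  + by apply: (gtame_eq (c := 1) ta) => z; rewrite subr0 mul1r.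
  + by apply: (gtame_eq (c := -1) ta) => z; rewrite subr0 mulN1r opprK.
Qed.

Lemma case_two (X Y : E -> C) : ~ T be -> G X -> G Y ->
  (forall z, X z * expC (be z) + Y z * expC (- be z) = 0) -> zerof X /\ zerof Y.
Proof.
move=> nb gX gY H.
have [|z|h|[i [j [/andP[ij]]]]] := @borel_tame [:: (X, be); (Y, fun z => - be z)].
- move=> t /= [<-|[<-|//]] /=; split=> //; first exact: good_be.
  by apply: goodN; exact: good_be.
- by rewrite !big_cons big_nil /= addr0 H.
- by split; [apply: (h (X, be))|apply: (h (Y, fun z => - be z))] => /=; tauto.
- case: j ij => [//|[|//]]; case: i => [|//]//= _ _ tb; exfalso; apply: nb.
  by apply: (gtame_eq (c := 2^-1) tb) => z; rewrite opprK; field.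
Qed.

Lemma pfA : polynomial_fun l -> polynomial_fun A.
Proof. by move=> pl; apply: pf_add => //; exact: pf_mul. Qed.
Lemma pfB : polynomial_fun l -> polynomial_fun B.
Proof. by move=> pl; apply: pf_add => //; exact: pf_mul. Qed.

Lemma zeroA : zerof m1 -> zerof A.
Proof. by move=> m0 z; rewrite /A m0 (mn1 m0) mul0r addr0. Qed.
Lemma zeroB : zerof m2 -> zerof B.
Proof. by move=> m0 z; rewrite /B m0 (mn2 m0) mul0r addr0. Qed.

Lemma exp_split (X Y d : E -> C) : polynomial_fun X -> polynomial_fun Y -> entire d ->
  (forall z, X z = - (expC (d z) * Y z)) -> ~ zerof X -> exists k, forall z, d z = k.
Proof.
move=> pX pY ed H nX; apply: (poly_exp_cst ed pX (pf_opp pY)) => [z|]; first by rewrite mulrN H.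
have [z hz] := nzerof nX; exists z; apply: contraNneq hz => /eqP; rewrite oppr_eq0 => /eqP Y0.
by rewrite H Y0 mulr0 oppr0.
Qed.

(** The coefficients of [e^be] and [e^(-be)] vanish, so [A] and [P], and likewise [B] and [S],
    differ by exponential factors that are inverse to each other. Hence [A B = P S], a quadratic
    equation that makes [l] polynomial; then [e^(be - al)] is a quotient of polynomials. *)
Lemma case_sub : ~ T be -> T (fun z => al z - be z) -> polynomial_fun l /\
  exists k, (forall z, be z - al z = k) /\ (forall z, A z = - (expC k * P z)).
Proof.
move=> nb td; have ed : entire (fun z => al z - be z) by exact: ent_sub.
have [gE gE'] := good_exp ed td.
have [||z|X0 Y0] := @case_two (fun z => A z * expC (al z - be z) + P z)
    (fun z => B z * expC (- (al z - be z)) + S z) nb.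
- exact: (good_add eal ebe (good_mul eal ebe goodA gE) (good_pf eal ebe pP)).
- exact: (good_add eal ebe (good_mul eal ebe goodB gE') (good_pf eal ebe pS)).
- have e1 : expC (al z - be z) * expC (be z) = expC (al z) by rewrite -expCD subrK.
  have e2 : expC (- (al z - be z)) * expC (- be z) = expC (- al z).
    by rewrite -expCD; congr expC; ring.
  by rewrite -[RHS](main_eq z) -e1 -e2; ring.
have AE z : A z = - (expC (be z - al z) * P z).
  have /eqP := X0 z; rewrite addr_eq0 => /eqP/(congr1 (fun x => x * expC (be z - al z))).
  by rewrite -mulrA -expCD addrA subrK subrr expC0 mulr1 mulNr mulrC.
have BE z : B z = - (expC (al z - be z) * S z).
  have /eqP := Y0 z; rewrite addr_eq0 => /eqP/(congr1 (fun x => x * expC (al z - be z))).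
  by rewrite -mulrA -expCD addNr expC0 mulr1 mulNr mulrC.
have pl : polynomial_fun l.
  apply: (quad_poly (Q := fun z => P z * S z) pm1 pm2 pn1 pn2); first exact: pf_mul.
  - by case: gl.
  - move=> m0; apply: mP; split=> // z; have := zeroA m0 z; rewrite AE => /eqP.
    by rewrite oppr_eq0 mulf_eq0 (negbTE (expC_neq0 _)) => /eqP.
  - move=> m0; apply: mS; split=> // z; have := zeroB m0 z; rewrite BE => /eqP.
    by rewrite oppr_eq0 mulf_eq0 (negbTE (expC_neq0 _)) => /eqP.
  - move=> z; rewrite -/(A z) -/(B z) AE BE mulrNN mulrACA -expCD addrA subrK subrr expC0 mul1r//.
split=> //; have [P0|nP] := pselect (zerof P).
  have nB : ~ zerof B.
    move=> B0; apply: PS; split=> // z; have := B0 z; rewrite BE => /eqP.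
    by rewrite oppr_eq0 mulf_eq0 (negbTE (expC_neq0 _)) => /eqP.
  have [k hk] := exp_split (pfB pl) pS ed BE nB; exists (- k); split=> z; first by rewrite -(hk z) opprB.
  by rewrite AE P0 !mulr0.
have nA : ~ zerof A.
  move=> A0; apply: nP => z; have := A0 z; rewrite AE => /eqP.
  by rewrite oppr_eq0 mulf_eq0 (negbTE (expC_neq0 _)) => /eqP.
have [k hk] := exp_split (pfA pl) pP (ent_sub ebe eal) AE nA.
by exists k; split=> // z; rewrite AE hk.
Qed.

(** Now [A] is paired with [S] and [B] with [P]. Again [A B = P S], but [mP] and [mS] no longer
    exclude that [m1] or [m2] vanishes. In that event the equation says nothing about [l], and the
    transcendental case arises. *)
Lemma case_add : ~ T be -> T (fun z => al z + be z) ->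
  (polynomial_fun l /\ exists k, forall z, al z + be z = k) \/
  [/\ ~ polynomial_fun l, ~ (exists k, forall z, al z + be z = k) &
    (zerof m1 /\ zerof S) \/ (zerof m2 /\ zerof P)].
Proof.
move=> nb td; have ed : entire (fun z => al z + be z) by exact: ent_add.
have [gE gE'] := good_exp ed td.
have [||z|Y0 X0] := @case_two (fun z => B z * expC (- (al z + be z)) + P z)
    (fun z => A z * expC (al z + be z) + S z) nb.
- exact: (good_add eal ebe (good_mul eal ebe goodB gE') (good_pf eal ebe pP)).
- exact: (good_add eal ebe (good_mul eal ebe goodA gE) (good_pf eal ebe pS)).
- have e1 : expC (al z + be z) * expC (- be z) = expC (al z) by rewrite -expCD addrK.
  have e2 : expC (- (al z + be z)) * expC (be z) = expC (- al z).
    by rewrite -expCD; congr expC; ring.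
  by rewrite -[RHS](main_eq z) -e1 -e2; ring.
have SE z : S z = - (expC (al z + be z) * A z).
  by have /eqP := X0 z; rewrite addrC addr_eq0 mulrC => /eqP.
have PE z : P z = - (expC (- (al z + be z)) * B z).
  by have /eqP := Y0 z; rewrite addrC addr_eq0 mulrC => /eqP.
have eNd : entire (fun z => - (al z + be z)) by exact: ent_opp.
have cst1 : polynomial_fun l -> ~ zerof S -> exists k, forall z, al z + be z = k.
  by move=> pl; apply: exp_split pS (pfA pl) ed SE.
have cst2 : polynomial_fun l -> ~ zerof P -> exists k, forall z, al z + be z = k.
  move=> pl nP; have [k hk] := exp_split pP (pfB pl) eNd PE nP.
  by exists (- k) => z; rewrite -(hk z) opprK.
have [m10|m10] := pselect (zerof m1).
  have S0 : zerof S by move=> z; rewrite SE (zeroA m10) mulr0 oppr0.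
  have nP : ~ zerof P by move=> P0; apply: PS.
  have [pl|npl] := pselect (polynomial_fun l); first by left; split=> //; exact: cst2.
  right; split=> //; last by left.
  move=> [k hk]; apply: npl; apply: (division pm2); [|by case: gl|].
    by apply: nzerof => m20; apply: mS.
  apply: pf_growth; apply: (pf_ext (f := fun z => - expC k * P z - n2 z)) => [z|]; last first.
    by apply: pf_sub => //; exact: pf_scale.
  by rewrite PE hk expCN mulrNN mulrA mulfV ?expC_neq0// mul1r /B addrK.
have [m20|m20] := pselect (zerof m2).
  have P0 : zerof P by move=> z; rewrite PE (zeroB m20) mulr0 oppr0.
  have nS : ~ zerof S by move=> S0; apply: PS.
  have [pl|npl] := pselect (polynomial_fun l); first by left; split=> //; exact: cst1.
  right; split=> //; last by right.
  move=> [k hk]; apply: npl; apply: (division pm1); [exact: nzerof|by case: gl|].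
  apply: pf_growth; apply: (pf_ext (f := fun z => - (expC k)^-1 * S z - n1 z)) => [z|]; last first.
    by apply: pf_sub => //; exact: pf_scale.
  by rewrite SE hk mulrNN mulrA mulVf ?expC_neq0// mul1r /A addrK.
left; have pl : polynomial_fun l.
  apply: (quad_poly (Q := fun z => P z * S z) pm1 pm2 pn1 pn2) => //; first exact: pf_mul.
    by case: gl.
  move=> z; rewrite -/(A z) -/(B z) PE SE mulrNN mulrACA -expCD addNr expC0 mul1r mulrC//.
split=> //; have [P0|nP] := pselect (zerof P); last exact: cst2.
by apply: cst1 => // S0; apply: PS.
Qed.

Lemma exp_analysis :
  [\/ exists k, forall z, be z = k,
      polynomial_fun l /\
        exists k, (forall z, be z - al z = k) /\ (forall z, A z = - (expC k * P z)),
      polynomial_fun l /\ exists k, forall z, al z + be z = k |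
      [/\ ~ polynomial_fun l, ~ (exists k, forall z, al z + be z = k) &
        (zerof m1 /\ zerof S) \/ (zerof m2 /\ zerof P)]].
Proof.
have [ta|nta] := pselect (T al); first by constructor 1; exact: case_al.
have [tb|ntb] := pselect (T be); first by constructor 1; exact: case_be.
have [td|ntd] := pselect (T (fun z => al z - be z)); first by constructor 2; exact: case_sub.
have [ts|nts] := pselect (T (fun z => al z + be z)).
  by have [h|h] := case_add ntb ts; [constructor 3|constructor 4].
exfalso.
have [|z|h|[i [j [/andP[ij]]]]] := @borel_tame [:: (A, al); (B, fun z => - al z); (P, be); (S, fun z => - be z)].
- move=> t /= [<-|[<-|[<-|[<-|//]]]] /=; split.
  + exact: goodA. + exact: good_al. + exact: goodB. + by apply: goodN; exact: good_al.
  + exact: (good_pf eal ebe). + exact: good_be. + exact: (good_pf eal ebe). + by apply: goodN; exact: good_be.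
- by rewrite !big_cons big_nil /= addr0 !addrA main_eq.
- by apply: PS; split; [apply: (h (P, be))|apply: (h (S, fun z => - be z))] => /=; tauto.
(* Up to sign and a factor 2, the differences of the four exponents are [al], [be], [al - be] and
   [al + be]. *)
- case: j ij => [//|[|[|[|//]]]]; case: i => [|[|[|//]]]//= _ _ h.
  + by apply: nta; apply: (gtame_eq (c := 2^-1) h) => z; rewrite opprK; field.
  + by apply: nts; apply: (gtame_eq (c := -1) h) => z; rewrite mulN1r opprD !opprK.
  + by apply: nts; apply: (gtame_eq (c := 1) h) => z; rewrite mul1r opprK.
  + by apply: ntd; apply: (gtame_eq (c := -1) h) => z; rewrite mulN1r opprD !opprK.
  + by apply: ntb; apply: (gtame_eq (c := 2^-1) h) => z; rewrite opprK; field.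
Qed.

End Analysis.

(** * The operator [L] as a derivation *)

Section DiffOp.
Variables (R : realType) (n s : nat) (t : 'I_s -> 'I_n) (q : 'I_s -> mpoly n R[i]).
Local Notation C := R[i].
Local Notation E := 'rV[C]_n.
Local Notation L := (diffop t q).
Implicit Types (f g h : E -> C).

Lemma diffop_ent f : entire f -> entire (L f).
Proof.
by move=> ef; apply: ent_sum => l; apply: ent_mul; [apply: pf_ent; exact: pf_pfun|exact: ent_pd].
Qed.

Lemma diffop_pf f : polynomial_fun f -> polynomial_fun (L f).
Proof. by move=> pf; apply: pf_sum => l; apply: pf_mul; [exact: pf_pfun|exact: pf_pd]. Qed.

Lemma diffop_good al be f : entire al -> entire be -> good al be f -> good al be (L f).
Proof.
move=> eal ebe gf; rewrite /diffop.
have gs (r : seq 'I_s) : good al be (fun z => \sum_(l <- r) pfun (q l) z * pderiv (t l) f z).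
  elim: r => [|l r IH].
    rewrite (_ : (fun z => _) = fun=> 0); first exact: (good_cst eal ebe).
    by apply/funext => z; rewrite big_nil.
  rewrite (_ : (fun z => _) = fun z => pfun (q l) z * pderiv (t l) f z
      + \sum_(l <- r) pfun (q l) z * pderiv (t l) f z); last by apply/funext => z; rewrite big_cons.
  exact: (good_add eal ebe (good_mul eal ebe (good_pf eal ebe (pf_pfun (q l))) (good_pd eal ebe (t l) gf)) IH).
exact: gs.
Qed.

Lemma diffop_add f g z : entire f -> entire g -> L (fun z => f z + g z) z = L f z + L g z.
Proof.
move=> ef eg; rewrite /diffop -big_split; apply: eq_bigr => l _.
by rewrite (pd_add _ _ ef eg) mulrDr.
Qed.

Lemma diffop_scale c f z : entire f -> L (fun z => c * f z) z = c * L f z.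
Proof.
move=> ef; rewrite /diffop mulr_sumr; apply: eq_bigr => l _.
by rewrite (pd_scale _ _ _ ef) mulrCA.
Qed.

Lemma diffop_mul f g z : entire f -> entire g -> L (fun z => f z * g z) z = L f z * g z + f z * L g z.
Proof.
move=> ef eg; rewrite /diffop mulr_suml mulr_sumr -big_split; apply: eq_bigr => l _ /=.
by rewrite (pd_mul _ _ ef eg) mulrDr mulrA (mulrCA (f z)).
Qed.

Lemma diffop_exp f z : entire f -> L (fun z => expC (f z)) z = expC (f z) * L f z.
Proof.
move=> ef; rewrite /diffop mulr_sumr; apply: eq_bigr => l _.
by rewrite (pd_exp _ _ ef) mulrCA.
Qed.

Lemma diffop0 f : zerof f -> zerof (L f).
Proof.
move=> f0 z; rewrite (_ : f = fun=> 0); last by apply/funext.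
by rewrite /diffop big1// => l _; rewrite pd_cst mulr0.
Qed.

End DiffOp.

(** Eliminates [f] and [lf = L f]: [d d'] times the third equation, minus [d ld + d' d1] times the
    first, minus [d'^2] times the second. Here [d] and [d'] are [D] and its shift, [e], [e'] are the
    exponentials of [al], [-al], and [E], [E'] those of [be], [-be]. *)
Lemma elimination (K : fieldType) (i e e' E E' d d' f lf ld a la pa lpa b1 pb2 d1 l : K) :
  2 * i * d' * f = a * e - pa * e' ->
  2 * i * (d * lf - d1 * f) = - b1 * E + pb2 * E' ->
  2 * i * (ld * f + d' * lf) = la * e + a * (e * (i * l)) - (lpa * e' - pa * (e' * (i * l))) ->
  (d * d' * (a * i) * l + (d * d' * la - (d * ld + d' * d1) * a)) * e
  + (d * d' * (pa * i) * l + - (d * d' * lpa - (d * ld + d' * d1) * pa)) * e'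
  + d' ^+ 2 * b1 * E + - (d' ^+ 2 * pb2) * E' = 0.
Proof.
move=> H1 H2 H3.
transitivity (d * d' * (la * e + a * (e * (i * l)) - (lpa * e' - pa * (e' * (i * l))))
   - (d * ld + d' * d1) * (a * e - pa * e') - d' ^+ 2 * (- b1 * E + pb2 * E')); first by ring.
by rewrite -H1 -H2 -H3; ring.
Qed.

Section SolveSystem.
Variables (K : fieldType) (i k p1 p2 p3 p4 p5 p6 x y w E PE : K).
Variables (k2 : k * k = 1).
Variables (H1 : (p1 * x + p2 * y + p5 * w) + k * (i * (p3 * x + p4 * y + p6 * w)) = E).
Variables (H2 : (p1 * x + p2 * y + p5 * w) - k * (i * (p3 * x + p4 * y + p6 * w)) = PE).

(** Cramer's rule for the two linear forms; the multiple of [w = f] that would remain has the factor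
    [d2]. *)
Lemma solve_shift : p3 * p5 - p1 * p6 = 0 ->
  2 * i * (p1 * p4 - p2 * p3) * y = (k * p1 - i * p3) * E - (k * p1 + i * p3) * PE.
Proof.
move=> H3; rewrite -H1 -H2.
transitivity (2 * i * ((k * k) * p1 * (p3 * x + p4 * y + p6 * w) - p3 * (p1 * x + p2 * y + p5 * w))); last by ring.
rewrite k2 mul1r.
transitivity (2 * i * ((p1 * p4 - p2 * p3) * y - (p3 * p5 - p1 * p6) * w)); last by ring.
by rewrite H3; ring.
Qed.

Lemma solve_deriv : 2 * i * ((p1 * p4 - p2 * p3) * x - (p2 * p6 - p4 * p5) * w) =
  - (k * p2 - i * p4) * E + (k * p2 + i * p4) * PE.
Proof.
rewrite -H1 -H2.
transitivity (2 * i * (p4 * (p1 * x + p2 * y + p5 * w) - (k * k) * p2 * (p3 * x + p4 * y + p6 * w))); last by ring.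
by rewrite k2 mul1r; ring.
Qed.

End SolveSystem.

(** * The structure of the solutions *)

Section Core.
Variables (R : realType) (n : nat) (c : 'rV[R[i]]_n).
Local Notation C := R[i].
Local Notation E := 'rV[C]_n.

Lemma zerof_mul (f g : E -> C) : entire f -> entire g -> zerof (fun z => f z * g z) -> ~ zerof f -> zerof g.
Proof. by move=> ef eg H /nzerof[z fz]; exact: ent_id0 ef eg H fz. Qed.

Lemma zerof_pfun (P : mpoly n C) : zerof (pfun P) -> P = 0.
Proof. exact: pfun_eq0. Qed.

Lemma zerof_shift (f : E -> C) : zerof (shiftm c f) -> zerof f.
Proof. by move=> H z; have := H (z + c); rewrite /shiftm addrK. Qed.

(** Common source of both halves of the theorem. The second alternative also keeps the polynomial
    identity behind it, from which degrees are compared when [L] is a partial derivative. *)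
Lemma solution_structure (p p1 p2 p3 p4 p5 p6 : mpoly n C) (s : nat) (t : 'I_s -> 'I_n) (q : 'I_s -> mpoly n C) :
  p != 0 -> irreducible_mpoly p ->
  let d1 := p2 * p6 - p4 * p5 in
  let d2 := p3 * p5 - p1 * p6 in
  let D := p1 * p4 - p2 * p3 in
  let L := diffop t q in
  D != 0 -> d2 = 0 -> forall f : E -> C, entire f -> solves c p p1 p2 p3 p4 p5 p6 (L f) f ->
  exists (k : C) (g : E -> C),
    let a1 := k *: p1 - 'i *: p3 in
    let a2 := k *: p1 + 'i *: p3 in
    let b1 := k *: p2 - 'i *: p4 in
    let b2 := k *: p2 + 'i *: p4 in
    let gm := shiftm c g in
    let D' := shiftm c (pfun D) in
    let a' := shiftm c (pfun a1) in
    [/\ k = 1 \/ k = -1, entire g, has_form c p D a1 a2 g f &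
      [\/ constant_fun g,
          [/\ polynomial_fun (L gm), constant_fun (g \- gm) & exists2 e : C, e != 0 & forall z,
            pfun D z * D' z * (L a' z + a' z * ('i * L gm z)) - (pfun D z * L D' z + D' z * pfun d1 z) * a' z
            = e * (D' z ^+ 2 * pfun b1 z)],
          polynomial_fun (L gm) /\ constant_fun (g \+ gm) |
          [/\ transcendental (L gm), entire (g \+ gm) /\ ~ constant_fun (g \+ gm) &
            (a1 = 0 /\ b2 = 0) \/ (a2 = 0 /\ b1 = 0)]]].
Proof.
move=> p0 irr d1 d2 D L D0 d20 f ef Hs.
pose F z := pfun p1 z * L f z + pfun p2 z * shiftp c f z + pfun p5 z * f z.
pose H z := pfun p3 z * L f z + pfun p4 z * shiftp c f z + pfun p6 z * f z.
have epf (P : mpoly n C) : entire (pfun P) by apply: pf_ent; exact: pf_pfun.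
have eL := diffop_ent t q ef; have efc : entire (shiftp c f) := ent_shift c ef.
have eF : entire F by apply: ent_add; [apply: ent_add|]; apply: ent_mul.
have eH : entire H by apply: ent_add; [apply: ent_add|]; apply: ent_mul.
have i2 : 'i ^+ 2 = -1 :> C by exact: sqrCi.
(* The sign [k] records which of the two factors is zero free, so that both cases continue
   together. *)
have [k [k1 nz]] : exists k : C, (k = 1 \/ k = -1) /\ forall z, F z + k * ('i * H z) != 0.
  have UV z : (F z + 'i * H z) * (F z - 'i * H z) = pfun p z.
    rewrite -(Hs z) -/(F z) -/(H z); transitivity (F z ^+ 2 - 'i ^+ 2 * H z ^+ 2); first by ring.
    by rewrite i2; ring.
  have eiH : entire (fun z => 'i * H z) by exact: ent_scale.
  have [U0|V0] := factor_zero_free (ent_add eF eiH) (ent_sub eF eiH) UV p0 irr.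
    by exists 1; split; [left|move=> z; rewrite mul1r].
  by exists (-1); split; [right|move=> z; rewrite mulN1r].
have k2 : k * k = 1 by case: k1 => ->; rewrite ?mulr1 ?mulrNN ?mulr1.
have [h eh hE] := log_ent (ent_add eF (ent_scale k (ent_scale 'i eH))) nz.
pose g z := - 'i * h z; have eg : entire g by exact: ent_scale.
have ig z : 'i * g z = h z by rewrite /g mulrA mulrN -expr2 i2 opprK mul1r.
have Vh z : F z - k * ('i * H z) = pfun p z * expC (- h z).
  have e0 := expC_neq0 (h z); apply: (mulIf e0); rewrite expCN divfK// -hE.
  rewrite -(Hs z) -/(F z) -/(H z); transitivity (F z ^+ 2 - k * k * ('i ^+ 2 * H z ^+ 2)); first by ring.
  by rewrite k2 i2; ring.
exists k, g => a1 a2 b1 b2 gm D' a'.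
pose al z := 'i * gm z; pose be z := 'i * g z.
have egm : entire gm := ent_shift (- c) eg.
have eal : entire al by exact: ent_scale.
have ebe : entire be by exact: ent_scale.
have Ev (P Q : mpoly n C) x y z : pfun (x *: P + y *: Q) z = x * pfun P z + y * pfun Q z.
  by rewrite /pfun mevalD !mevalZ.
have a1E z : pfun a1 z = k * pfun p1 z - 'i * pfun p3 z by rewrite /a1 -scaleNr Ev mulNr.
have a2E z : pfun a2 z = k * pfun p1 z + 'i * pfun p3 z by rewrite Ev.
have b1E z : pfun b1 z = k * pfun p2 z - 'i * pfun p4 z by rewrite /b1 -scaleNr Ev mulNr.
have b2E z : pfun b2 z = k * pfun p2 z + 'i * pfun p4 z by rewrite Ev.
have DE z : pfun D z = pfun p1 z * pfun p4 z - pfun p2 z * pfun p3 z by rewrite /pfun mevalB !mevalM.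
have d1E z : pfun d1 z = pfun p2 z * pfun p6 z - pfun p4 z * pfun p5 z by rewrite /pfun mevalB !mevalM.
have d2E z : pfun p3 z * pfun p5 z - pfun p1 z * pfun p6 z = 0.
  by have := congr1 (fun P => pfun P z) d20; rewrite /pfun mevalB !mevalM meval0.
have eq1 z : 2 * 'i * pfun D z * f (z + c) = pfun a1 z * expC (h z) - pfun p z * pfun a2 z * expC (- h z).
  rewrite a1E a2E DE [pfun p z * _]mulrC -[_ * pfun p z * _]mulrA.
  exact: solve_shift k2 (hE z) (Vh z) (d2E z).
have eq2 z : 2 * 'i * (pfun D z * L f z - pfun d1 z * f z) =
    - pfun b1 z * expC (h z) + pfun p z * pfun b2 z * expC (- h z).
  rewrite b1E b2E DE d1E [pfun p z * _]mulrC -[_ * pfun p z * _]mulrA.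
  exact: solve_deriv k2 (hE z) (Vh z).
pose pa z := shiftm c (pfun p) z * shiftm c (pfun a2) z.
have eq1' z : 2 * 'i * D' z * f z = a' z * expC (al z) - pa z * expC (- al z).
  by have := eq1 (z - c); rewrite subrK /al /gm /shiftm ig.
have hf : has_form c p D a1 a2 g f.
  move=> z Dz; apply: (mulIf (_ : 2 * 'i * D' z != 0)).
    by rewrite !mulf_neq0 ?pnatr_eq0 ?neq0Ci.
  by rewrite divfK ?mulf_neq0 ?pnatr_eq0 ?neq0Ci// mulrC eq1'.
have pD' : polynomial_fun D' := pf_shift (- c) (pf_pfun D).
have pa' : polynomial_fun a' := pf_shift (- c) (pf_pfun a1).
have ppa : polynomial_fun pa := pf_mul (pf_shift (- c) (pf_pfun p)) (pf_shift (- c) (pf_pfun a2)).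
have eD' := pf_ent pD'; have ea' := pf_ent pa'; have epa := pf_ent ppa.
have eNal : entire (fun z => -1 * al z) by exact: ent_scale.
have Lal z : L al z = 'i * L gm z by exact: diffop_scale.
have eq3 z : 2 * 'i * (L D' z * f z + D' z * L f z) =
    L a' z * expC (al z) + a' z * (expC (al z) * L al z)
    - (L pa z * expC (- al z) - pa z * (expC (- al z) * L al z)).
  have fE : (fun z => 2 * 'i * (D' z * f z)) = fun z => a' z * expC (al z) + -1 * (pa z * expC (-1 * al z)).
    by apply/funext => x; rewrite mulrA eq1' !mulN1r.
  have := congr1 (fun G => L G z) fE.
  rewrite /= /L (diffop_scale t q _ z (ent_mul eD' ef)) (diffop_mul t q z eD' ef).
  rewrite (diffop_add t q z (ent_mul ea' (ent_exp eal)) (ent_scale (-1) (ent_mul epa (ent_exp eNal)))).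
  rewrite (diffop_scale t q _ z (ent_mul epa (ent_exp eNal))) (diffop_mul t q z ea' (ent_exp eal)).
  rewrite (diffop_mul t q z epa (ent_exp eNal)) (diffop_exp t q z eal) (diffop_exp t q z eNal).
  rewrite (diffop_scale t q _ z eal) -/L => ->.
  by rewrite !mulN1r !mulrN.
pose X z := pfun D z * L D' z + D' z * pfun d1 z.
pose m1 z := pfun D z * D' z * (a' z * 'i); pose n1 z := pfun D z * D' z * L a' z - X z * a' z.
pose m2 z := pfun D z * D' z * (pa z * 'i); pose n2 z := - (pfun D z * D' z * L pa z - X z * pa z).
pose P z := D' z ^+ 2 * pfun b1 z; pose S z := - (D' z ^+ 2 * (pfun p z * pfun b2 z)).
have main z : (m1 z * L gm z + n1 z) * expC (al z) + (m2 z * L gm z + n2 z) * expC (- al z)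
    + P z * expC (be z) + S z * expC (- be z) = 0.
  have e2 := eq2 z; have e3 := eq3 z; rewrite -(ig z) -/(be z) in e2; rewrite Lal in e3.
  exact: elimination (eq1' z) e2 e3.
have pDD' : polynomial_fun (fun z => pfun D z * D' z) := pf_mul (pf_pfun D) pD'.
have pX : polynomial_fun X :=
  pf_add (pf_mul (pf_pfun D) (diffop_pf t q pD')) (pf_mul pD' (pf_pfun d1)).
have pm1 : polynomial_fun m1 := pf_mul pDD' (pf_mul pa' (pf_cst n 'i)).
have pm2 : polynomial_fun m2 := pf_mul pDD' (pf_mul ppa (pf_cst n 'i)).
have pn1 : polynomial_fun n1 := pf_sub (pf_mul pDD' (diffop_pf t q pa')) (pf_mul pX pa').
have pn2 : polynomial_fun n2 := pf_opp (pf_sub (pf_mul pDD' (diffop_pf t q ppa)) (pf_mul pX ppa)).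
have pP : polynomial_fun P := pf_mul (pf_exp 2 pD') (pf_pfun b1).
have pS : polynomial_fun S := pf_opp (pf_mul (pf_exp 2 pD') (pf_mul (pf_pfun p) (pf_pfun b2))).
have gl : good al be (L gm).
  apply: (diffop_good t q eal ebe).
  have -> : gm = fun z => - 'i * al z.
    by apply/funext => z; rewrite /al mulrA mulNr -expr2 i2 opprK mul1r.
  exact: (good_mul eal ebe (good_cst eal ebe _) (good_base eal ebe).1).
have nD : ~ zerof (pfun D) by move=> /zerof_pfun Dz; move: D0; rewrite Dz eqxx.
have nD' : ~ zerof D' by move=> /zerof_shift.
have nDD' : ~ zerof (fun z => pfun D z * D' z).
  by move=> H0; apply: nD'; exact: zerof_mul (epf D) eD' H0 nD.
have ni : ~ zerof (fun _ : E => 'i : C) by move=> /(_ 0) /eqP; rewrite (negbTE (neq0Ci _)).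
have nD2 : ~ zerof (fun z => D' z ^+ 2).
  by move=> H0; apply: nD' => z; have /eqP := H0 z; rewrite expf_eq0 => /andP[_ /eqP].
have np : ~ zerof (pfun p) by move=> /zerof_pfun pz; move: p0; rewrite pz eqxx.
have za' : zerof m1 -> zerof a'.
  move=> H0; have eai : entire (fun z => a' z * 'i) by apply: ent_mul => //; exact: ent_cst.
  have H1 := zerof_mul (pf_ent pDD') eai H0 nDD'.
  by move=> z; have /eqP := H1 z; rewrite mulf_eq0 (negbTE (neq0Ci _)) orbF => /eqP.
have zpa : zerof m2 -> zerof pa.
  move=> H0; have eai : entire (fun z => pa z * 'i) by apply: ent_mul => //; exact: ent_cst.
  have H1 := zerof_mul (pf_ent pDD') eai H0 nDD'.
  by move=> z; have /eqP := H1 z; rewrite mulf_eq0 (negbTE (neq0Ci _)) orbF => /eqP.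
have za1 : zerof m1 -> a1 = 0 by move=> /za'/zerof_shift/zerof_pfun.
have za2 : zerof m2 -> a2 = 0.
  move=> /zpa H0; apply: zerof_pfun; apply: zerof_shift.
  apply: zerof_mul (pf_ent (pf_shift (- c) (pf_pfun p))) (pf_ent (pf_shift (- c) (pf_pfun a2))) H0 _.
  by move=> /zerof_shift.
have zb1 : zerof P -> b1 = 0.
  by move=> H0; apply: zerof_pfun; apply: zerof_mul (pf_ent (pf_exp 2 pD')) (epf b1) H0 nD2.
have zb2 : zerof S -> b2 = 0.
  move=> H0; apply: zerof_pfun; apply: (zerof_mul (epf p) (epf b2) _ np).
  apply: (zerof_mul (pf_ent (pf_exp 2 pD')) (ent_mul (epf p) (epf b2)) _ nD2).
  by move=> z; apply/eqP; rewrite -oppr_eq0; apply/eqP; exact: (H0 z).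
(* By this determinant [D != 0] leaves only [a1], [b2] or [a2], [b1] as pairs that can vanish
   together with one member from each product excluded. *)
have detE z : pfun a1 z * pfun b2 z - pfun a2 z * pfun b1 z = 2 * 'i * k * pfun D z.
  rewrite a1E a2E b1E b2E DE.
  by move: (pfun p1 z) (pfun p2 z) (pfun p3 z) (pfun p4 z) ('i : C) => *; ring.
have k0 : k != 0 by case: k1 => ->; rewrite ?oppr_eq0 oner_eq0.
have Dzero : (a1 = 0 \/ b2 = 0) -> (a2 = 0 \/ b1 = 0) -> False.
  have z0 z : pfun (0 : mpoly n C) z = 0 by rewrite /pfun meval0.
  move=> h1 h2; apply: nD => z; apply/eqP; have /esym/eqP := detE z.
  have -> : pfun a1 z * pfun b2 z = 0 by case: h1 => ->; rewrite z0 ?mul0r ?mulr0.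
  have -> : pfun a2 z * pfun b1 z = 0 by case: h2 => ->; rewrite z0 ?mul0r ?mulr0.
  by rewrite subr0 !mulf_eq0 pnatr_eq0 (negbTE (neq0Ci _)) (negbTE k0).
have zn1 : zerof m1 -> zerof n1.
  move=> /za' H0 z; have La0 : L a' z = 0 := diffop0 t q H0 z.
  by rewrite /n1 La0 (H0 z) !mulr0 subrr.
have zn2 : zerof m2 -> zerof n2.
  move=> /zpa H0 z; have La0 : L pa z = 0 := diffop0 t q H0 z.
  by rewrite /n2 La0 (H0 z) !mulr0 subrr oppr0.
have cstN (F0 : E -> C) : (exists x, forall z, 'i * F0 z = x) -> constant_fun F0.
  by move=> [x hx]; exists (- 'i * x) => z; rewrite -(hx z) mulrA mulNr -expr2 i2 opprK mul1r.
have [|||hb|[pl [x [hx HA]]]|[pl [x hx]]|[npl nc hz]] :=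
  exp_analysis eal ebe pm1 pm2 pn1 pn2 pP pS gl zn1 zn2 _ _ _ main.
- by move=> [/za1 ? /zb1 ?]; apply: Dzero; [left|right].
- by move=> [/za2 ? /zb2 ?]; apply: Dzero; [right|left].
- by move=> [/zb1 ? /zb2 ?]; apply: Dzero; right.
- split=> //; constructor 1; exact: cstN.
- split=> //; constructor 2; split=> //.
    by apply: cstN; exists x => z; rewrite -(hx z) /be /al -mulrBr.
  exists (- expC x); first by rewrite oppr_eq0 expC_neq0.
  have alg (dd la a l x0 : C) : dd * (la + a * ('i * l)) - x0 = dd * (a * 'i) * l + (dd * la - x0) by ring.
  by move=> z; rewrite mulNr -HA; exact: alg.
- split=> //; constructor 3; split=> //.
  by apply: cstN; exists x => z; rewrite -(hx z) /be /al -mulrDr addrC.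
- split=> //; constructor 4; split.
  + exact: (conj (diffop_ent t q egm) npl).
  + split; first exact: (ent_add eg egm).
    by move=> [x hx]; apply: nc; exists ('i * x) => z; rewrite -(hx z) /be /al -mulrDr addrC.
  + case: hz => -[h1 h2]; [left|right]; split; [exact: za1|exact: zb2|exact: za2|exact: zb1].
Qed.

End Core.

(** * Degrees in one variable *)

Section Degree.
Variables (R : realType) (n : nat) (j : 'I_n).
Local Notation C := R[i].
Local Notation E := 'rV[C]_n.
Implicit Types (P Q : mpoly n C) (z : E).

Lemma poly_eq_eval (p q : {poly C}) : (forall w, p.[w] = q.[w]) -> p = q.
Proof.
move=> H; have [l Hl] := interpolation R (size (p - q)).
apply/eqP; rewrite -subr_eq0 (Hl (p - q) (leqnSn _)); apply/eqP.
by rewrite big1// => k _; rewrite hornerD hornerN H subrr scale0r.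
Qed.

(** On the line [z + w c] the polynomial satisfies [q (w + 1) = - q w], whereas the substitution
    preserves the leading coefficient. *)
Lemma antiperiodic (f : E -> C) (c : E) : polynomial_fun f -> (forall z, f (z + c) = - f z) -> zerof f.
Proof.
move=> pf H z; have [A [d HA]] := pf_growth pf; have [l Hl] := interpolation R d.
have [+ _] := line_interpolation z c (pf_ent pf) HA Hl; set q := \poly_(_ < _) _ => qE.
have qc : q \Po ('X + 1%:P) = - q.
  apply: poly_eq_eval => w; rewrite horner_comp hornerN !hornerE !qE -H; congr f.
  by rewrite scalerDl scale1r addrA.
suff q0 : q = 0 by rewrite -[z]addr0 -(scale0r c) -qE q0 horner0.
have s1 : (1 < size ('X + 1%:P : {poly C})%R)%N by rewrite size_XaddC.
have := lead_coef_comp q s1; rewrite lead_coefXaddC expr1n mulr1 qc lead_coefN => /eqP.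
by rewrite -subr_eq0 -opprD oppr_eq0 -mulr2n mulrn_eq0 /= lead_coef_eq0 => /eqP.
Qed.

Definition upd z (w : C) : E := \row_i (if i == j then w else z 0 i).

Definition line_poly_in P z : {poly C} :=
  \sum_(m <- msupp P) (mcoeff m P * \prod_(i | i != j) z 0 i ^+ m i) *: 'X^(m j).

Lemma line_poly_inE P z w : (line_poly_in P z).[w] = pfun P (upd z w).
Proof.
rewrite /pfun mevalE horner_sum; apply: eq_bigr => m _.
rewrite hornerZ hornerXn -mulrA; congr (_ * _); rewrite [RHS](bigD1 j)//= mxE eqxx mulrC.
by congr (_ * _); apply: eq_bigr => i ij; rewrite mxE (negbTE ij).
Qed.

Definition degj P : nat := (\max_(m <- msupp P) m j)%N.

Lemma size_line_poly P z : (size (line_poly_in P z) <= (degj P).+1)%N.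
Proof.
apply: leq_trans (size_sum _ _ _) _; apply/bigmax_leqP_seq => m mP _.
apply: leq_trans (size_scale_leq _ _) _; rewrite size_polyXn ltnS.
by rewrite /degj (big_rem m)//= leq_maxl.
Qed.

Lemma max_attained (T : eqType) (s : seq T) (F : T -> nat) : s != [::] ->
  exists2 x, x \in s & F x = (\max_(x <- s) F x)%N.
Proof.
elim: s => [//|x s IH] _; rewrite big_cons; have [->|/IH[y ys yE]] := eqVneq s [::].
  by exists x; rewrite ?mem_head// big_nil maxn0.
have [xy|xy] := leqP (F x) (F y).
  by exists y; [rewrite inE ys orbT|rewrite -yE; apply/esym/maxn_idPr].
by exists x; [rewrite mem_head|rewrite -yE; apply/esym/maxn_idPl; exact: ltnW].
Qed.

(** The degree in the variable [j] drops only where [top], the sum of the terms of maximal degree in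
    that variable, vanishes. *)
Lemma gen_size P : P != 0 -> gen (fun z => size (line_poly_in P z) = (degj P).+1).
Proof.
move=> P0; pose top := \sum_(m <- msupp P | m j == degj P) mcoeff m P *: mpolyX C m.
have [m0 m0P m0E] : exists2 m, m \in msupp P & m j = degj P.
  by apply: (max_attained (fun m : multinom n => m j)); rewrite msupp_eq0.
have t0 : top != 0.
  apply/eqP => /(congr1 (mcoeff m0)); rewrite mcoeff0 raddf_sum /= big_mkcond /= (bigD1_seq m0) ?msupp_uniq//= m0E eqxx.
  rewrite mcoeffZ mcoeffX eqxx mulr1 big1 ?addr0 => [/eqP|m mm].
    by rewrite mcoeff_eq0 m0P.
  by case: ifP => // _; rewrite mcoeffZ mcoeffX (negbTE mm) mulr0.
exists (pfun top); split; first by apply: pf_ent; exact: pf_pfun.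
  by apply: nzerof => /pfun_eq0 h; rewrite h eqxx in t0.
move=> z tz; apply/eqP; rewrite eqn_leq size_line_poly /= ltnNge; apply: contra tz => sz.
have : (line_poly_in P z)`_(degj P) * z 0 j ^+ degj P = pfun top z; last first.
  by move=> <-; rewrite nth_default// mul0r.
rewrite /pfun raddf_sum /= coef_sum mulr_suml [RHS]big_mkcond /=; apply: eq_bigr => m _.
rewrite coefZ coefXn eq_sym; case: eqP => [mj|_]; last by rewrite mulr0 mul0r.
by rewrite mevalZ mevalX [in RHS](bigD1 j)//= -mj mulr1 -mulrA [X in _ * X]mulrC.
Qed.

Lemma deg_shift_le P Q (c : E) : P != 0 -> (forall z, pfun P z = pfun Q (z + c)) -> (degj P <= degj Q)%N.
Proof.
move=> P0 H; have [z zE] := gen_ex (gen_size P0).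
have e : line_poly_in P z = line_poly_in Q (z + c) \Po ('X + (c 0 j)%:P).
  apply: poly_eq_eval => w; rewrite horner_comp !line_poly_inE H !hornerE; congr (pfun Q _).
  by apply/rowP => i; rewrite !mxE; case: eqP => // ->.
by rewrite -ltnS -zE e size_comp_poly2 ?size_XaddC// size_line_poly.
Qed.

Lemma deg_shift P Q (c : E) : P != 0 -> Q != 0 -> (forall z, pfun P z = pfun Q (z + c)) -> degj P = degj Q.
Proof.
move=> P0 Q0 H; apply/eqP; rewrite eqn_leq (deg_shift_le P0 H) /=.
by apply: (@deg_shift_le _ _ (- c)) => // z; rewrite H subrK.
Qed.

Lemma line_poly_deriv P z w : ((line_poly_in P z)^`()).[w] = pderiv j (pfun P) (upd z w).
Proof.
have uE x : upd z x = upd z 0 + x *: delta_mx 0 j.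
  by apply/rowP => i; rewrite !mxE eqxx /=; case: eqP => _; rewrite ?mulr1 ?mulr0 ?add0r ?addr0.
have h1 := cder_horner (line_poly_in P z) w.
have h2 := line_cdiff (upd z 0) (delta_mx 0 j) w (pf_ent (pf_pfun P)).
rewrite -uE dird_delta in h2; apply: cdiff_uniq h1 _.
by move: h2; congr cdiff; apply/funext => x; rewrite line_poly_inE -uE.
Qed.

(** The terms with a derivative have lower degree than [x x' y w], which occurs with the factor [i].
    A size is a degree plus one: four sizes on the right against one on the left leave the 3. *)
Lemma size_bracket (x x' y w : {poly C}) : x != 0 -> x' != 0 -> y != 0 -> w != 0 ->
  (size (x * (x' * (y^`() + 'i *: (y * w)) - x'^`() * y))%R + 3 = size x + size x' + size y + size w)%N.
Proof.
move=> x0 x0' y0 w0; have yw : y * w != 0 by rewrite mulf_neq0.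
have i0 : 'i != 0 :> C by exact: neq0Ci.
have e : x' * (y^`() + 'i *: (y * w)) - x'^`() * y = 'i *: (x' * (y * w)) + (x' * y^`() - x'^`() * y).
  by rewrite -!mul_polyC; ring.
have s1 : size ('i *: (x' * (y * w))) = (size x' + (size y + size w).-1).-1.
  by rewrite size_scale// !size_mul.
have dy := lt_size_deriv y0; have dx := lt_size_deriv x0'.
have px : (0 < size x)%N by rewrite size_poly_gt0.
have px' : (0 < size x')%N by rewrite size_poly_gt0.
have py : (0 < size y)%N by rewrite size_poly_gt0.
have pw : (0 < size w)%N by rewrite size_poly_gt0.
have s2 : (size (x' * y^`() - x'^`() * y)%R < size ('i *: (x' * (y * w)))%R)%N.
  rewrite s1; apply: leq_ltn_trans (size_polyD _ _) _; rewrite size_polyN gtn_max.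
  have nat1 (k l m r : nat) : (l < m -> 0 < k -> 0 < r -> (k + l).-1 < (k + (m + r).-1).-1)%N by lia.
  have nat2 (k l m r : nat) : (k < l -> 0 < m -> 0 < r -> (k + m).-1 < (l + (m + r).-1).-1)%N by lia.
  by apply/andP; split; apply: leq_ltn_trans (size_polyMleq _ _) _; [exact: nat1|exact: nat2].
have nat3 (k l m r : nat) : (0 < k -> 0 < l -> 0 < m -> 0 < r ->
    (k + (l + (m + r).-1).-1).-1 + 3 = k + l + m + r)%N by lia.
have nz : 'i *: (x' * (y * w)) + (x' * y^`() - x'^`() * y) != 0.
  by rewrite -size_poly_gt0 size_polyDl// (leq_ltn_trans _ s2).
by rewrite e size_mul// size_polyDl// s1; exact: nat3.
Qed.

(** At a generic point the degrees in the variable [j] give [deg D + deg D' + deg a + deg w = 2 deg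
    D' + deg b], and [deg D = deg D'] cancels. *)
Lemma degree_identity (D D' a w b : mpoly n C) (e : C) : D != 0 -> D' != 0 -> a != 0 -> w != 0 -> e != 0 ->
  degj D = degj D' ->
  (forall z, pfun D z * pfun D' z * (pderiv j (pfun a) z + pfun a z * ('i * pfun w z))
     - pfun D z * pderiv j (pfun D') z * pfun a z = e * (pfun D' z ^+ 2 * pfun b z)) ->
  b != 0 /\ (degj w + degj a = degj b)%N.
Proof.
move=> D0 D0' a0 w0 e0 dD H.
pose x := line_poly_in D; pose x' := line_poly_in D'; pose y := line_poly_in a.
pose u := line_poly_in w; pose v := line_poly_in b.
have HE z : x z * (x' z * ((y z)^`() + 'i *: (y z * u z)) - (x' z)^`() * y z) = e *: (x' z ^+ 2 * v z).
  have alg (k l da al dl be : C) :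
      k * (l * (da + 'i * (al * be)) - dl * al) = k * l * (da + al * ('i * be)) - k * dl * al by ring.
  apply: poly_eq_eval => t0; rewrite !(hornerM, hornerD, hornerN, hornerZ, horner_exp).
  by rewrite !line_poly_deriv !line_poly_inE alg; exact: H.
have g4 := gen_and (gen_and (gen_size D0) (gen_size D0')) (gen_and (gen_size a0) (gen_size w0)).
have sz z (P : mpoly n C) : size (line_poly_in P z) = (degj P).+1 -> line_poly_in P z != 0.
  by move=> h; rewrite -size_poly_gt0 h.
have b0 : b != 0.
  have [z [[h1 h2] [h3 h4]]] := gen_ex g4; apply/eqP => bz.
  have := size_bracket (sz _ _ h1) (sz _ _ h2) (sz _ _ h3) (sz _ _ h4).
  rewrite HE (_ : v z = 0); last by rewrite /v /line_poly_in bz msupp0 big_nil.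
  by rewrite mulr0 scaler0 size_poly0 h1 h2 h3 h4; lia.
split=> //; have [z [[[h1 h2] [h3 h4]] h5]] := gen_ex (gen_and g4 (gen_size b0)).
have := size_bracket (sz _ _ h1) (sz _ _ h2) (sz _ _ h3) (sz _ _ h4).
rewrite HE size_scale// expr2 !size_mul ?mulf_neq0 ?sz// -/x' h1 h2 h3 h4 h5 dD; lia.
Qed.

End Degree.

Section PartialDerivative.
Variables (R : realType) (n : nat) (j : 'I_n).
Local Notation C := R[i].

Lemma diffop_pderiv : diffop (fun _ : 'I_1 => j) (fun _ => 1 : mpoly n C) = pderiv j.
Proof.
by apply/funext => f; apply/funext => z; rewrite /diffop big_ord1 /pfun meval1 mul1r.
Qed.

End PartialDerivative.

Theorem theorem3p1 (R : realType) (n : nat) (c : 'rV[R[i]]_n)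
    (p p1 p2 p3 p4 p5 p6 : mpoly n R[i])
    (s : nat) (t : 'I_s -> 'I_n) (q : 'I_s -> mpoly n R[i])
    (n_ge1 : (1 <= n)%N) (c_neq0 : c != 0)
    (p_neq0 : p != 0) (p_irr : irreducible_mpoly p)
    (s_bounds : (1 <= s <= n)%N)
    (t_incr : forall l m : 'I_s, (l < m)%N -> (t l < t m)%N)
    (q_neq0 : forall l : 'I_s, q l != 0) :
  let d1 := p2 * p6 - p4 * p5 in
  let d2 := p3 * p5 - p1 * p6 in
  let D := p1 * p4 - p2 * p3 in
  let L := diffop t q in
  D != 0 -> d2 = 0 ->
  (forall f : 'rV[R[i]]_n -> R[i], entire f ->
    solves c p p1 p2 p3 p4 p5 p6 (L f) f ->
    exists (k : R[i]) (g : 'rV[R[i]]_n -> R[i]),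
      let a1 := k *: p1 - 'i *: p3 in
      let a2 := k *: p1 + 'i *: p3 in
      let b1 := k *: p2 - 'i *: p4 in
      let b2 := k *: p2 + 'i *: p4 in
      let gm := shiftm c g in
      [/\ k = 1 \/ k = -1,
          entire g,
          has_form c p D a1 a2 g f &
          [\/ constant_fun g,
              polynomial_fun (L gm) /\
                (constant_fun (g \+ gm) \/ constant_fun (g \- gm)) |
              [/\ transcendental (L gm),
                  entire (g \+ gm) /\ ~ constant_fun (g \+ gm) &
                  (a1 = 0 /\ b2 = 0) \/ (a2 = 0 /\ b1 = 0)]]])
  /\
  (forall j : 'I_n, d1 = 0 ->
    forall f : 'rV[R[i]]_n -> R[i], entire f ->
    solves c p p1 p2 p3 p4 p5 p6 (pderiv j f) f ->
    exists (k : R[i]) (g : 'rV[R[i]]_n -> R[i]),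
      let a1 := k *: p1 - 'i *: p3 in
      let a2 := k *: p1 + 'i *: p3 in
      let b1 := k *: p2 - 'i *: p4 in
      let b2 := k *: p2 + 'i *: p4 in
      let gm := shiftm c g in
      [/\ k = 1 \/ k = -1,
          entire g,
          has_form c p D a1 a2 g f &
          [\/ constant_fun g,
              (forall z, pderiv j g z = 0) /\
                (constant_fun (g \+ gm) \/ constant_fun (g \- gm)),
              [/\ exists2 P : mpoly n R[i], P != 0 & pderiv j g =1 pfun P,
                  constant_fun (g \- gm) &
                  exists2 Q : mpoly n R[i], pderiv j gm =1 pfun Q &
                    deg_in j Q = (deg_in j b1 - deg_in j a1)%E \/
                    deg_in j Q = (deg_in j b2 - deg_in j a2)%E] |
              [/\ transcendental (pderiv j g),
                  entire (g \+ gm) /\ ~ constant_fun (g \+ gm) &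
                  (a1 = 0 /\ b2 = 0) \/ (a2 = 0 /\ b1 = 0)]]]).

Proof.
move=> d1 d2 D L D0 d20; split=> [f ef Hs|j d10 f ef Hs].
  have [k [g [k1 eg hf H]]] := solution_structure p_neq0 p_irr D0 d20 ef Hs.
  exists k, g => a1 a2 b1 b2 gm; split=> //; case: H => [h|[h1 h2 _]|[h1 h2]|h].
  - by constructor 1.
  - by constructor 2; split=> //; right.
  - by constructor 2; split=> //; left.
  - by constructor 3.
(* The partial derivative is the operator [L] with one summand and coefficient 1. *)
have := solution_structure (c := c) (t := fun _ : 'I_1 => j) (q := fun _ => 1) p_neq0 p_irr D0 d20 ef.
rewrite diffop_pderiv => /(_ Hs)[k [g [k1 eg hf H]]].
exists k, g => a1 a2 b1 b2 gm; split; [exact: k1|exact: eg|exact: hf|].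
have gz z : pderiv j g z = pderiv j gm (z + c).
  by rewrite /gm /shiftm (pd_shift j (- c) _ eg) addrK.
have zg : zerof (pderiv j gm) -> forall z, pderiv j g z = 0 by move=> h z; rewrite gz h.
have gmz z : pderiv j gm z = pderiv j g (z - c) by rewrite gz subrK.
have egm : entire gm := ent_shift (- c) eg.
case: H => [h|[h1 h2 [e e0 he]]|[h1 [x hx]]|[[h1 h1'] h2 h3]].
- by constructor 1.
- have [h0|/nzerof[z0 hz0]] := pselect (zerof (pderiv j gm)).
    by constructor 2; split; [exact: zg|right].
  have [Q QE] := h1; have [P PE] := pf_shift c h1.
  have Q0 : Q != 0 by apply: contraNneq hz0 => Q0; rewrite QE Q0 /pfun meval0.
  constructor 3; split; [|exact: h2|].
    exists P => [|z]; last by rewrite gz PE.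
    by apply: contraNneq hz0 => P0; rewrite -(subrK c z0) PE P0 /pfun meval0.
  (* The identity kept in [solution_structure] always yields the alternative with [b1] and [a1]. *)
  exists Q => //; left.
  have [D' DE'] := pf_shift (- c) (pf_pfun D); have [a' aE'] := pf_shift (- c) (pf_pfun a1).
  have D0' : D' != 0.
    apply/eqP => Dz; move/eqP: D0; apply; apply: pfun_eq0 => z.
    by rewrite -[z](addrK c) DE' Dz /pfun meval0.
  have a1a' : a' = 0 -> a1 = 0.
    by move=> az; apply: pfun_eq0 => z; rewrite -[z](addrK c) aE' az /pfun meval0.
  have shE (P0 P1 : mpoly n R[i]) : (forall z, pfun P0 (z - c) = pfun P1 z) -> shiftm c (pfun P0) = pfun P1.
    by move=> hP; apply/funext => z; exact: hP.
  have he' z : pfun D z * pfun D' z * (pderiv j (pfun a') z + pfun a' z * ('i * pfun Q z))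
     - pfun D z * pderiv j (pfun D') z * pfun a' z = e * (pfun D' z ^+ 2 * pfun b1 z).
    have := he z; rewrite (shE _ _ DE') (shE _ _ aE') QE.
    by rewrite (_ : p2 * p6 - p4 * p5 = 0) // /pfun meval0 mulr0 addr0.
  (* If [a1 = 0], the identity forces [b1 = 0], and then [D = 0]. This excludes the value [-oo] of
     [deg_in] for [a1]. *)
  have a10 : a1 != 0.
    apply/eqP => a10; have a0' : a' = 0.
      by apply: pfun_eq0 => z; rewrite -aE' a10 /pfun meval0.
    have k2 : k * k = 1 by case: k1 => ->; rewrite ?mulr1 ?mulrNN ?mulr1.
    have b10 : b1 = 0.
      apply: pfun_eq0; apply: (zerof_mul (f := fun z => pfun D' z ^+ 2)).
      - by apply: pf_ent; apply: pf_exp; exact: pf_pfun.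
      - by apply: pf_ent; exact: pf_pfun.
      - move=> z; have a0z x : pfun a' x = 0 by rewrite a0' /pfun meval0.
        have pa0 : pderiv j (pfun a') z = 0.
          by rewrite (_ : pfun a' = fun=> 0) ?pd_cst//; apply/funext.
        have := he' z; rewrite pa0 a0z mul0r addr0 !mulr0 subrr => /esym/eqP.
        by rewrite mulf_eq0 (negbTE e0) => /eqP.
      - move=> h; move/eqP: D0'; apply; apply: pfun_eq0 => z.
        by have /eqP := h z; rewrite expf_eq0 => /andP[_ /eqP].
    move/eqP: D0; apply; have e1 : k *: p1 = 'i *: p3 by apply/eqP; rewrite -subr_eq0; apply/eqP.
    have e2 : k *: p2 = 'i *: p4 by apply/eqP; rewrite -subr_eq0; apply/eqP.
    rewrite /D -[p1 * _]scale1r -[p2 * _]scale1r -k2 -!scalerA !scalerAl e1 e2 -!scalerAl.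
    by rewrite [p4 * _]mulrC subrr.
  have a0' : a' != 0 by apply/eqP => /a1a' h; rewrite h eqxx in a10.
  have dDD : degj j D = degj j D' by apply: (@deg_shift _ _ j _ _ c) => // z; rewrite -DE' addrK.
  have daa : degj j a1 = degj j a' by apply: (@deg_shift _ _ j _ _ c) => // z; rewrite -aE' addrK.
  have [b10 db] := degree_identity D0 D0' a0' Q0 e0 dDD he'.
  rewrite /deg_in (negbTE Q0) (negbTE b10) (negbTE a10) -/(degj j Q) -/(degj j b1) -/(degj j a1) daa -db.
  by rewrite -EFinB PoszD addrK.
- constructor 2; split; last by left; exists x.
  (* When [g + gm] is constant, the polynomial [pderiv j gm] changes sign under the shift by [c],
     hence vanishes. *)
  apply: zg; apply: (antiperiodic (c := c)) => // z.
  have gE : g = fun y => x + -1 * gm y.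
    by apply/funext => y; rewrite -(hx y) mulN1r addrK.
  by rewrite -gz {1}gE (pd_add j z (@ent_cst R n x) (ent_scale (-1) egm)) pd_cst add0r (pd_scale j (-1) z egm) mulN1r.
- constructor 4; split; [|exact: h2|exact: h3]; split; first exact: ent_pd.
  move=> /(pf_shift (- c)) h; apply: h1'; exact: (pf_ext (fun z => esym (gmz z)) h).
Qed.
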